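(* Let $(\Pi(t),t\ge0)$ be a self-similar fragmentation process, with index $a\in\mathbb R$ and dislocation measure $\nu$ with infinite total mass. Then the entire process $(\Pi(t),t\ge0)$ can be constructed from the consistent sequence $(T_{[n]},n\ge1)$ of combinatorial shapes of trees derived from $\Pi$; that is, $(\Pi(t),t\ge0)$ is almost surely equal to a measurable function (depending on $(a,\nu)$) of $(T_{[n]},n\ge1)$.
   Context: **Mass partitions, paintboxes.** $\mathcal S^\downarrow=\{\mathbf s=(s_i)_{i\ge1}: s_1\ge s_2\ge\cdots\ge0,\ \sum_i s_i\le1\}$, $[n]=\{1,\dots,n\}$. $\mathbb P_{\mathbf s}$ is the law of an exchangeable random partition of $\mathbb N$ with ranked asymptotic block frequencies $\mathbf s$ (Kingman's paintbox), and for a measure $\nu$ on $\mathcal S^\downarrow$, $\mathbb P_\nu=\int \mathbb P_{\mathbf s}\,\nu(d\mathbf s)$. For a composition $(n_1,\dots,n_k)$ of $n$ into positive integers, $p_\nu(n_1,\dots,n_k)$ is the $\mathbb P_\nu$-measure of the event that the restriction of the partition to $[n]$ equals a given partition with block sizes $n_1,\dots,n_k$. **Dislocation measures and fragmentations.** A dislocation measure is a nonzero measure $\nu$ on $\mathcal S^\downarrow$ with no atom at $(1,0,0,\dots)$, $\int(1-s_1)\nu(d\mathbf s)<\infty$ and (standing assumption) $\nu(\sum_i s_i<1)=0$; fragmentations have no erosion. The homogeneous fragmentation $\Pi^0$ with dislocation measure $\nu$ is the càdlàg process of partitions of $\mathbb N$, started from the one-block partition, whose restriction to $[n]$, for each $n$,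 is a Markov chain in which each block $B$ splits, independently of the others, into $\{B_1,\dots,B_k\}$ ($k\ge2$) at rate $p_\nu(\#B_1,\dots,\#B_k)$. The self-similar fragmentation $\Pi$ with parameters $(a,\nu)$, $a\in\mathbb R$, is obtained by time-change: writing $\Pi^0_{(i)}(t)$ for the block containing $i$ and $|\cdot|$ for asymptotic frequency, the block of $\Pi(t)$ containing $i$ is $\Pi^0_{(i)}(\tau_i(t))$ with $\tau_i(t)=\inf\{u:\int_0^u|\Pi^0_{(i)}(r)|^{-a}dr>t\}$ ($\{i\}$ if $\tau_i(t)=\infty$). **Combinatorial trees.** $T_{[n]}$ is the tree whose vertices are all blocks occurring in the evolution of $\Pi\cap[n]$ (the restriction of $\Pi$ to $[n]$), with edges given by the parent/child relation for inclusion; its leaves are the singletons $\{1\},\dots,\{n\}$ and its first branch point is $[n]$. It records no time information. *)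

(* Defs.v *)
From HB Require Import structures.
From mathcomp Require Import all_boot all_order all_algebra.
From mathcomp Require Import all_classical all_reals all_analysis.

Set Implicit Arguments.
Unset Strict Implicit.
Unset Printing Implicit Defensive.

Import Order.TTheory GRing.Theory Num.Theory numFieldNormedType.Exports.

Local Open Scope classical_set_scope.
Local Open Scope ring_scope.

(** Conventions: the natural numbers start at 0, so that mass sequences are
    indexed from 0, partitions of N are partitions of [nat], and
    [[n] = {1, ..., n}] is ['I_n].  Time is a nonnegative element of [R]; values
    of processes at negative times are never used. *)

(** * Mass partitions *)

Record mass_partition (R : realType) := MassPartition {
  mass :> nat -> R ;
  mass_partitionP : [/\ forall i, mass i.+1 <= mass i, forall i, 0 <= mass i &
    (\sum_(0 <= i <oo) (mass i)%:E <= 1)%E] }.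

HB.instance Definition _ (R : realType) := gen_eqMixin (mass_partition R).
HB.instance Definition _ (R : realType) := gen_choiceMixin (mass_partition R).

Definition total_mass (R : realType) (s : mass_partition R) : \bar R :=
  (\sum_(0 <= i <oo) (s i)%:E)%E.

Lemma unit_massP (R : realType) (e : nat -> R := fun i => (i == 0)%:R) :
  [/\ forall i, e i.+1 <= e i, forall i, 0 <= e i &
    (\sum_(0 <= i <oo) (e i)%:E <= 1)%E].
Proof.
split=> [i|i|]; rewrite /e ?ler0n//.
have -> : (\sum_(0 <= i <oo) (((i == 0)%:R : R)%:E) = 1)%E; last by [].
rewrite (@nneseries_split _ _ 0 1); last by move=> k _; rewrite lee_fin ler0n.
by rewrite add0n big_nat1 eseries0 ?adde0//; case.
Qed.

Definition unit_mass (R : realType) : mass_partition R :=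
  MassPartition (@unit_massP R).

HB.instance Definition _ (R : realType) :=
  isPointed.Build (mass_partition R) (unit_mass R).

Definition mass_partition_cylinders (R : realType) :
    set (set (mass_partition R)) :=
  [set A | exists i (B : set R),
     measurable B /\ A = [set s : mass_partition R | B (s i)]].

HB.instance Definition _ (R : realType) := Measurable.copy (mass_partition R)
  (g_sigma_algebraType (@mass_partition_cylinders R)).

(** * Partitions of N *)

(** A partition is encoded by the relation "being in the same block", so that
    [pi i : pred nat] is the block of [pi] containing [i]. *)
Record nat_partition := NatPartition {
  same_block :> rel nat ;
  nat_partitionP : [/\ reflexive same_block, symmetric same_block &
    transitive same_block] }.

HB.instance Definition _ := gen_eqMixin nat_partition.
HB.instance Definition _ := gen_choiceMixin nat_partition.

Definition one_block : nat_partition :=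
  @NatPartition (fun _ _ => true)
    (And3 (fun _ => erefl) (fun _ _ => erefl) (fun _ _ _ _ _ => erefl)).

HB.instance Definition _ := isPointed.Build nat_partition one_block.

Definition nat_partition_cylinders : set (set nat_partition) :=
  [set A | exists i j, A = [set pi : nat_partition | pi i j]].

HB.instance Definition _ := Measurable.copy nat_partition
  (g_sigma_algebraType nat_partition_cylinders).

Definition restriction (n : nat) (pi : nat_partition) : {set {set 'I_n}} :=
  equivalence_partition (fun i j : 'I_n => pi i j) [set: 'I_n]%SET.

(** Equal to 0 by convention when the limit does not exist. *)
Definition asymptotic_frequency (R : realType) (B : pred nat) : R :=
  lim ((fun n => (\sum_(i < n) B i)%:R / n%:R : R) @ \oo).

(** * Paintboxes and the function p_nu *)

(** In the paintbox based on [s] the integers receive i.i.d. colours, equal to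
    [Some k] with probability [s k] and to [None] (dust) with the remaining
    probability; integers sharing a colour [Some k] form a block, and
    integers coloured [None] are singletons. *)
Definition colour_mass (R : realType) (s : mass_partition R)
    (c : option nat) : R :=
  if c is Some k then s k else 1 - fine (total_mass s).

Definition colour_partition (n : nat) (x : {ffun 'I_n -> option nat}) :
    {set {set 'I_n}} :=
  equivalence_partition (fun i j => (i == j) || (x i == x j) && (x i != None))
    [set: 'I_n]%SET.

(** [P_s (restriction to [n] = D)] *)
Definition paintbox_prob (R : realType) (s : mass_partition R) (n : nat)
    (D : {set {set 'I_n}}) : \bar R :=
  \esum_(x in [set x : {ffun 'I_n -> option nat} | colour_partition x = D])
    (\prod_(i < n) colour_mass s (x i))%:E.

(** The partition of [n_1 + ... + n_k] into successive intervals of lengths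
    [n_1, ..., n_k]. *)
Definition interval_partition (c : seq nat) : {set {set 'I_(sumn c)}} :=
  equivalence_partition
    (fun i j : 'I_(sumn c) => reshape_index c i == reshape_index c j)
    [set: 'I_(sumn c)]%SET.

Definition p_ (R : realType) (nu : {measure set (mass_partition R) -> \bar R})
    (c : seq nat) : \bar R :=
  (\int[nu]_s paintbox_prob s (interval_partition c))%E.

(** * Dislocation measures *)

Record dislocation_measure (R : realType)
    (nu : {measure set (mass_partition R) -> \bar R}) : Prop := {
  dislocation_neq0 : nu setT <> 0%E ;
  dislocation_no_atom : nu [set unit_mass R] = 0%E ;
  dislocation_integrable : (\int[nu]_s (1 - s 0)%:E < +oo)%E ;
  dislocation_conservative : nu [set s | (total_mass s < 1)%E] = 0%E }.

(** * Homogeneous fragmentations *)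

(** Rate of [x -> y] for partitions of [[n]]: sum, over the blocks [B] of [x]
    and the partitions [D] of [B] into at least 2 blocks, of [p_nu] of the block
    sizes of [D], when [y] is [x] with [B] replaced by [D]. At most one pair
    [(B, D)] contributes, and each [p_nu] involved is finite when [nu] is a
    dislocation measure. *)
Definition split_rate (R : realType)
    (nu : {measure set (mass_partition R) -> \bar R}) (n : nat)
    (x y : {set {set 'I_n}}) : R :=
  \sum_(B in x) \sum_(D : {set {set 'I_n}} |
      [&& finset.partition D B, (1 < #|D|)%N & y == (D :|: (x :\ B))%SET])
    fine (p_ nu [seq #|C : {set 'I_n}| | C <- enum D]).

(** The sum of the splitting mechanisms of the separate blocks: this is the
    generator for blocks splitting independently of each other. *)
Definition split_generator (R : realType)
    (nu : {measure set (mass_partition R) -> \bar R}) (n : nat) :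
    'M[R]_#|{set {set 'I_n}}| :=
  \matrix_(i, j) if i == j
    then - \sum_(z | z != enum_val i) split_rate nu (enum_val i) z
    else split_rate nu (enum_val i) (enum_val j).

(** Entries of [exp (t Q)] *)
Definition transition (R : realType) (S : finType) (Q : 'M[R]_#|S|) (t : R)
    (x y : S) : R :=
  lim (series (fun k => t ^+ k / k`!%:R
                        * (Q ^+ k) (enum_rank x) (enum_rank y)) @ \oo).

Definition markov_chain (R : realType) (d : measure_display)
    (Omega : measurableType d) (P : probability Omega R) (S : finType)
    (X : R -> Omega -> S) (x0 : S) (Q : 'M[R]_#|S|) : Prop :=
  (forall w, X 0 w = x0) /\
  forall (past : seq (R * S)) (s t : R) (x y : S),
    0 <= s -> 0 <= t -> (forall h, h \in past -> 0 <= h.1 <= s) ->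
    P [set w | [/\ forall h, h \in past -> X h.1 w = h.2, X s w = x &
                   X (s + t) w = y]] =
    (P [set w | (forall h, h \in past -> X h.1 w = h.2) /\ X s w = x]
     * (transition Q t x y)%:E)%E.

(** Càdlàg for the product topology inherited from [nat -> nat -> bool] *)
Definition cadlag (R : realType) (f : R -> nat_partition) : Prop :=
  forall i j,
    (forall t, 0 <= t -> (fun u => f u i j) @ t^'+ --> f t i j) /\
    (forall t, 0 < t -> cvg ((fun u => f u i j) @ t^'-)).

Record homogeneous_fragmentation (R : realType) (d : measure_display)
    (Omega : measurableType d) (P : probability Omega R)
    (nu : {measure set (mass_partition R) -> \bar R})
    (Pi : R -> Omega -> nat_partition) : Prop := {
  homogeneous_measurable : forall t, 0 <= t -> measurable_fun setT (Pi t) ;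
  homogeneous_start : forall w, Pi 0 w = one_block ;
  homogeneous_cadlag : forall w, cadlag (fun t => Pi t w) ;
  homogeneous_markov : forall n,
    markov_chain P (fun t w => restriction n (Pi t w)) (restriction n one_block)
      (split_generator nu n) }.

(** * Self-similar fragmentations *)

(** [x ^ (- a)] for [0 <= x], where [0 ^ (- a)] is [+oo] if [0 < a]. *)
Definition neg_power (R : realType) (a x : R) : \bar R :=
  if (x == 0) && (0 < a) then +oo%E else (x `^ (- a))%:E.

(** [tau_i (t)], for the path [f] of a homogeneous fragmentation *)
Definition time_change (R : realType) (a : R) (f : R -> nat_partition)
    (i : nat) (t : R) : \bar R :=
  ereal_inf [set u%:E | u in [set u : R | 0 <= u /\
    (t%:E < \int[lebesgue_measure]_(r in `[0%R, u])
              neg_power a (asymptotic_frequency R (f r i)))%E]].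

Definition time_changed_block (R : realType) (a : R) (f : R -> nat_partition)
    (t : R) (i : nat) : pred nat :=
  if time_change a f i t is u%:E then f u i else pred1 i.

Definition self_similar_fragmentation (R : realType) (d : measure_display)
    (Omega : measurableType d) (P : probability Omega R) (a : R)
    (nu : {measure set (mass_partition R) -> \bar R})
    (Pi : R -> Omega -> nat_partition) : Prop :=
  (forall t, 0 <= t -> measurable_fun setT (Pi t)) /\
  exists2 Pi0 : R -> Omega -> nat_partition,
    homogeneous_fragmentation P nu Pi0 &
    {ae P, forall w, forall t, 0 <= t -> forall i,
      Pi t w i =1 time_changed_block a (fun u => Pi0 u w) t i}.

(** * Combinatorial trees *)

(** Vertices, which are subsets of [[n]], and (parent, child) pairs *)
Definition comb_tree (n : nat) : finType :=
  ({set {set 'I_n}} * {set {set 'I_n} * {set 'I_n}})%type.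

Definition tree_vertices (R : realType) (n : nat) (f : R -> nat_partition) :
    {set {set 'I_n}} :=
  [set B | `[< exists2 t : R, 0 <= t & B \in restriction n (f t) >]]%SET.

Definition tree_edges (n : nat) (V : {set {set 'I_n}}) :
    {set {set 'I_n} * {set 'I_n}} :=
  [set e | [&& e.1 \in V, e.2 \in V, e.2 \proper e.1 &
    [forall C in V, ~~ ((e.2 \proper C) && (C \proper e.1))]]]%SET.

Definition tree (R : realType) (n : nat) (f : R -> nat_partition) :
    comb_tree n :=
  (tree_vertices n f, tree_edges (tree_vertices n f)).

(** The [n]-th entry is a tree on [[n + 1]]. *)
Definition tree_sequence := forall n, comb_tree n.+1.

HB.instance Definition _ := gen_eqMixin tree_sequence.
HB.instance Definition _ := gen_choiceMixin tree_sequence.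
HB.instance Definition _ :=
  isPointed.Build tree_sequence (fun n => (finset.set0, finset.set0)).

Definition tree_sequence_cylinders : set (set tree_sequence) :=
  [set A | exists n (t : comb_tree n.+1), A = [set T : tree_sequence | T n = t]].

HB.instance Definition _ := Measurable.copy tree_sequence
  (g_sigma_algebraType tree_sequence_cylinders).

Definition trees (R : realType) (f : R -> nat_partition) : tree_sequence :=
  fun n => tree n.+1 f.

(* Main.v *)
From HB Require Import structures.
From mathcomp Require Import all_boot all_order all_algebra.
From mathcomp Require Import all_classical all_reals all_analysis.
From mathcomp Require Import perm measurable_realfun lra zify.
Require Import Defs.

Set Implicit Arguments.
Unset Strict Implicit.
Unset Printing Implicit Defensive.

Import Order.TTheory GRing.Theory Num.Theory numFieldNormedType.Exports.

Local Open Scope classical_set_scope.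
Local Open Scope ring_scope.


(** Write [lambda_m] for the rate at which a block of [m] sampled integers splits:
    the integral of [1 - \sum_k (s k) ^+ m] with respect to [nu]. As [nu] is infinite
    and does not charge the trivial partition, [lambda_m] increases to infinity
    ([split_rate_infty]).

    The main step recovers the times of the underlying homogeneous fragmentation
    from the trees. In the tree on [n] integers, consider the vertices containing
    two given integers [i] and [j]. In the homogeneous fragmentation a vertex with
    [m] elements lives for an exponential time of parameter [lambda_m], given the
    past, so the sum of the [1 / lambda_m] over these vertices ([tree_time])
    estimates the time at which [i] and [j] are separated. The estimation error is the
    terminal value of a martingale whose mean square is at most the expected time
    integral of [1 / lambda_m], with [m] the size of the current block while it
    contains [i] and [j]. By exchangeability this block is large with high
    probability if [n] is large, and then [1 / lambda_m] is small: the error tends to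
    0 in mean square. To stay within finite chains, the martingale is replaced by its
    analogue on a grid of times ([expect_grid_error_sq]), and the bound is carried to
    the limit of fine grids along each path ([grid_error_cvg]) by Fatou's lemma. Along
    sample sizes growing fast enough, chosen from [nu] only, the estimates converge
    almost surely ([ae_estimated_time]).

    The separation times of all pairs determine the homogeneous fragmentation, hence
    its asymptotic frequencies and the time changes. For this to determine the
    self-similar fragmentation from its own trees, one needs that the time changes do
    not alter the trees. This holds if each time change runs through all times,
    that is, if the clock, the integral of the frequency to the power [- a], is finite
    and strictly increasing ([clock_fin], [clock_increasing]); and this follows from
    the fact that frequencies exist and are positive at almost every time
    ([ae_frequencies]), since blocks decrease.

    Positivity at a fixed time [t] is proved by moments. The frequency [X] of the
    block of an integer at time [t] exists by a law of large numbers for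
    exchangeable indicators ([ae_average_cvg]), and its [k]-th moment is
    [exp (- t * lambda_k.+1)]. So frequencies are multiplicative in time as far as
    moments are concerned, and the probability that [X] vanishes at most doubles
    when [t] does ([prob_frequency0_double]). It is thus at most [K] times the
    probability at time [t / K], for [K] a power of 2, which is bounded by the [N]-th
    moment of [1 - X] at that time; as [K] grows this yields [t] times the rate at
    which an integer is separated from [N] others at once ([alternating_rate]), and
    this rate tends to 0 as [N] grows because [nu] is conservative. *)

(** * Paintboxes and bijections of the sampled integers *)

Lemma equivalence_partition_inj (T : finType) (e1 e2 : rel T) :
  equivalence_rel e1 -> equivalence_rel e2 ->
  equivalence_partition e1 [set: T]%SET = equivalence_partition e2 [set: T]%SET ->
  e1 =2 e2.
Proof.
move=> eq1 eq2 e12 x y.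
have e1E := @pblock_equivalence_partition _ e1 [set: T]%SET (fun a b c _ _ _ => eq1 a b c) x y (finset.in_setT _) (finset.in_setT _).
rewrite -e1E e12.
exact: (@pblock_equivalence_partition _ e2 [set: T]%SET (fun a b c _ _ _ => eq2 a b c) x y (finset.in_setT _) (finset.in_setT _)).
Qed.

Lemma eq_equivalence_partition (T : finType) (e1 e2 : rel T) : e1 =2 e2 ->
  equivalence_partition e1 [set: T]%SET = equivalence_partition e2 [set: T]%SET.
Proof.
move=> e12; rewrite /equivalence_partition; apply: eq_imset => x.
by apply/setP => y; rewrite !inE e12.
Qed.

Lemma partition_equivalence_partition (T : finType) (e : rel T) :
  equivalence_rel e ->
  finset.partition (equivalence_partition e [set: T]%SET) [set: T]%SET.
Proof. by move=> eqe; apply: equivalence_partitionP => ? ? ? _ _ _; exact: eqe. Qed.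

Lemma pblock_equivalence_rel (T : finType) (D : {set {set T}}) :
  finset.partition D [set: T]%SET ->
  equivalence_rel (fun x y => y \in finset.pblock D x).
Proof.
move=> /and3P[/eqP cD tD _] x y z; split=> [|xy]; first by rewrite mem_pblock cD.
by rewrite (@same_pblock _ _ y x) //; rewrite // in xy *.
Qed.

Definition colour_rel (n : nat) (x : {ffun 'I_n -> option nat}) : rel 'I_n :=
  fun i j => (i == j) || (x i == x j) && (x i != None).

Lemma colour_rel_equivalence n (x : {ffun 'I_n -> option nat}) :
  equivalence_rel (colour_rel x).
Proof.
move=> i j k; rewrite /colour_rel eqxx; split=> //.
case: (eqVneq i j) => [->//|ij /= /andP[/eqP xij xi0]].
rewrite -xij xi0 !andbT.
case: (eqVneq i k) => [<-|_]; first by rewrite xij !eqxx !orbT.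
by case: (eqVneq j k) => [<-|_]; rewrite xij ?eqxx.
Qed.

(** A bijection of the integers transports colourings, and the colours are
    exchangeable. *)
Lemma paintbox_prob_bij (R : realType) (s : mass_partition R) (m n : nat)
    (k : 'I_m -> 'I_n) (e1 : rel 'I_m) (e2 : rel 'I_n) :
  bijective k -> equivalence_rel e1 -> equivalence_rel e2 ->
  (forall i j, e1 i j = e2 (k i) (k j)) ->
  paintbox_prob s (equivalence_partition e1 [set: 'I_m]%SET) =
  paintbox_prob s (equivalence_partition e2 [set: 'I_n]%SET).
Proof.
move=> [l kl lk] eq1 eq2 e12; rewrite /paintbox_prob.
rewrite (reindex_esum [set x | colour_partition x =
      equivalence_partition e2 [set: 'I_n]%SET] _
    (fun x : {ffun 'I_n -> option nat} => [ffun i => x (k i)])); last first.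
  split=> [x/= /equivalence_partition_inj xe2|x y _ _ /ffunP xy|x/= /equivalence_partition_inj xe1].
  - apply: eq_equivalence_partition => i j; rewrite e12 !ffunE.
    rewrite -(xe2 (@colour_rel_equivalence _ x) eq2) /colour_rel.
    by rewrite (can_eq kl).
  - by apply/ffunP => i; have := xy (l i); rewrite !ffunE lk.
  - exists [ffun i => x (l i)] => /=.
      apply: eq_equivalence_partition => i j.
      rewrite -[i in RHS]lk -[j in RHS]lk -e12.
      rewrite -(xe1 (@colour_rel_equivalence _ x) eq1) /colour_rel.
      by rewrite !ffunE (can_eq lk).
    by apply/ffunP => i; rewrite !ffunE kl.
apply: eq_esum => x _; congr EFin.
rewrite (reindex k)/=; last by exists l.
by apply: eq_bigr => i _; rewrite ffunE.
Qed.

(** The bijection behind this identity lists the blocks of [D] one after the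
    other: it carries the successive intervals to the blocks. *)
Lemma paintbox_prob_interval (R : realType) (s : mass_partition R) (m : nat)
    (D : {set {set 'I_m}}) (E : seq {set 'I_m}) :
  finset.partition D [set: 'I_m]%SET -> perm_eq E (enum D) ->
  paintbox_prob s (interval_partition [seq #|C : {set 'I_m}| | C <- E]) =
  paintbox_prob s D.
Proof.
move=> Dpart permE.
have memE C : (C \in E) = (C \in D) by rewrite (perm_mem permE) mem_enum.
have uniqE : uniq E by rewrite (perm_uniq permE) enum_uniq.
pose ss := [seq enum (pred_of_set C) | C <- E].
have shE : [seq #|C : {set 'I_m}| | C <- E] = shape ss.
  by rewrite /shape -map_comp; apply: eq_map => C; rewrite /= cardE.
rewrite shE.
have [/eqP cD tD D0] := and3P Dpart.
have memf x : x \in flatten ss.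
  apply/flattenP; exists (enum (pred_of_set (finset.pblock D x))).
    by apply: map_f; rewrite memE pblock_mem// cD.
  by rewrite mem_enum mem_pblock cD.
have szf : size (flatten ss) = m.
  rewrite size_flatten -shE.
  rewrite sumnE big_map (perm_big _ permE)/= big_enum/=.
  by rewrite -(card_partition Dpart) cardsT card_ord.
have uniqf : uniq (flatten ss).
  have : perm_eq (undup (flatten ss)) (enum 'I_m).
    apply: uniq_perm; [exact: undup_uniq|exact: enum_uniq|].
    by move=> x; rewrite mem_undup memf mem_enum.
  move=> /perm_size; rewrite size_enum_ord => szu.
  by rewrite -[uniq _]negbK -ltn_size_undup szu szf ltnn.
have szm : sumn (shape ss) = m by rewrite -size_flatten.
pose k (i : 'I_(sumn (shape ss))) := nth (cast_ord szm i) (flatten ss) i.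
have kinj : injective k.
  move=> i j; rewrite /k (set_nth_default (cast_ord szm j)); last first.
    by rewrite size_flatten.
  move=> /eqP; rewrite nth_uniq ?size_flatten// => /eqP ij.
  exact: val_inj.
rewrite -[in RHS](equivalence_partition_pblock Dpart).
apply: (@paintbox_prob_bij _ _ _ _ k).
- by apply: inj_card_bij kinj _; rewrite !card_ord szm.
- by move=> i j l; split=> // /eqP ->.
- exact: pblock_equivalence_rel.
move=> i j.
have rlt (l : 'I_(sumn (shape ss))) : (reshape_index (shape ss) l < size E)%N.
  by rewrite -(size_map (fun C : {set 'I_m} => enum C)) -(size_map size) reshape_indexP.
have kin l : k l \in nth finset.set0 E (reshape_index (shape ss) l).
  rewrite /k nth_flatten -mem_enum.
  rewrite -(nth_map finset.set0 [::] (fun C : {set 'I_m} => enum C)) //.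
  rewrite mem_nth//.
  have := reshape_offsetP (ltn_ord l).
  by rewrite (nth_map [::])// size_map.
have nin (l : 'I_(sumn (shape ss))) : nth finset.set0 E (reshape_index (shape ss) l) \in D.
  by rewrite -memE mem_nth.
rewrite (def_pblock tD (nin i) (kin i)).
apply/eqP/idP => [->|kji]; first exact: kin.
have := def_pblock tD (nin i) kji; rewrite (def_pblock tD (nin j) (kin j)).
by move=> /eqP; rewrite nth_uniq// => /eqP.
Qed.

(** * Splitting rates of blocks *)

Lemma perm_enum_imset (T T' : finType) (h : T -> T') (A : {set T}) :
  injective h -> perm_eq (enum [set h x | x in A]%SET) (map h (enum A)).
Proof.
move=> hinj; apply: uniq_perm; first exact: enum_uniq.
  by rewrite map_inj_uniq ?enum_uniq.
move=> y; rewrite mem_enum; apply/imsetP/mapP => -[x xA ->]; exists x => //.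
  by rewrite mem_enum.
by rewrite mem_enum in xA.
Qed.

(** [p_] only sees block sizes, so a partition of a block can be pulled back to an
    initial segment of the integers, where paintbox probabilities apply. *)
Lemma p_imset (R : realType) (nu : {measure set (mass_partition R) -> \bar R})
    (m n : nat) (f : 'I_m -> 'I_n) (D : {set {set 'I_m}}) :
  injective f -> finset.partition D [set: 'I_m]%SET ->
  p_ nu [seq #|C : {set 'I_n}| | C <- enum [set f @: (C : {set 'I_m}) | C in D]%SET]
  = (\int[nu]_s paintbox_prob s D)%E.
Proof.
move=> finj Dpart; set L := enum _.
pose E := [seq (f @^-1: (C : {set 'I_n}))%SET | C <- L].
have fK (C : {set 'I_m}) : (f @^-1: (f @: C))%SET = C.
  by apply/setP => x; rewrite !inE mem_imset.
have permL : perm_eq L (map (fun C : {set 'I_m} => f @: C)%SET (enum D)).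
  by apply: perm_enum_imset; exact: imset_inj.
have -> : [seq #|C : {set 'I_n}| | C <- L] = [seq #|C : {set 'I_m}| | C <- E].
  rewrite /E -map_comp; apply/eq_in_map => C.
  by rewrite (perm_mem permL) => /mapP[C' _ ->]/=; rewrite fK card_imset.
apply: eq_integral => s _; apply: paintbox_prob_interval => //.
rewrite /E; apply: (perm_trans (perm_map _ permL)).
by rewrite -map_comp (eq_map (g := id)) ?map_id.
Qed.

(** The total rate at which a block with [m] elements splits, written [lambda_m]
    in comments. *)
Definition split_rate_of_size (R : realType)
    (nu : {measure set (mass_partition R) -> \bar R}) (m : nat) : R :=
  \sum_(D : {set {set 'I_m}} | finset.partition D [set: 'I_m]%SET && (1 < #|D|)%N)
    fine (\int[nu]_s paintbox_prob s D)%E.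

Lemma split_rate_of_block (R : realType)
    (nu : {measure set (mass_partition R) -> \bar R}) (n : nat) (B : {set 'I_n}) :
  \sum_(D : {set {set 'I_n}} | finset.partition D B && (1 < #|D|)%N)
    fine (p_ nu [seq #|C : {set 'I_n}| | C <- enum D]) =
  split_rate_of_size nu #|B|.
Proof.
pose f : 'I_#|B| -> 'I_n := enum_val.
have finj : injective f by exact: enum_val_inj.
have fB : [set f x | x in [set: 'I_#|B|]%SET]%SET = B.
  apply/setP => x; apply/imsetP/idP => [[y _ ->]|xB]; first exact: enum_valP.
  by exists (enum_rank_in xB x); rewrite /f ?enum_rankK_in.
pose h (D : {set {set 'I_#|B|}}) := [set f @: (C : {set 'I_#|B|}) | C in D]%SET.
pose h' (D : {set {set 'I_n}}) := [set f @^-1: (C : {set 'I_n}) | C in D]%SET.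
have fK (C : {set 'I_#|B|}) : (f @^-1: (f @: C))%SET = C.
  by apply/setP => x; rewrite !inE mem_imset.
have hK D : h' (h D) = D.
  by rewrite /h' /h -imset_comp (eq_imset (g := id)) ?imset_id.
have hpart D : finset.partition (h D) B = finset.partition D [set: 'I_#|B|]%SET.
  by rewrite -(imset_partition D _ finj) fB.
rewrite (reindex_onto h h')/=; last first.
  move=> D /andP[/and3P[/eqP cD _ _] _].
  rewrite /h /h' -imset_comp -[RHS]imset_id.
  apply: eq_in_imset => C CD /=.
  apply/setP => x; apply/imsetP/idP => [[y + ->]|xC]; first by rewrite inE.
  have : x \in B by rewrite -cD; apply/bigcupP; exists C.
  move=> xB; exists (enum_rank_in xB x); last by rewrite /f enum_rankK_in.
  by rewrite inE /f enum_rankK_in.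
rewrite /split_rate_of_size; apply: eq_big => [D|D].
  by rewrite hK eqxx andbT hpart card_imset//; exact: imset_inj.
by rewrite hpart => /andP[/andP[Dpart _] _]; rewrite p_imset.
Qed.

(** * Countable sums and laws of colourings *)

Lemma esumZl (R : realType) (T : choiceType) (D : set T) (f : T -> \bar R) (r : R) :
  0 <= r -> (forall x, D x -> 0 <= f x)%E ->
  (\esum_(x in D) (r%:E * f x) = r%:E * \esum_(x in D) f x)%E.
Proof.
move=> r0 f0.
have le (g : T -> \bar R) (c : R) : 0 <= c -> (forall x, D x -> 0 <= g x)%E ->
    (\esum_(x in D) (c%:E * g x) <= c%:E * \esum_(x in D) g x)%E.
  move=> c0 g0; apply: ge_ereal_sup => /= _ [X [finX XD] <-].
  rewrite fsbig_finite//= big_seq -ge0_sume_distrr -?big_seq; last first.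
    move=> i; rewrite in_fset_set// inE => /XD; exact: g0.
  apply: lee_wpmul2l; first by rewrite lee_fin.
  rewrite -fsbig_finite//; apply: ereal_sup_ubound; exists X => //; split => //.
apply/eqP; rewrite eq_le le//=.
case: (ltgtP 0 r) r0 => // [r0 _|<- _]; last first.
  by rewrite mul0e esum_ge0// => x Dx; rewrite mul0e.
rewrite -lee_pdivlMl// -[leLHS](_ : \esum_(x in D) (r^-1%:E * (r%:E * f x)) = _)%E.
  by apply: le; [rewrite invr_ge0 ltW|move=> x Dx; rewrite mule_ge0 ?f0// lee_fin ltW].
by apply: eq_esum => x _; rewrite muleA -EFinM mulVf ?mul1e// gt_eqF.
Qed.

(** Turns an unordered countable sum into a series, for which measurability of
    limits applies. *)
Lemma esum_countable (R : realType) (T : countType) (D : set T) (f : T -> \bar R) :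
  (forall x, 0 <= f x)%E ->
  (\esum_(x in D) f x =
   \sum_(0 <= n <oo | n \in (fun n => `[< exists2 x, D x & pickle x = n >]))
     (if (@unpickle T n) is Some x then f x else 0))%E.
Proof.
move=> f0; rewrite nneseries_esum; last by move=> n _; case: unpickle.
transitivity (\esum_(n in (@pickle T) @` D)
    (if (@unpickle T n) is Some x then f x else 0%E)).
  rewrite esum_image; last by move=> x y _ _ /(pcan_inj (@pickleK T)).
  by apply: eq_esum => x _; rewrite pickleK.
by congr esum; apply/seteqP; split=> n /=; rewrite -topredE/= => /asboolP.
Qed.

Lemma measurable_esum (R : realType) d (X : measurableType d) (T : countType)
    (D : set T) (f : T -> X -> \bar R) :
  (forall x s, 0 <= f x s)%E -> (forall x, measurable_fun setT (f x)) ->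
  measurable_fun setT (fun s => \esum_(x in D) f x s).
Proof.
move=> f0 mf; under eq_fun do rewrite esum_countable//.
apply: ge0_emeasurable_sum => [k x _ _|k _]; first by case: unpickle.
by case: unpickle.
Qed.

Section mass_partition_facts.
Variables (R : realType) (s : mass_partition R).

Lemma mass_ge0 i : 0 <= s i. Proof. by case: (mass_partitionP s). Qed.

Lemma total_mass_le1 : (total_mass s <= 1)%E.
Proof. by case: (mass_partitionP s). Qed.

Lemma total_mass_ge0 : (0 <= total_mass s)%E.
Proof. by apply: nneseries_ge0 => n _ _; rewrite lee_fin mass_ge0. Qed.

Lemma total_mass_fin_num : total_mass s \is a fin_num.
Proof.
rewrite ge0_fin_numE ?total_mass_ge0//.
by apply: (le_lt_trans total_mass_le1); rewrite ltry.
Qed.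

Lemma mass_nonincreasing i j : (i <= j)%N -> s j <= s i.
Proof.
move=> /subnK <-; elim: (j - i)%N => [|k]; first by rewrite add0n.
by apply: le_trans; rewrite addSn; case: (mass_partitionP s).
Qed.

Lemma mass_le1 i : s i <= 1.
Proof.
rewrite -lee_fin; apply: le_trans total_mass_le1.
apply: (@le_trans _ _ (\sum_(0 <= k < i.+1) (s k)%:E)%E).
  by rewrite big_nat_recr//= leeDr// sume_ge0// => k _; rewrite lee_fin mass_ge0.
by apply: nneseries_lim_ge => k _ _; rewrite lee_fin mass_ge0.
Qed.

Lemma colour_mass_ge0 c : 0 <= colour_mass s c.
Proof.
case: c => [k|] /=; first exact: mass_ge0.
by rewrite subr_ge0 -lee_fin fineK ?total_mass_fin_num ?total_mass_le1.
Qed.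

Lemma colour_prod_ge0 (n : nat) (x : {ffun 'I_n -> option nat}) :
  (0 <= (\prod_(i < n) colour_mass s (x i))%:E)%E.
Proof. by rewrite lee_fin prodr_ge0// => i _; exact: colour_mass_ge0. Qed.

Lemma sum_colour_mass : (\esum_(c in [set: option nat]) (colour_mass s c)%:E = 1)%E.
Proof.
rewrite (esumID [set None])/=; last by move=> c _; rewrite lee_fin colour_mass_ge0.
rewrite setTI esum_set1 ?lee_fin ?colour_mass_ge0// setTI.
have -> : ~` [set None : option nat] = Some @` [set: nat].
  by apply/seteqP; split=> [[k _|[]//]|_ [k _ <-]//]; exists k.
rewrite esum_image; last by move=> ? ? _ _ [].
rewrite /= -nneseries_esumT; last by move=> n; rewrite lee_fin mass_ge0.
rewrite -/(total_mass s) EFinB fineK ?total_mass_fin_num//.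
by rewrite subeK// total_mass_fin_num.
Qed.

(** Total mass of the law of [n] i.i.d. colours, by conditioning on the first. *)
Lemma sum_colour_prod (n : nat) :
  (\esum_(x in [set: {ffun 'I_n -> option nat}])
     (\prod_(i < n) colour_mass s (x i))%:E = 1)%E.
Proof.
elim: n => [|n IHn].
  have -> : [set: {ffun 'I_0 -> option nat}] = [set [ffun=> None]].
    by apply/seteqP; split=> // x _; apply/ffunP => -[].
  by rewrite esum_set1 ?colour_prod_ge0// big_ord0.
pose e (p : option nat * {ffun 'I_n -> option nat}) : {ffun 'I_n.+1 -> option nat} :=
  [ffun i => if unlift ord0 i is Some j then p.2 j else p.1].
rewrite (reindex_esum ([set: option nat] `*`` fun=> [set: {ffun 'I_n -> option nat}])
   _ e); last first.
  split=> //.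
    move=> [c x] [d y] _ _ /ffunP xy /=; congr pair.
      by have := xy ord0; rewrite !ffunE unlift_none.
    by apply/ffunP => j; have := xy (lift ord0 j); rewrite !ffunE liftK.
  move=> x _; exists (x ord0, [ffun j => x (lift ord0 j)]) => //.
  apply/ffunP => i; rewrite ffunE; case: unliftP => [j ->|->//].
  by rewrite ffunE.
transitivity (\esum_(c in [set: option nat]) (colour_mass s c)%:E)%E; last first.
  exact: sum_colour_mass.
rewrite -(@esum_esum _ _ _ _ (fun=> _) (fun c x => (\prod_(i < n.+1)
  colour_mass s (e (c, x) i))%:E)%E); last by move=> *; exact: colour_prod_ge0.
apply: eq_esum => c _.
transitivity ((colour_mass s c)%:E * \esum_(x in [set: {ffun 'I_n -> option nat}])
     (\prod_(i < n) colour_mass s (x i))%:E)%E; last by rewrite IHn mule1.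
rewrite -esumZl ?colour_mass_ge0//; last by move=> x _; exact: colour_prod_ge0.
apply: eq_esum => x _; rewrite -EFinM big_ord_recl ffunE unlift_none.
by congr (_ * _)%:E; apply: eq_bigr => i _; rewrite ffunE liftK.
Qed.

End mass_partition_facts.

(** * Measurability in the mass partition *)

Section mass_partition_measurability.
Variable R : realType.

Lemma measurable_mass i : measurable_fun setT (fun s : mass_partition R => s i).
Proof.
move=> _ B mB; rewrite setTI; apply: sub_sigma_algebra.
by exists i, B.
Qed.

Lemma measurable_total_mass : measurable_fun setT (@total_mass R).
Proof.
apply: (@ge0_emeasurable_sum _ _ _ _ (fun i (s : mass_partition R) => (s i)%:E) xpredT).
  by move=> k s _ _; rewrite lee_fin mass_ge0.
by move=> k _; apply/measurable_EFinP; exact: measurable_mass.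
Qed.

Lemma measurable_colour_mass c :
  measurable_fun setT (fun s : mass_partition R => colour_mass s c).
Proof.
case: c => [k|] /=; first exact: measurable_mass.
apply: measurable_funB; first exact: measurable_cst.
by apply: (measurableT_comp _ measurable_total_mass) => //; exact: measurable_realfun.fine_measurable.
Qed.

Lemma measurable_paintbox_prob n (D : {set {set 'I_n}}) :
  measurable_fun setT (fun s : mass_partition R => paintbox_prob s D).
Proof.
apply: (@measurable_esum _ _ _ {ffun 'I_n -> option nat}
  [set x | colour_partition x = D] (fun x (s : mass_partition R) =>
  (\prod_(i < n) colour_mass s (x i))%:E)) => [x s|x]; first exact: colour_prod_ge0.
apply/measurable_EFinP; apply: measurable_prod => i _.
exact: measurable_colour_mass.
Qed.

Definition power_sum (s : mass_partition R) (m : nat) : \bar R :=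
  (\sum_(0 <= k <oo) (s k ^+ m)%:E)%E.

Lemma measurable_power_sum m : measurable_fun setT (power_sum ^~ m).
Proof.
apply: (@ge0_emeasurable_sum _ _ _ _ (fun i (s : mass_partition R) => (s i ^+ m)%:E) xpredT).
  by move=> k s _ _; rewrite lee_fin exprn_ge0// mass_ge0.
move=> k _; apply/measurable_EFinP; apply: measurable_funX; exact: measurable_mass.
Qed.

Lemma power_sum_ge0 s m : (0 <= power_sum s m)%E.
Proof. by apply: nneseries_ge0 => k _ _; rewrite lee_fin exprn_ge0// mass_ge0. Qed.

Lemma power_sum1 s : power_sum s 1 = total_mass s.
Proof. by []. Qed.

Lemma power_sum_nonincreasing s m n : (m <= n)%N -> (power_sum s n <= power_sum s m)%E.
Proof.
move=> mn; apply: lee_nneseries => k _; rewrite lee_fin ?exprn_ge0 ?mass_ge0//.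
by rewrite ler_wiXn2l// ?mass_ge0// mass_le1.
Qed.

Lemma power_sum_le1 s m : (0 < m)%N -> (power_sum s m <= 1)%E.
Proof.
move=> m0; apply: le_trans (total_mass_le1 s); rewrite -power_sum1.
exact: power_sum_nonincreasing.
Qed.

Lemma power_sum_fin_num s m : (0 < m)%N -> power_sum s m \is a fin_num.
Proof.
move=> m0; rewrite ge0_fin_numE ?power_sum_ge0//.
by apply: (le_lt_trans (power_sum_le1 s m0)); rewrite ltry.
Qed.

Lemma colour_partition_constant n k :
  (#|colour_partition [ffun _ : 'I_n => Some k]| <= 1)%N.
Proof.
rewrite -(cards1 ([set: 'I_n]%SET)); apply: subset_leq_card.
apply/fintype.subsetP => C /imsetP[i _ ->]; rewrite inE; apply/eqP/setP => j.
by rewrite !inE /= !ffunE eqxx orbT.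
Qed.

Lemma card_colour_partition n (x : {ffun 'I_n -> option nat}) (i j : 'I_n) :
  x i != x j -> (1 < #|colour_partition x|)%N.
Proof.
move=> xij.
have xeq : equivalence_rel (colour_rel x) := colour_rel_equivalence x.
have xP := partition_equivalence_partition xeq.
rewrite -/(colour_rel x) -/(colour_partition x) in xP.
have [/eqP cP tP _] := and3P xP.
apply/card_gt1P; exists (finset.pblock (colour_partition x) i),
  (finset.pblock (colour_partition x) j); split.
- by rewrite pblock_mem// cP inE.
- by rewrite pblock_mem// cP inE.
rewrite (@eq_pblock _ _ i j tP) ?cP ?inE//.
rewrite (@pblock_equivalence_partition _ (colour_rel x) [set: 'I_n]%SET) ?inE//.
  rewrite /colour_rel negb_or (negbTE xij)/= andbT.
  by apply: contraNneq xij => ->.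
Qed.

(** For a conservative [s] no integer is uncoloured, almost surely, so that a
    single block arises exactly when all [m] integers have the same colour. *)
Lemma sum_paintbox_prob (s : mass_partition R) m : total_mass s = 1%E -> (0 < m)%N ->
  (\sum_(D : {set {set 'I_m}} | finset.partition D [set: 'I_m]%SET && (1 < #|D|)%N)
    paintbox_prob s D = 1 - power_sum s m)%E.
Proof.
move=> s1 m0; set F := fun x : {ffun 'I_m -> option nat} =>
  ((\prod_(i < m) colour_mass s (x i))%:E)%E.
have F0 x : (0 <= F x)%E by exact: colour_prod_ge0.
have None0 : colour_mass s None = 0 by rewrite /= s1 /= subrr.
pose c k : {ffun 'I_m -> option nat} := [ffun _ => Some k].
pose P := fun D : {set {set 'I_m}} => finset.partition D [set: 'I_m]%SET && (1 < #|D|)%N.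
have := sum_colour_prod s m.
rewrite -[LHS]/(\esum_(x in [set: {ffun 'I_m -> option nat}]) F x).
rewrite (esumID (range c))// !setTI.
rewrite esum_image; last first.
  by move=> k l _ _ /ffunP/(_ (Ordinal m0)); rewrite !ffunE => -[].
rewrite (eq_esum (b := fun k => (s k ^+ m)%:E)); last first.
  move=> k _; rewrite /F; congr EFin.
  by under eq_bigr do rewrite ffunE; rewrite prodr_const card_ord.
rewrite -nneseries_esumT; last by move=> k; rewrite lee_fin exprn_ge0// mass_ge0.
rewrite -/(power_sum s m) => <-.
rewrite addeC addeK ?power_sum_fin_num//.
rewrite /paintbox_prob.
under eq_bigr do rewrite esum_mkcond.
rewrite (eq_bigr (fun D => \esum_(x in [set: {ffun 'I_m -> option nat}])
    (if x \in [set x | colour_partition x = D] then F x else 0)%E)); last first.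
  by move=> D _; rewrite [LHS]esum_mkcond; apply: eq_esum => x _; rewrite in_setT.
rewrite -esum_sum; last by move=> x D _ _; case: ifP.
rewrite [RHS]esum_mkcond; apply: eq_esum => x _.
rewrite -big_mkcondr/=.
have xpart : finset.partition (colour_partition x) [set: 'I_m]%SET.
  by apply: partition_equivalence_partition; exact: colour_rel_equivalence.
have [->|F1] := eqVneq (F x) 0%E; first by rewrite big1// if_same.
have xS i : x i != None.
  apply: contraNneq F1 => xi; rewrite /F (bigD1 i)//= xi.
  by rewrite [X in X * _]None0 mul0r.
case: ifPn; rewrite ?notin_setE ?inE /= => xc; last first.
  have {}xc : range c x by apply: contrapT; exact: xc.
  case: xc => k _ <-; rewrite big_pred0// => D.
  have [->|] := eqVneq D (colour_partition (c k)); last first.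
    move=> Dx; rewrite [X in _ && X](_ : _ = false) ?andbF//.
    by apply/negbTE; rewrite notin_setE => /esym/eqP; exact/negP.
  by rewrite [X in _ && X && _]ltnNge colour_partition_constant andbF.
have [j xj] : exists j, x (Ordinal m0) != x j.
  apply: contrapT => nex; apply: xc.
  case x0 : (x (Ordinal m0)) => [k|]; last by have := xS (Ordinal m0); rewrite x0.
  exists k => //; apply/ffunP => j; rewrite ffunE -x0.
  by apply: contrapT => /eqP ?; apply: nex; exists j.
rewrite (big_pred1 (colour_partition x))// => D.
have [->|Dx] := eqVneq D (colour_partition x).
  by rewrite xpart (card_colour_partition xj) mem_set//= eqxx.
rewrite [X in _ && X](_ : _ = false) ?andbF/= ?(negbTE Dx)//.
by apply/negbTE; rewrite notin_setE => /esym/eqP; exact/negP.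
Qed.

End mass_partition_measurability.

(** * Growth of the splitting rates *)

Lemma cvg_sumr (R : realType) (T : Type) (F : set_system T) (FF : Filter F)
    (I : Type) (r : seq I) (P : pred I) (f : I -> T -> R) (l : I -> R) :
  (forall i, P i -> f i x @[x --> F] --> l i) ->
  \sum_(i <- r | P i) f i x @[x --> F] --> \sum_(i <- r | P i) l i.
Proof.
move=> fl; elim: r => [|i r IHr].
  by rewrite big_nil; under eq_fun do rewrite big_nil; exact: cvg_cst.
rewrite big_cons; under eq_fun do rewrite big_cons.
by case: ifPn => // Pi; apply: cvgD => //; exact: fl.
Qed.

Section split_rates.
Variables (R : realType) (nu : {measure set (mass_partition R) -> \bar R}).
Hypothesis nuD : dislocation_measure nu.

(** Real-valued version of [power_sum], meaningful for [0 < m]. *)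
Definition psum (s : mass_partition R) (m : nat) : R := fine (power_sum s m).

Lemma psumE s m : (0 < m)%N -> power_sum s m = (psum s m)%:E.
Proof. by move=> m0; rewrite /psum fineK// power_sum_fin_num. Qed.

Lemma measurable_psum m : measurable_fun setT (psum ^~ m).
Proof.
by apply: (measurableT_comp _ (measurable_power_sum m)) => //; exact: measurable_realfun.fine_measurable.
Qed.

Lemma measurable_one_sub_psum m : measurable_fun setT (fun s => (1 - psum s m)%:E).
Proof. by apply/measurable_EFinP; apply: measurable_funB => //; exact: measurable_psum. Qed.

Lemma psum_le1 s m : (0 < m)%N -> psum s m <= 1.
Proof. by move=> m0; rewrite -lee_fin -psumE// power_sum_le1. Qed.

Lemma psum_nonincreasing s m n : (0 < m)%N -> (m <= n)%N -> psum s n <= psum s m.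
Proof.
move=> m0 mn; rewrite -lee_fin -!psumE//; first exact: power_sum_nonincreasing.
exact: leq_trans mn.
Qed.

Lemma psum_ge (s : mass_partition R) m : (0 < m)%N -> s 0%N ^+ m <= psum s m.
Proof.
move=> m0; rewrite -lee_fin -psumE//.
apply: (@le_trans _ _ (\sum_(0 <= k < 1) (s k ^+ m)%:E)%E); first by rewrite big_nat1.
by apply: nneseries_lim_ge => k _ _; rewrite lee_fin exprn_ge0// mass_ge0.
Qed.

Lemma psum_le (s : mass_partition R) m : psum s m.+1 <= s 0%N ^+ m.
Proof.
rewrite -lee_fin -psumE//.
apply: (@le_trans _ _ ((s 0%N ^+ m)%:E * total_mass s)%E).
  rewrite -nneseriesZl; last by move=> k _; rewrite lee_fin mass_ge0.
  apply: lee_nneseries => k _; rewrite ?lee_fin ?exprn_ge0 ?mass_ge0//.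
  by rewrite exprSr ler_wpM2r ?mass_ge0// lerXn2r ?nnegrE ?mass_ge0// mass_nonincreasing.
rewrite -[leRHS]mule1 lee_wpmul2l ?total_mass_le1// lee_fin exprn_ge0//.
exact: mass_ge0.
Qed.

Lemma ae_total_mass : {ae nu, forall s, total_mass s = 1%E}.
Proof.
exists [set s | (total_mass s < 1)%E]; split.
- rewrite -[X in measurable X]setTI.
  have := @measurable_total_mass R measurableT `]-oo, 1%E[%classic (emeasurable_itv _).
  by congr measurable; apply/seteqP; split=> s /=; rewrite in_itv.
- exact: dislocation_conservative nuD.
- by move=> s /= /eqP s1; rewrite lt_neqAle s1 total_mass_le1.
Qed.

Lemma integrable_largest_mass : nu.-integrable setT (fun s => (1 - s 0%N)%:E).
Proof.
apply/integrableP; split.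
  by apply/measurable_EFinP; apply: measurable_funB => //; exact: measurable_mass.
have -> : (\int[nu]_s `|(1 - s 0%N)%:E| = \int[nu]_s (1 - s 0%N)%:E)%E.
  by apply: eq_integral => s _; rewrite gee0_abs// lee_fin subr_ge0 mass_le1.
exact: dislocation_integrable nuD.
Qed.

Lemma one_sub_expr_le (x : R) m : 0 <= x <= 1 -> 1 - x ^+ m <= m%:R * (1 - x).
Proof.
move=> /andP[x0 x1]; elim: m => [|m IHm]; first by rewrite expr0 subrr mul0r.
rewrite exprS mulrSr mulrDl mul1r.
have : (1 - x) * x ^+ m <= 1 - x.
  by rewrite ler_piMr ?subr_ge0// exprn_ile1.
lra.
Qed.

Lemma integrable_psum m : (0 < m)%N -> nu.-integrable setT (fun s => (1 - psum s m)%:E).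
Proof.
move=> m0.
apply: (@le_integrable _ _ _ _ _ measurableT _ (fun s : mass_partition R => (m%:R : R)%:E * (1 - s 0%N)%:E)%E) => //.
- exact: measurable_one_sub_psum.
- move=> s _; rewrite -EFinM !gee0_abs ?lee_fin ?mulr_ge0 ?subr_ge0 ?mass_le1 ?psum_le1//.
  apply: le_trans (one_sub_expr_le m _); last by rewrite mass_ge0 mass_le1.
  by rewrite lerB// psum_ge.
- exact: integrableZl integrable_largest_mass.
Qed.

(** Given [s], a block with [m] elements stays in one piece with probability
    [psum s m]. *)
Lemma split_rate_of_sizeE m : (0 < m)%N ->
  (split_rate_of_size nu m)%:E = (\int[nu]_s (1 - psum s m)%:E)%E.
Proof.
move=> m0.
pose P := fun D : {set {set 'I_m}} => finset.partition D [set: 'I_m]%SET && (1 < #|D|)%N.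
have pb0 D s : (0 <= paintbox_prob s (D : {set {set 'I_m}}))%E.
  by apply: esum_ge0 => x _; exact: colour_prod_ge0.
have intE : (\sum_(D | P D) \int[nu]_s paintbox_prob s D = \int[nu]_s (1 - psum s m)%:E)%E.
  rewrite -big_filter -ge0_integral_sum//; last first.
    by move=> D; exact: measurable_paintbox_prob.
  apply: ge0_ae_eq_integral => //.
  - by apply: emeasurable_sum => D; exact: measurable_paintbox_prob.
  - exact: measurable_one_sub_psum.
  - by move=> s _; exact: sume_ge0.
  - by move=> s _; rewrite lee_fin subr_ge0 psum_le1.
  apply: filterS ae_total_mass => s s1 _.
  by rewrite big_filter sum_paintbox_prob// psumE.
have intfin : (\int[nu]_s (1 - psum s m)%:E)%E \is a fin_num.
  exact: integrable_fin_num (integrable_psum m0).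
rewrite /split_rate_of_size sum_fine; last first.
  by move: intfin; rewrite -intE => /sum_fin_numP H D PD; apply: H => //; rewrite mem_index_enum.
by rewrite -/P intE fineK.
Qed.

Lemma split_rate_ge0 m : 0 <= split_rate_of_size nu m.
Proof.
apply: sumr_ge0 => D _; apply: fine_ge0; apply: integral_ge0 => s _.
by apply: esum_ge0 => x _; exact: colour_prod_ge0.
Qed.

Lemma split_rate_nondecreasing m n : (0 < m)%N -> (m <= n)%N ->
  split_rate_of_size nu m <= split_rate_of_size nu n.
Proof.
move=> m0 mn; have n0 := leq_trans m0 mn.
rewrite -lee_fin !split_rate_of_sizeE//; apply: ge0_le_integral => //.
- by move=> s _; rewrite lee_fin subr_ge0 psum_le1.
- exact: measurable_one_sub_psum.
- exact: measurable_one_sub_psum.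
- by move=> s _; rewrite lee_fin lerB// psum_nonincreasing.
Qed.

(** The mass partitions with largest mass 1 reduce to the excluded atom. *)
Lemma largest_mass_lt1 (s : mass_partition R) : s <> unit_mass R -> s 0%N < 1.
Proof.
move=> s1; rewrite lt_neqAle mass_le1 andbT; apply/eqP => s01; apply: s1.
have s0 i : (0 < i)%N -> s i = 0.
  case: i => // i _; apply/eqP; rewrite eq_le mass_ge0 andbT.
  rewrite -(lerD2l (s 0%N)) addr0 s01.
  rewrite -lee_fin; apply: le_trans (total_mass_le1 s).
  apply: (@le_trans _ _ (\sum_(0 <= k < i.+2) (s k)%:E)%E); last first.
    by apply: nneseries_lim_ge => k _ _; rewrite lee_fin mass_ge0.
  rewrite big_nat_recl//= big_nat_recr//= s01 EFinD leeD2l// leeDr// sume_ge0// => k _.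
  by rewrite lee_fin mass_ge0.
have : mass s = mass (unit_mass R).
  by apply/funext => -[|i] /=; [exact: s01|exact: s0].
case: (s) => f fP; rewrite /unit_mass /= => fE.
rewrite fE in fP *; congr MassPartition; exact: Prop_irrelevance.
Qed.

Lemma ae_largest_mass_lt1 : {ae nu, forall s : mass_partition R, s 0%N < 1}.
Proof.
exists [set s : mass_partition R | s 0%N = 1]; split.
- rewrite -[X in measurable X]setTI.
  exact: (@measurable_mass R 0%N measurableT [set 1] (measurable_set1 1)).
- suff -> : [set s : mass_partition R | s 0%N = 1] = [set unit_mass R].
    exact: dislocation_no_atom nuD.
  apply/seteqP; split=> s /=; last by move=> ->.
  move=> s1; apply: contrapT => /largest_mass_lt1; by rewrite s1 ltxx.
- by move=> s /= /negP; rewrite -leNgt => s1; apply/eqP; rewrite eq_le s1 mass_le1.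
Qed.

Hypothesis nu_infinite : nu setT = +oo%E.

(** Since [nu] is infinite and [s 0 < 1] almost everywhere, monotone
    convergence makes [lambda_m] diverge. *)
Lemma split_rate_infty : split_rate_of_size nu m @[m --> \oo] --> +oo.
Proof.
pose g n (s : mass_partition R) := (1 - s 0%N ^+ n)%:E.
have mg n : measurable_fun setT (g n).
  apply/measurable_EFinP; apply: measurable_funB => //.
  by apply: measurable_funX; exact: measurable_mass.
have g0 n s : (0 <= g n s)%E by rewrite lee_fin subr_ge0 exprn_ile1 ?mass_ge0 ?mass_le1.
have gnd s : {homo g ^~ s : n m / (n <= m)%N >-> (n <= m)%E}.
  by move=> n m nm; rewrite lee_fin lerB// ler_wiXn2l ?mass_ge0 ?mass_le1.
have := @cvg_monotone_convergence _ _ _ nu setT measurableT g (fun n => mg n)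
  (fun n s _ => g0 n s) (fun s _ => gnd s).
have -> : (\int[nu]_s limn (g ^~ s) = +oo)%E.
  rewrite -nu_infinite -[RHS]mul1e -(integral_cst _ measurableT 1).
  apply: ae_eq_integral => //.
    apply: (emeasurable_fun_cvg g) => // s _.
    by apply: ereal_nondecreasing_is_cvgn; exact: gnd.
  apply: filterS ae_largest_mass_lt1 => s s1 _ /=.
  apply/cvg_lim => //; apply/fine_cvgP; split; first exact: nearW.
  rewrite /= -[X in _ --> X]subr0; apply: cvgB; first exact: cvg_cst.
  by apply: cvg_expr; rewrite ger0_norm ?mass_ge0.
move=> goo; apply/cvgeryP.
rewrite -(cvg_shiftS _).
apply: (@gee_cvgy _ _ _ _ (fun n => \int[nu]_x g n x)%E); last exact: goo.
apply: nearW => n; rewrite /= split_rate_of_sizeE//; apply: ge0_le_integral => //.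
- exact: measurable_one_sub_psum.
- by move=> s _; rewrite lee_fin lerB// psum_le.
Qed.

(** The bounds [1 - psum s n <= n * (1 - s 0)] and [psum s 2 <= s 0] give
    [lambda_n <= n * lambda_2], so [lambda_2] cannot vanish since [lambda_n]
    diverges. *)
Lemma split_rate_gt0 m : (1 < m)%N -> 0 < split_rate_of_size nu m.
Proof.
move=> m1; apply: (@lt_le_trans _ _ (split_rate_of_size nu 2)); last first.
  exact: split_rate_nondecreasing.
rewrite lt_neqAle split_rate_ge0 andbT; apply/eqP => lam2.
have lam0 n : split_rate_of_size nu n.+1 = 0.
  apply/eqP; rewrite eq_le split_rate_ge0 andbT.
  rewrite -[leRHS](mulr0 n.+1%:R) lam2 -lee_fin EFinM !split_rate_of_sizeE//.
  rewrite -ge0_integralZl//; last first.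
  - by move=> s _; rewrite lee_fin subr_ge0 psum_le1.
  - exact: measurable_one_sub_psum.
  apply: ge0_le_integral => //.
  - by move=> s _; rewrite lee_fin subr_ge0 psum_le1.
  - exact: measurable_one_sub_psum.
  - apply: measurable_funeM.
    exact: measurable_one_sub_psum.
  move=> s _; rewrite -EFinM lee_fin.
  apply: (@le_trans _ _ (n.+1%:R * (1 - s 0%N))).
    apply: le_trans (one_sub_expr_le n.+1 _); last by rewrite mass_ge0 mass_le1.
    by rewrite lerB// psum_ge.
  by rewrite ler_pM2l ?ltr0n// lerB//; have := psum_le s 1; rewrite expr1.
have := split_rate_infty; rewrite -(cvg_shiftS _).
rewrite (_ : (fun n => _) = fun=> 0); last by apply/funext => n; rewrite /= lam0.
move=> /cvgryPgt/(_ 0) [N _ /(_ N (leqnn N))]; by rewrite /= ltxx.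
Qed.

(** For a conservative [s] and [0 < N] this is, by the binomial formula, the sum of
    the [s i * (1 - s i) ^+ N]: the probability that an integer has a colour not
    shared by any of [N] others. *)
Definition alternating_psum (N : nat) (s : mass_partition R) : R :=
  \sum_(k < N.+1) (-1) ^+ k * 'C(N, k)%:R * (psum s k.+1 - 1).

(** The integral of [alternating_psum N], by linearity: the rate at which a split
    separates an integer from [N] others all at once. It bounds the rate at which
    its block can lose its frequency. *)
Definition alternating_rate (N : nat) : R :=
  \sum_(k < N.+1) (-1) ^+ k * 'C(N, k)%:R * (- split_rate_of_size nu k.+1).

Lemma alternating_rateE N :
  (alternating_rate N)%:E = (\int[nu]_s (alternating_psum N s)%:E)%E.
Proof.
rewrite /alternating_rate /alternating_psum -sumEFin.
under [RHS]eq_integral do rewrite -sumEFin.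
rewrite integral_sum//; last first.
  move=> k; apply: (@eq_integrable _ _ _ _ _ measurableT (fun s =>
    (- ((-1) ^+ k * 'C(N, k)%:R))%:E * (1 - psum s k.+1)%:E)%E).
    by move=> s _; rewrite -EFinM mulNr -mulrN opprB.
  by apply: integrableZl => //; exact: integrable_psum.
apply: eq_bigr => k _.
transitivity (\int[nu]_s ((- ((-1) ^+ k * 'C(N, k)%:R))%:E * (1 - psum s k.+1)%:E))%E.
  rewrite integralZl//; last exact: integrable_psum.
  by rewrite -split_rate_of_sizeE// -EFinM mulrN mulNr.
by apply: eq_integral => s _; rewrite -EFinM mulNr -mulrN opprB.
Qed.

Lemma psum_cvg (s : mass_partition R) m : (0 < m)%N ->
  \sum_(0 <= i < K) s i ^+ m @[K --> \oo] --> psum s m.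
Proof.
move=> m0.
have : (\sum_(0 <= i < K) (s i ^+ m)%:E)%E @[K --> \oo] --> power_sum s m.
  by apply: is_cvg_nneseries => k _ _; rewrite lee_fin exprn_ge0// mass_ge0.
rewrite psumE// => /fine_cvg; rewrite /= => H.
apply: cvg_trans H; apply: near_eq_cvg; near=> K => /=.
by rewrite sumEFin.
Unshelve. all: by end_near. Qed.

Lemma mul_expr_one_sub_le (x : R) N : 0 <= x <= 1 -> N%:R * (x * (1 - x) ^+ N) <= 1.
Proof.
move=> /andP[x0 x1].
have : (1 - x) ^+ N * (1 + N%:R * x) <= 1.
  elim: N => [|N IHN]; first by rewrite expr0 mul0r addr0 mulr1.
  apply: le_trans IHN; rewrite exprSr -mulrA ler_wpM2l ?exprn_ge0 ?subr_ge0//.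
  rewrite -natr1; have := mulr_ge0 (ler0n R N) (mulr_ge0 x0 x0); have := mulr_ge0 x0 x0.
  nra.
have : 0 <= (1 - x) ^+ N by rewrite exprn_ge0// subr_ge0.
set y := (1 - x) ^+ N; nra.
Qed.

Lemma alternating_psum_cvg (s : mass_partition R) N : (0 < N)%N ->
  \sum_(0 <= i < K) s i * (1 - s i) ^+ N @[K --> \oo] --> alternating_psum N s.
Proof.
move=> N0.
have -> : alternating_psum N s =
    \sum_(k < N.+1) (-1) ^+ k * 'C(N, k)%:R * psum s k.+1.
  rewrite /alternating_psum.
  under eq_bigr do rewrite mulrBr mulr1.
  rewrite sumrB [X in _ - X](_ : _ = (1 - 1) ^+ N); last first.
    rewrite exprBn; apply: eq_bigr => k _.
    by rewrite !expr1n !mulr1 mulr_natr.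
  by rewrite subrr expr0n eqn0Ngt N0 subr0.
rewrite (_ : (fun K => _) = fun K =>
    \sum_(k < N.+1) (-1) ^+ k * 'C(N, k)%:R * \sum_(0 <= i < K) s i ^+ k.+1); last first.
  apply/funext => K.
  under [RHS]eq_bigr do rewrite mulr_sumr.
  rewrite exchange_big/=; apply: eq_bigr => i _.
  rewrite exprBn mulr_sumr; apply: eq_bigr => k _.
  by rewrite expr1n mulr1 exprS -mulr_natr mulrCA; lra.
by apply: cvg_sumr => k _; apply: cvgMl_tmp; exact: psum_cvg.
Qed.

Lemma alternating_psum_ge0 (s : mass_partition R) N : (0 < N)%N -> 0 <= alternating_psum N s.
Proof.
move=> N0; apply: (cvgr_to_ge (alternating_psum_cvg N0)); apply: nearW => K /=.
by apply: sumr_ge0 => i _; rewrite mulr_ge0 ?exprn_ge0 ?subr_ge0 ?mass_ge0 ?mass_le1.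
Qed.

Lemma sum_mass_le1 (s : mass_partition R) K : \sum_(0 <= i < K) s i <= 1.
Proof.
rewrite -lee_fin; apply: le_trans (total_mass_le1 s); rewrite -sumEFin.
by apply: nneseries_lim_ge => k _ _; rewrite lee_fin mass_ge0.
Qed.

(** Domination by an integrable function, uniformly in [N]: the largest mass
    contributes at most [1 - s 0], and so do all the others together. *)
Lemma alternating_psum_le (s : mass_partition R) N : (0 < N)%N ->
  alternating_psum N s <= 2 * (1 - s 0%N).
Proof.
move=> N0; apply: (cvgr_to_le (alternating_psum_cvg N0)); near=> K => /=.
have K0 : (0 < K)%N by near: K; exact: nbhs_infty_gt.
have := sum_mass_le1 s K.
have split0 (f : nat -> R) :
    \sum_(0 <= i < K) f i = f 0%N + \sum_(0 <= i < K.-1) f i.+1.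
  by rewrite -[in LHS](prednK K0) big_nat_recl.
rewrite !split0 => sle1.
have : s 0%N * (1 - s 0%N) ^+ N <= 1 - s 0%N.
  rewrite -(prednK N0) exprS mulrCA ler_piMr ?subr_ge0 ?mass_le1//.
  by rewrite mulr_ile1 ?exprn_ge0 ?exprn_ile1 ?subr_ge0 ?mass_ge0 ?mass_le1// gerBl mass_ge0.
have : \sum_(0 <= i < K.-1) s i.+1 * (1 - s i.+1) ^+ N <= \sum_(0 <= i < K.-1) s i.+1.
  apply: ler_sum => i _; rewrite ler_piMr ?mass_ge0// exprn_ile1 ?subr_ge0 ?mass_le1//.
  by rewrite gerBl mass_ge0.
lra.
Unshelve. all: by end_near. Qed.

(** Each of the first [J] masses contributes at most [1 / N]. *)
Lemma alternating_psum_le_tail (s : mass_partition R) N J : (0 < N)%N ->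
  alternating_psum N s <= J%:R / N%:R + (1 - \sum_(0 <= i < J) s i).
Proof.
move=> N0; apply: (cvgr_to_le (alternating_psum_cvg N0)); near=> K => /=.
have JK : (J <= K)%N by near: K; exact: nbhs_infty_ge.
have splitJ (f : nat -> R) :
    \sum_(0 <= i < K) f i = \sum_(0 <= i < J) f i + \sum_(J <= i < K) f i.
  exact: big_cat_nat.
have := sum_mass_le1 s K; rewrite !splitJ.
have : \sum_(0 <= i < J) s i * (1 - s i) ^+ N <= J%:R / N%:R.
  apply: (@le_trans _ _ (\sum_(0 <= i < J) N%:R^-1)); last first.
    by rewrite sumr_const_nat subn0 mulr_natl.
  apply: ler_sum => i _; rewrite -(ler_pM2l (_ : 0 < N%:R)) ?ltr0n//.
  by rewrite divff ?pnatr_eq0 -?lt0n// mul_expr_one_sub_le// mass_ge0 mass_le1.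
have : \sum_(J <= i < K) s i * (1 - s i) ^+ N <= \sum_(J <= i < K) s i.
  apply: ler_sum => i _; rewrite ler_piMr ?mass_ge0// exprn_ile1 ?subr_ge0 ?mass_le1//.
  by rewrite gerBl mass_ge0.
lra.
Unshelve. all: by end_near. Qed.

Lemma measurable_alternating_psum N : measurable_fun setT (alternating_psum N).
Proof.
apply: measurable_sum => k; apply: measurable_funM => //.
by apply: measurable_funB => //; exact: measurable_psum.
Qed.

Lemma alternating_psum_cvg0 (s : mass_partition R) : total_mass s = 1%E ->
  alternating_psum N s @[N --> \oo] --> 0.
Proof.
move=> s1; apply/cvgrPdist_le => e e0.
have : \sum_(0 <= i < J) s i @[J --> \oo] --> (1 : R).
  have -> : (1 : R) = psum s 1 by rewrite /psum power_sum1 s1.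
  by have := @psum_cvg s 1 isT; under eq_fun do under eq_bigr do rewrite expr1.
move=> /cvgrPdist_le/(_ (e / 2) ltac:(by rewrite divr_gt0)) [J _ /(_ J (leqnn J))] /=.
rewrite ger0_norm ?subr_ge0 ?sum_mass_le1// => sJ.
near=> N.
have N0 : (0 < N)%N by near: N; exact: nbhs_infty_gt.
rewrite distrC subr0 ger0_norm ?alternating_psum_ge0//.
apply: le_trans (alternating_psum_le_tail s J N0) _.
rewrite [leRHS]splitr lerD// ler_pdivrMr ?ltr0n//.
rewrite -ler_pdivrMl ?divr_gt0//.
by near: N; exact: nbhs_infty_ger.
Unshelve. all: by end_near. Qed.

(** Dominated convergence: a conservative [s] leaves no mass to isolated integers. *)
Lemma alternating_rate_cvg0 : alternating_rate N @[N --> \oo] --> 0.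
Proof.
rewrite -(cvg_shiftS alternating_rate).
have ig : nu.-integrable setT (fun s : mass_partition R => (2 : R)%:E * (1 - s 0%N)%:E)%E.
  exact: integrableZl integrable_largest_mass.
have [] := @dominated_convergence _ _ _ nu setT measurableT
  (fun N s => (alternating_psum N.+1 s)%:E) (cst 0%E) _ _ _ _ ig _.
- by move=> N; apply/measurable_EFinP; exact: measurable_alternating_psum.
- exact: measurable_cst.
- apply: filterS ae_total_mass => s s1 _.
  apply/fine_cvgP; split; first exact: nearW.
  by have := alternating_psum_cvg0 s1; rewrite -(cvg_shiftS (alternating_psum ^~ s)).
- apply: aeW => s N _; rewrite -EFinM gee0_abs ?lee_fin ?alternating_psum_ge0//.
  exact: alternating_psum_le.
move=> _ _; rewrite integral_cst// mul0e.
rewrite (_ : [sequence _]_n = fun N => (alternating_rate N.+1)%:E); last first.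
  by apply/funext => N /=; rewrite alternating_rateE.
by move=> /fine_cvgP[_].
Qed.

End split_rates.

(** * Semigroups of finite chains *)

Section finite_markov_semigroup.
Variables (R : realType) (S : finType) (Q : 'M[R]_#|S|).

Lemma mxE_expr_le k i j : `|(Q ^+ k) i j| <= (1 + \sum_i \sum_j `|Q i j|) ^+ k.
Proof.
set M := 1 + _.
have M1 : 1 <= M by rewrite lerDl sumr_ge0// => ? _; exact: sumr_ge0.
elim: k i j => [|k IHk] i j.
  by rewrite !expr0 mxE; case: eqP => _; rewrite ?normr1 ?normr0 ?ler01.
rewrite exprS mxE exprS; apply: le_trans (ler_norm_sum _ _ _) _.
apply: (@le_trans _ _ (\sum_l `|Q i l| * M ^+ k)).
  by apply: ler_sum => l _; rewrite normrM ler_wpM2l.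
rewrite -mulr_suml ler_wpM2r ?exprn_ge0 ?(le_trans ler01)//.
rewrite /M [X in _ <= 1 + X](bigD1 i)//= addrCA lerDl addr_ge0// sumr_ge0// => ? _; exact: sumr_ge0.
Qed.

Lemma is_cvg_transition t x y :
  cvgn (series (fun k => t ^+ k / k`!%:R * (Q ^+ k) (enum_rank x) (enum_rank y))).
Proof.
set M := 1 + \sum_i \sum_j `|Q i j|.
apply: normed_cvg.
apply: (@series_le_cvg _ _ (exp_coeff (`|t| * M))) => [k|k|k|].
- exact: normr_ge0.
- apply: exp_coeff_ge0; rewrite mulr_ge0//.
  by rewrite addr_ge0// sumr_ge0// => ? _; exact: sumr_ge0.
- rewrite /= /exp_coeff /= !normrM normrX normfV exprMn mulrAC.
  rewrite [`|k`!%:R|]ger0_norm// ler_wpM2r ?invr_ge0// ler_wpM2l ?exprn_ge0//.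
  exact: mxE_expr_le.
- exact: is_cvg_series_exp_coeff.
Qed.

Definition mx_fun (v : S -> R) (x : S) : R :=
  \sum_y Q (enum_rank x) (enum_rank y) * v y.

(** The predicate [W] is an absorbing set of states, outside of which [v] need not
    be an eigenvector. *)
Lemma mx_fun_expr (W : pred S) (c : R) (v : S -> R) k x :
  (forall x y, W x -> ~~ W y -> Q (enum_rank x) (enum_rank y) = 0) ->
  (forall x, W x -> mx_fun v x = c * v x) ->
  W x -> \sum_y (Q ^+ k) (enum_rank x) (enum_rank y) * v y = c ^+ k * v x.
Proof.
move=> WQ Wv; elim: k x => [|k IHk] x Wx.
  rewrite !expr0 (bigD1 x)//= mxE eqxx !mul1r big1 ?addr0// => y yx.
  by rewrite mxE (inj_eq enum_rank_inj) eq_sym (negbTE yx) mul0r.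
rewrite exprS.
transitivity (\sum_z Q (enum_rank x) (enum_rank z) *
    \sum_y (Q ^+ k) (enum_rank z) (enum_rank y) * v y).
  under eq_bigr do rewrite mxE mulr_suml.
  rewrite exchange_big/= (reindex (@enum_rank S))/=; last first.
    by exists enum_val => ? _; rewrite ?enum_valK ?enum_rankK.
  by apply: eq_bigr => z _; rewrite mulr_sumr; apply: eq_bigr => y _; rewrite mulrA.
transitivity (\sum_z Q (enum_rank x) (enum_rank z) * (c ^+ k * v z)).
  apply: eq_bigr => z _; have [Wz|Wz] := boolP (W z); first by rewrite IHk.
  by rewrite (WQ x z)// !mul0r.
under eq_bigr do rewrite mulrCA.
by rewrite -mulr_sumr -/(mx_fun v x) Wv// mulrA exprSr.
Qed.

(** A function that is an eigenvector of the generator along the states that can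
    be reached is an eigenvector of the semigroup. *)
Lemma transition_eigen (W : pred S) (c : R) (v : S -> R) t x :
  (forall x y, W x -> ~~ W y -> Q (enum_rank x) (enum_rank y) = 0) ->
  (forall x, W x -> mx_fun v x = c * v x) ->
  W x -> \sum_y transition Q t x y * v y = expR (t * c) * v x.
Proof.
move=> WQ Wv Wx.
pose u y k := t ^+ k / k`!%:R * (Q ^+ k) (enum_rank x) (enum_rank y).
have H1 : \sum_y series (u y) n * v y @[n --> \oo] --> \sum_y transition Q t x y * v y.
  apply: cvg_sumr => y _; apply: cvgMr_tmp; exact: is_cvg_transition.
have H2 : series (exp_coeff (t * c)) n * v x @[n --> \oo] --> expR (t * c) * v x.
  apply: cvgMr_tmp; exact: is_cvg_series_exp_coeff.
suff E : (fun n => series (exp_coeff (t * c)) n * v x) =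
    (fun n => \sum_y series (u y) n * v y).
  by rewrite E in H2; exact: (cvg_unique (@norm_hausdorff _ _) H1 H2).
apply/funext => n; rewrite /series /= mulr_suml.
under [RHS]eq_bigr do rewrite mulr_suml.
rewrite exchange_big/=; apply: eq_bigr => k _.
rewrite /exp_coeff/= exprMn mulrAC -mulrA -mulrA [RHS](_ : _ = t ^+ k / k`!%:R *
  \sum_y (Q ^+ k) (enum_rank x) (enum_rank y) * v y); last first.
  by rewrite mulr_sumr; apply: eq_bigr => y _; rewrite /u mulrA.
rewrite (mx_fun_expr k WQ Wv Wx); lra.
Qed.

Lemma transition_relabel (h : S -> S) t x y : bijective h ->
  (forall x y, Q (enum_rank (h x)) (enum_rank (h y)) = Q (enum_rank x) (enum_rank y)) ->
  transition Q t (h x) (h y) = transition Q t x y.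
Proof.
move=> bh hQ; rewrite /transition; congr (limn (series _)); apply/funext => k.
congr (_ * _); elim: k x y => [|k IHk] x y.
  by rewrite !expr0 !mxE !(inj_eq enum_rank_inj) (inj_eq (bij_inj bh)).
rewrite exprS !mxE.
have rb : {on predT, bijective (@enum_rank S)}.
  by exists enum_val => ? _; rewrite ?enum_valK ?enum_rankK.
rewrite !(reindex (@enum_rank S))//= (reindex h)/=; last exact: onW_bij.
by apply: eq_bigr => z _; rewrite hQ IHk.
Qed.

End finite_markov_semigroup.

(** * Partitions of a finite set with independently splitting blocks *)

Section split_block.
Variable T : finType.
Implicit Types (x D : {set {set T}}) (B : {set T}).

Definition split_block x B D : {set {set T}} := (D :|: (x :\ B))%SET.

Lemma partition_split_block x B D :
  finset.partition x [set: T]%SET -> B \in x -> finset.partition D B ->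
  finset.partition (split_block x B D) [set: T]%SET.
Proof.
move=> xP Bx DB.
have /and3P[/eqP c1 t1 n1] := partitionD1 xP Bx.
have /and3P[/eqP c2 t2 n2] := DB.
apply/and3P; split.
- rewrite /finset.cover finset.bigcup_setU.
  by rewrite -[X in (X :|: _)%SET]/(finset.cover D) -[X in (_ :|: X)%SET]/(finset.cover (x :\ B)%SET)
    c1 c2 finset.setTD finset.setUCr.
- apply: trivIsetU => //; rewrite c1 c2 finset.setTD.
  by rewrite -finset.setI_eq0 finset.setICr.
- by rewrite inE negb_or n2.
Qed.

Lemma pblock_split_block x B D i :
  finset.partition x [set: T]%SET -> B \in x -> finset.partition D B ->
  finset.pblock (split_block x B D) i =
  if i \in B then finset.pblock D i else finset.pblock x i.
Proof.
move=> xP Bx DB.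
have /and3P[_ tS _] := partition_split_block xP Bx DB.
have /and3P[/eqP cx tx _] := xP.
have /and3P[/eqP cD tD _] := DB.
case: ifPn => iB; apply: def_pblock => //.
- by rewrite inE pblock_mem// cD.
- by rewrite mem_pblock cD.
- rewrite !inE pblock_mem ?cx ?inE// andbT; apply/orP; right.
  by apply: contra iB => /eqP <-; rewrite mem_pblock cx inE.
- by rewrite mem_pblock cx inE.
Qed.

Lemma pblock_split_block_sub x B D i :
  finset.partition x [set: T]%SET -> B \in x -> finset.partition D B ->
  finset.pblock (split_block x B D) i \subset finset.pblock x i.
Proof.
move=> xP Bx DB; rewrite (pblock_split_block _ xP Bx DB).
have /and3P[/eqP cx tx _] := xP; have /and3P[/eqP cD tD _] := DB.
case: ifPn => // iB; rewrite (def_pblock tx Bx iB); apply: (partitionS DB).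
by rewrite pblock_mem// cD.
Qed.

Lemma pblock_proper B D i : finset.partition D B -> (1 < #|D|)%N ->
  finset.pblock D i != B.
Proof.
move=> DB D1; apply: contraTneq D1 => pB; rewrite -leqNgt.
have /and3P[/eqP cD tD D0] := DB.
have [iB|iB] := boolP (i \in finset.cover D); last first.
  suff -> : D = finset.set0 by rewrite cards0.
  apply/eqP; rewrite -finset.subset0; apply/fintype.subsetP => C CD.
  have B0 : B = finset.set0.
    rewrite -pB; apply/eqP; rewrite -finset.subset0; apply/fintype.subsetP => j.
    by rewrite inE /finset.pblock; case: pickP => [A /andP[AD iA]|]; rewrite ?inE//;
       case/negP: iB; apply/bigcupP; exists A.
  have := partitionS DB CD; rewrite B0 finset.subset0 => /eqP C0.
  by rewrite -C0 CD in D0.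
suff -> : D = [set B]%SET by rewrite cards1.
have BD : B \in D by rewrite -pB pblock_mem.
apply/eqP; rewrite finset.eqEsubset finset.sub1set BD andbT.
apply/fintype.subsetP => C CD; rewrite inE.
have [y yC] : exists y, y \in C.
  by apply/set0Pn; apply: contraNneq D0 => <-.
have yB : y \in B by rewrite (fintype.subsetP (partitionS DB CD)).
by rewrite -(def_pblock tD CD yC) (def_pblock tD BD yB).
Qed.

End split_block.

Section split_generator.
Variables (R : realType) (nu : {measure set (mass_partition R) -> \bar R}) (n : nat).
Implicit Types (x y D : {set {set 'I_n}}) (B : {set 'I_n}).

Definition block_sizes (m : nat) (D : {set {set 'I_m}}) : seq nat :=
  [seq #|C : {set 'I_m}| | C <- enum D].

(** Summing over the splits [(B, D)] instead of the target states removes the need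
    to decide which split leads to a given state. *)
Lemma split_generator_fun (v : {set {set 'I_n}} -> R) x :
  mx_fun (split_generator nu n) v x =
  \sum_(B in x) \sum_(D | finset.partition D B && (1 < #|D|)%N)
     fine (p_ nu (block_sizes D)) * (v (split_block x B D) - v x).
Proof.
rewrite /mx_fun (bigD1 x)//= mxE eqxx enum_rankK.
rewrite [X in _ + X](eq_bigr (fun y => split_rate nu x y * v y)); last first.
  by move=> y yx; rewrite mxE (inj_eq enum_rank_inj) eq_sym (negbTE yx) !enum_rankK.
rewrite mulNr mulr_suml addrC -sumrB.
rewrite (eq_bigr (fun y => split_rate nu x y * (v y - v x))); last first.
  by move=> y _; rewrite mulrBr.
transitivity (\sum_y split_rate nu x y * (v y - v x)).
  by rewrite [RHS](bigD1 x)//= subrr mulr0 add0r.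
rewrite /split_rate.
rewrite (eq_bigr (fun y => \sum_(B in x)
    \sum_(D | finset.partition D B && (1 < #|D|)%N)
      (if y == split_block x B D then
         fine (p_ nu (block_sizes D)) * (v y - v x) else 0))); last first.
  move=> y _; rewrite mulr_suml; apply: eq_bigr => B Bx.
  by rewrite mulr_suml -big_mkcondr/=; apply: eq_bigl => D; rewrite andbA.
rewrite exchange_big/=; apply: eq_bigr => B Bx.
rewrite exchange_big/=; apply: eq_bigr => D _.
by rewrite -big_mkcond/= (big_pred1 (split_block x B D)).
Qed.

Lemma split_generator_eq0 x y : x != y ->
  (forall B D, B \in x -> finset.partition D B -> (1 < #|D|)%N -> y != split_block x B D) ->
  split_generator nu n (enum_rank x) (enum_rank y) = 0.
Proof.
move=> xy H; rewrite mxE (inj_eq enum_rank_inj) (negbTE xy) !enum_rankK /split_rate.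
rewrite big1// => B Bx; rewrite big1// => D /and3P[DB D1 /eqP yE].
by have := H B D Bx DB D1; rewrite yE eqxx.
Qed.

Definition split_stable (W : pred {set {set 'I_n}}) :=
  forall x B D, W x -> B \in x -> finset.partition D B -> W (split_block x B D).

Lemma transition_split_eigen (W : pred {set {set 'I_n}}) (c : R) v t x :
  split_stable W ->
  (forall x, W x -> \sum_(B in x) \sum_(D | finset.partition D B && (1 < #|D|)%N)
     fine (p_ nu (block_sizes D)) * (v (split_block x B D) - v x) = c * v x) ->
  W x -> \sum_y transition (split_generator nu n) t x y * v y = expR (t * c) * v x.
Proof.
move=> sW Wv; apply: (transition_eigen (W := W)).
  move=> {}x y Wx Wy; apply: split_generator_eq0.
    by apply: contraNneq Wy => <-.
  move=> B D Bx DB _; apply: contraNneq Wy => ->; exact: sW.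
by move=> {}x Wx; rewrite split_generator_fun Wv.
Qed.

(** Let [B] be the block of [i] in [x]. On the partitions whose block of [i] is
    contained in [B], the indicator that this block is [B] is an eigenvector: only
    the splits of [B] matter, they all set the indicator to 0, and their total rate
    is [lambda_m] with [m] the cardinality of [B]. *)
Lemma transition_same_block t x i : finset.partition x [set: 'I_n]%SET ->
  \sum_(y | finset.pblock y i == finset.pblock x i)
    transition (split_generator nu n) t x y =
  expR (- t * split_rate_of_size nu #|finset.pblock x i|).
Proof.
move=> xP; set B := finset.pblock x i.
pose v y : R := (finset.pblock y i == B)%:R.
pose W := [pred y | finset.partition y [set: 'I_n]%SET && (finset.pblock y i \subset B)].
have := @transition_split_eigen W (- split_rate_of_size nu #|B|) v t x.
rewrite mulrN mulNr /v eqxx mulr1 => <- //=.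
- rewrite [RHS](bigID (fun y => finset.pblock y i == B))/= [X in _ + X]big1 ?addr0.
    by apply: eq_bigr => y ->; rewrite mulr1.
  by move=> y /negbTE ->; rewrite mulr0.
- move=> y C D /andP[yP yB] Cy DC; rewrite /= partition_split_block//=.
  by apply: fintype.subset_trans yB; exact: pblock_split_block_sub.
- move=> z /= /andP[zP zB].
  have /and3P[/eqP cz tz _] := zP.
  have [ziB|ziB] := eqVneq (finset.pblock z i) B; last first.
    rewrite mulr0 big1// => C Cx; rewrite big1// => D /andP[DC _].
    suff -> : finset.pblock (split_block z C D) i == B = false by rewrite subr0 mulr0.
    apply/negbTE/eqP => sB; move/eqP: ziB; apply.
    apply/eqP; rewrite finset.eqEsubset zB/= -sB; exact: pblock_split_block_sub.
  have Bx : B \in z by rewrite -ziB pblock_mem// cz inE.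
  have iB : i \in B by rewrite -ziB mem_pblock cz inE.
  rewrite (bigD1 B)//= [X in _ + X]big1 ?addr0; last first.
    move=> C /andP[Cx CB]; rewrite big1// => D /andP[DC _].
    rewrite (pblock_split_block _ zP Cx DC) ifF ?ziB ?eqxx ?subrr ?mulr0//.
    by apply/negbTE; apply: contra CB => iC; rewrite -ziB (def_pblock tz Cx iC).
  rewrite mulr1 -split_rate_of_block -sumrN; apply: eq_bigr => D /andP[DB D1].
  rewrite (pblock_split_block _ zP Bx DB) iB (negbTE (pblock_proper _ DB D1)).
  by rewrite sub0r mulrN1.
by rewrite /W/= xP/=.
Qed.

(** The partitions separating [i] and [j] are stable under splitting. *)
Lemma transition_separated t x i j : finset.partition x [set: 'I_n]%SET ->
  j \notin finset.pblock x i ->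
  \sum_(y | j \in finset.pblock y i) transition (split_generator nu n) t x y = 0.
Proof.
move=> xP xij.
pose v y : R := (j \in finset.pblock y i)%:R.
pose W := [pred y | finset.partition y [set: 'I_n]%SET && (j \notin finset.pblock y i)].
have Wst : split_stable W.
  move=> y C D /andP[yP yB] Cy DC; rewrite /W/= partition_split_block//=.
  by apply: contra yB; apply: fintype.subsetP; exact: pblock_split_block_sub.
have vx : v x = 0 by rewrite /v (negbTE xij).
transitivity (\sum_y transition (split_generator nu n) t x y * v y).
  rewrite [RHS](bigID (fun y => j \in finset.pblock y i))/= [X in _ + X]big1 ?addr0.
    by apply: eq_bigr => y yij; rewrite /v yij mulr1.
  by move=> y /negbTE yij; rewrite /v yij mulr0.
rewrite (@transition_split_eigen W 0 v t x Wst).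
- by rewrite vx mulr0.
- move=> y Wy; rewrite mul0r big1// => C Cy; rewrite big1// => D /andP[DC _].
  have /andP[_ /negbTE yij] := Wy.
  have /andP[_ /negbTE yij'] := Wst y C D Wy Cy DC.
  by rewrite /v yij yij' subrr mulr0.
- by rewrite /W/= xP.
Qed.

End split_generator.

(** * Invariance of the rates under relabelling *)

Definition relabel (T T' : finType) (f : T -> T') (x : {set {set T}}) : {set {set T'}} :=
  [set f @: (C : {set T}) | C in x]%SET.

Lemma relabel_inj (T T' : finType) (f : T -> T') : injective f -> injective (relabel f).
Proof. by move=> finj; apply: imset_inj; exact: imset_inj. Qed.

Lemma relabel_bij (T : finType) (f : T -> T) : injective f -> bijective (relabel f).
Proof. by move=> finj; apply: injF_bij; exact: relabel_inj. Qed.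

Lemma relabel_comp (T1 T2 T3 : finType) (f : T1 -> T2) (g : T2 -> T3) x :
  relabel g (relabel f x) = relabel (g \o f) x.
Proof. by rewrite /relabel -imset_comp; apply: eq_imset => C /=; rewrite -imset_comp. Qed.

Lemma pblock_relabel (T T' : finType) (f : T -> T') x i j : injective f ->
  finset.partition x [set: T]%SET ->
  (f j \in finset.pblock (relabel f x) (f i)) = (j \in finset.pblock x i).
Proof.
move=> finj xP; have /and3P[/eqP cx tx x0] := xP.
have tfx : finset.trivIset (relabel f x) by rewrite imset_trivIset.
have -> : finset.pblock (relabel f x) (f i) = (f @: finset.pblock x i)%SET.
  apply: def_pblock => //; last by rewrite imset_f// mem_pblock cx inE.
  by apply: imset_f; rewrite pblock_mem// cx inE.
by rewrite mem_imset.
Qed.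

(** Brings an arbitrary block into the form required by [p_imset]. *)
Lemma partition_enum_val (n : nat) (B : {set 'I_n}) (D : {set {set 'I_n}}) :
  finset.partition D B ->
  exists2 D' : {set {set 'I_#|B|}},
    finset.partition D' [set: 'I_#|B|]%SET & D = relabel (enum_val : 'I_#|B| -> 'I_n) D'.
Proof.
move=> DB; pose f : 'I_#|B| -> 'I_n := enum_val.
have finj : injective f by exact: enum_val_inj.
have fB : (f @: [set: 'I_#|B|])%SET = B.
  apply/setP => x; apply/imsetP/idP => [[y _ ->]|xB]; first exact: enum_valP.
  by exists (enum_rank_in xB x); rewrite /f ?enum_rankK_in.
pose D' : {set {set 'I_#|B|}} := [set f @^-1: (C : {set 'I_n}) | C in D]%SET.
have DE : D = relabel f D'.
  rewrite /relabel /D' -imset_comp -[LHS]imset_id.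
  apply: eq_in_imset => C CD /=.
  apply/setP => x; apply/idP/imsetP => [xC|[y + ->]]; last by rewrite inE.
  have xB : x \in B by rewrite (fintype.subsetP (partitionS DB CD)).
  exists (enum_rank_in xB x); last by rewrite /f enum_rankK_in.
  by rewrite inE /f enum_rankK_in.
by exists D' => //; rewrite -(imset_partition D' _ finj) fB -/(relabel f D') -DE.
Qed.

Section relabel_rates.
Variables (R : realType) (nu : {measure set (mass_partition R) -> \bar R}) (n : nat).
Variable f : 'I_n -> 'I_n.
Hypothesis finj : injective f.

Lemma p_relabel (B : {set 'I_n}) (D : {set {set 'I_n}}) : finset.partition D B ->
  p_ nu (block_sizes (relabel f D)) = p_ nu (block_sizes D).
Proof.
move=> /partition_enum_val[D' D'P ->]; rewrite relabel_comp.
rewrite /block_sizes /relabel (p_imset nu (inj_comp finj (@enum_val_inj _ _)) D'P).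
by rewrite (p_imset nu (@enum_val_inj _ _) D'P).
Qed.

Lemma split_rate_relabel x y : split_rate nu (relabel f x) (relabel f y) = split_rate nu x y.
Proof.
rewrite /split_rate big_imset/=; last by move=> ? ? _ _; exact: imset_inj.
apply: eq_bigr => B Bx.
rewrite (reindex (relabel f))/=; last exact: onW_bij (relabel_bij finj).
have condE (D : {set {set 'I_n}}) : [&& finset.partition (relabel f D) (f @: B), (1 < #|relabel f D|)%N
      & relabel f y == (relabel f D :|: (relabel f x :\ (f @: B)))%SET] =
    [&& finset.partition D B, (1 < #|D|)%N & y == (D :|: x :\ B)%SET].
  rewrite imset_partition// card_imset; last exact: imset_inj.
  do 2!congr (_ && _).
  rewrite -[RHS](inj_eq (relabel_inj finj)) /relabel imsetU; congr (_ == (_ :|: _)%SET).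
  apply/setP => C; apply/setD1P/imsetP => [[Cf /imsetP[C' C'x CE]]|[C' /setD1P[C'B C'x] ->]].
    by exists C' => //; rewrite !inE C'x andbT; apply: contraNneq Cf => <-; rewrite CE.
  by split; [rewrite (inj_eq (imset_inj finj))|exact: imset_f].
apply: eq_big => [D|D]; first exact: condE.
by rewrite condE => /and3P[DB _ _]; rewrite -!/(block_sizes _) (p_relabel DB).
Qed.

Lemma split_generator_relabel x y :
  split_generator nu n (enum_rank (relabel f x)) (enum_rank (relabel f y)) =
  split_generator nu n (enum_rank x) (enum_rank y).
Proof.
rewrite !mxE !(inj_eq enum_rank_inj) (inj_eq (relabel_inj finj)) !enum_rankK.
case: eqP => _; last exact: split_rate_relabel.
congr (- _); rewrite (reindex (relabel f))/=; last exact: onW_bij (relabel_bij finj).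
by apply: eq_big => [z|z _]; rewrite ?(inj_eq (relabel_inj finj))// split_rate_relabel.
Qed.

Lemma transition_split_relabel t x y :
  transition (split_generator nu n) t (relabel f x) (relabel f y) =
  transition (split_generator nu n) t x y.
Proof.
by apply: transition_relabel (relabel_bij finj) _; exact: split_generator_relabel.
Qed.

End relabel_rates.

(** Reduces events on arbitrary integers to events on the first ones. *)
Lemma extend_injection (m n : nat) (mn : (m <= n)%N) (u : 'I_m -> 'I_n) : injective u ->
  exists2 f : 'I_n -> 'I_n, injective f & forall i, f (widen_ord mn i) = u i.
Proof.
move=> uinj.
pose L := map u (enum 'I_m) ++ [seq j <- enum 'I_n | j \notin codom u].
have uL : uniq L.
  rewrite cat_uniq map_inj_uniq// enum_uniq/= filter_uniq ?enum_uniq// andbT.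
  apply/hasPn => j; rewrite mem_filter => /andP[ju _].
  by apply: contra ju => /mapP[i _ ->]; exact: codom_f.
have sL : size L = n.
  transitivity (size (enum 'I_n)); last by rewrite size_enum_ord.
  apply: perm_size; apply: uniq_perm => //; first exact: enum_uniq.
  move=> j; rewrite mem_enum mem_cat mem_filter mem_enum andbT.
  by rewrite -[X in X || _]/(j \in codom u) orbN.
exists (fun i => nth i L i).
  move=> i j /=; rewrite (set_nth_default j) ?sL// => /eqP.
  by rewrite nth_uniq ?sL// => /eqP/val_inj.
move=> i /=; rewrite nth_cat size_map size_enum_ord ltn_ord.
by rewrite (nth_map i) ?size_enum_ord// nth_ord_enum.
Qed.

(** * Laws at a fixed time and exchangeability *)

Section finite_valued.
Variables (R : realType) (d : measure_display) (Omega : measurableType d)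
  (P : probability Omega R).

Definition prob (A : set Omega) : R := fine (P A).

Lemma probE A : measurable A -> P A = (prob A)%:E.
Proof. by move=> mA; rewrite /prob fineK// fin_num_measure. Qed.

Lemma prob_ge0 A : 0 <= prob A. Proof. exact: fine_ge0. Qed.

Lemma prob_le1 A : measurable A -> prob A <= 1.
Proof. by move=> mA; rewrite -lee_fin -probE// probability_le1. Qed.

Lemma le_prob A B : measurable A -> measurable B -> A `<=` B -> prob A <= prob B.
Proof. by move=> mA mB AB; rewrite -lee_fin -!probE//; apply: le_measure => //; rewrite inE. Qed.

Variables (T : finType) (H : Omega -> T).
Hypothesis mH : forall y, measurable [set w | H w = y].

Lemma measurable_finite_pred (A : T -> Prop) : measurable [set w | A (H w)].
Proof.
have -> : [set w | A (H w)] = \bigcup_(y in [set y | A y]) [set w | H w = y].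
  by apply/seteqP; split=> [w /= Aw|w [y /= Ay ->]//]; exists (H w).
by apply: fin_bigcup_measurable.
Qed.

Lemma finite_fun_indic (F : T -> R) w :
  F (H w) = \sum_y F y * \1_[set w | H w = y] w.
Proof.
rewrite (bigD1 (H w))//= big1 ?addr0 => [|y yH].
  by rewrite indicE mem_set// mulr1.
rewrite indicE memNset ?mulr0//= => Hy; by rewrite Hy eqxx in yH.
Qed.

Lemma measurable_finite_fun (F : T -> R) : measurable_fun setT (fun w => F (H w)).
Proof.
rewrite (_ : (fun w => _) = fun w => \sum_y F y * \1_[set w | H w = y] w).
  by apply: measurable_sum => y; apply: measurable_funM => //.
by apply/funext => w; exact: finite_fun_indic.
Qed.

Lemma integral_finite_fun (F : T -> R) :
  (\int[P]_w (F (H w))%:E)%E = (\sum_y F y * prob [set w | H w = y])%:E.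
Proof.
under eq_integral do rewrite finite_fun_indic -sumEFin.
have ind y : P.-integrable setT (fun w => ((\1_[set w | H w = y] w : R)%:E)).
  apply/integrableP; split; first by apply/measurable_EFinP; exact: measurable_indic.
  under eq_integral do rewrite gee0_abs ?lee_fin//.
  by rewrite integral_indic// setIT (le_lt_trans (probability_le1 _ _)) ?ltry.
under eq_integral do under eq_bigr do rewrite EFinM.
rewrite integral_sum//; last by move=> y; apply: integrableZl => //; exact: ind.
rewrite -sumEFin; apply: eq_bigr => y _.
by rewrite integralZl//= integral_indic// setIT EFinM -probE.
Qed.

Lemma prob_finite (A : pred T) :
  prob [set w | A (H w)] = \sum_(y | A y) prob [set w | H w = y].
Proof.
have mA : measurable [set w | A (H w)] by exact: (measurable_finite_pred (fun y => A y)).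
apply: EFin_inj; rewrite -probE//.
rewrite -[X in P X]setIT -integral_indic//.
transitivity (\int[P]_w ((A (H w))%:R : R)%:E)%E.
  apply: eq_integral => w _; rewrite indicE; congr (_%:R%:E).
  have [Aw|Aw] := boolP (A (H w)); first by rewrite mem_set.
  by rewrite memNset//=; exact/negP.
rewrite (integral_finite_fun (fun y => (A y)%:R)) [in RHS]big_mkcond; congr EFin.
by apply: eq_bigr => y _; case: (A y); rewrite ?mul1r ?mul0r.
Qed.

End finite_valued.

Section restriction_facts.
Implicit Types (pi : nat_partition).

Lemma nat_partition_refl pi i : pi i i.
Proof. by case: (nat_partitionP pi) => /(_ i). Qed.

Lemma nat_partition_sym pi i j : pi i j = pi j i.
Proof. by case: (nat_partitionP pi) => _ + _; apply. Qed.

Lemma nat_partition_trans pi j i k : pi i j -> pi j k -> pi i k.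
Proof. by case: (nat_partitionP pi) => _ _; apply. Qed.

Lemma nat_partition_eqrel pi n : equivalence_rel (fun i j : 'I_n => pi i j).
Proof.
move=> i j k; split=> [|ij]; first exact: nat_partition_refl.
apply/idP/idP; last exact: nat_partition_trans ij.
by apply: nat_partition_trans; rewrite nat_partition_sym.
Qed.

Lemma restriction_partition n pi : finset.partition (restriction n pi) [set: 'I_n]%SET.
Proof. by apply: partition_equivalence_partition; exact: nat_partition_eqrel. Qed.

Lemma restrictionE n pi (i j : 'I_n) : (j \in finset.pblock (restriction n pi) i) = pi i j.
Proof.
have := @pblock_equivalence_partition _ (fun i j : 'I_n => pi i j) [set: 'I_n]%SET.
by apply; rewrite ?inE// => a b c _ _ _; exact: nat_partition_eqrel.
Qed.

Lemma restriction_eq n pi (y : {set {set 'I_n}}) :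
  finset.partition y [set: 'I_n]%SET ->
  restriction n pi = y <-> forall i j : 'I_n, pi i j = (j \in finset.pblock y i).
Proof.
move=> yP; split=> [<- i j|H]; first by rewrite restrictionE.
rewrite -[RHS](equivalence_partition_pblock yP) /restriction.
by apply: eq_equivalence_partition => i j; rewrite H.
Qed.

Lemma relabel_one_block n (f : 'I_n -> 'I_n) : injective f ->
  relabel f (restriction n one_block) = restriction n one_block.
Proof.
move=> finj.
have fT : (f @: [set: 'I_n])%SET = [set: 'I_n]%SET.
  apply/eqP; rewrite eqEcard finset.subsetT/= card_imset//.
have P1 : finset.partition (relabel f (restriction n one_block)) [set: 'I_n]%SET.
  by rewrite -fT imset_partition// restriction_partition.
apply/esym/restriction_eq => // i j.
have [g gf fg] := injF_bij finj.
by rewrite -[i]fg -[j]fg pblock_relabel// ?restriction_partition// restrictionE.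
Qed.

End restriction_facts.

Section homogeneous.
Variables (R : realType) (d : measure_display) (Omega : measurableType d)
  (P : probability Omega R) (nu : {measure set (mass_partition R) -> \bar R})
  (Pi : R -> Omega -> nat_partition).
Hypothesis Pi_hom : homogeneous_fragmentation P nu Pi.
Local Notation X n t w := (restriction n (Pi t w)).
Local Notation x0 n := (restriction n one_block).

Lemma measurable_same_block t i j : 0 <= t -> measurable [set w | Pi t w i j].
Proof.
move=> t0; have := homogeneous_measurable Pi_hom t0 measurableT.
move=> /(_ [set pi : nat_partition | pi i j]); rewrite setTI; apply.
by apply: sub_sigma_algebra; exists i, j.
Qed.

Lemma measurable_state n t y : 0 <= t -> measurable [set w | X n t w = y].
Proof.
move=> t0.
have [yP|yP] := boolP (finset.partition y [set: 'I_n]%SET); last first.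
  rewrite (_ : [set w | _] = set0)//; apply/seteqP; split=> // w /= wy.
  by move/negP: yP; apply; rewrite -wy restriction_partition.
have -> : [set w | X n t w = y] =
    \bigcap_(k in [set: 'I_n * 'I_n]) [set w | Pi t w k.1 k.2 = (k.2 \in finset.pblock y k.1)].
  apply/seteqP; split=> [w /= /(restriction_eq _ yP) H [i j] _/=|w H]; first exact: H.
  by apply/(restriction_eq _ yP) => i j; exact: (H (i, j)).
apply: fin_bigcap_measurable => // -[i j] _ /=.
case: (j \in _); first exact: measurable_same_block.
rewrite (_ : [set w | _] = ~` [set w | Pi t w i j]).
  by apply: measurableC; exact: measurable_same_block.
by apply/seteqP; split=> w /=; case: (Pi t w i j).
Qed.

Lemma state_law n t y : 0 <= t ->
  prob P [set w | X n t w = y] = transition (split_generator nu n) t (x0 n) y.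
Proof.
move=> t0; have [X0 markov] := homogeneous_markov Pi_hom n.
have := markov [::] 0 t (x0 n) y (lexx _) t0 _; rewrite add0r.
have -> : [set w | [/\ forall h : R * {set {set 'I_n}}, h \in [::] -> X n h.1 w = h.2,
    X n 0 w = x0 n & X n t w = y]] = [set w | X n t w = y].
  by apply/seteqP; split=> [w [//]|w /= Xy]; split => //; exact: X0.
have -> : [set w | (forall h : R * {set {set 'I_n}}, h \in [::] -> X n h.1 w = h.2) /\
    X n 0 w = x0 n] = setT.
  by apply/seteqP; split=> // w _; split => //; exact: X0.
by rewrite probability_setT mul1e /prob => ->.
Qed.

(** Exchangeability: the rates depend on block sizes only. *)
Lemma state_law_relabel n t (f : 'I_n -> 'I_n) y : injective f -> 0 <= t ->
  prob P [set w | X n t w = relabel f y] = prob P [set w | X n t w = y].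
Proof.
move=> finj t0; rewrite !state_law//.
by rewrite -[in LHS](relabel_one_block finj) transition_split_relabel.
Qed.

Lemma prob_relabel n t (f : 'I_n -> 'I_n) (A : pred {set {set 'I_n}}) :
  injective f -> 0 <= t ->
  prob P [set w | A (relabel f (X n t w))] = prob P [set w | A (X n t w)].
Proof.
move=> finj t0; have mX y := @measurable_state n t y t0.
rewrite (prob_finite P mX (fun y => A (relabel f y))) (prob_finite P mX A).
rewrite [RHS](reindex (relabel f))/=; last exact: onW_bij (relabel_bij finj).
by apply: eq_bigr => y _; rewrite state_law_relabel.
Qed.

(** By exchangeability and consistency the [m.+1] integers may be assumed to be the
    first ones, for which the event says that the chain on partitions of
    ['I_m.+1] is still in its initial state. *)
Lemma prob_same_block m n (u : 'I_m.+1 -> 'I_n) t : injective u -> 0 <= t ->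
  prob P [set w | forall k, Pi t w (u ord0) (u k)] =
  expR (- t * split_rate_of_size nu m.+1).
Proof.
move=> uinj t0.
have mn : (m.+1 <= n)%N by have := leq_card u uinj; rewrite !card_ord.
have [f finj fu] := extend_injection mn uinj.
pose e (i : 'I_m.+1) := widen_ord mn i.
have mX := fun y => @measurable_state n t y t0.
transitivity (prob P [set w | [forall k, u k \in finset.pblock (X n t w) (u ord0)]]).
  congr prob; apply/seteqP; split=> w /= => [H|/forallP H k].
    by apply/forallP => k; rewrite restrictionE.
  by have := H k; rewrite restrictionE.
rewrite -(prob_relabel (fun y => [forall k, u k \in finset.pblock y (u ord0)]) finj t0).
transitivity (prob P [set w | finset.pblock (X m.+1 t w) ord0 == [set: 'I_m.+1]%SET]).
  congr prob; apply/seteqP; split=> w /=.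
    move=> /forallP H; apply/eqP/setP => k; rewrite restrictionE inE.
    by have := H k; rewrite -!fu pblock_relabel ?restriction_partition// restrictionE.
  move=> /eqP/setP H; apply/forallP => k.
  rewrite -!fu pblock_relabel ?restriction_partition// restrictionE /=.
  by have := H k; rewrite restrictionE inE.
rewrite (prob_finite P (fun y => @measurable_state m.+1 t y t0)
  (fun y => finset.pblock y ord0 == [set: 'I_m.+1]%SET)).
under eq_bigr do rewrite state_law//.
have := @transition_same_block R nu m.+1 t (x0 m.+1) ord0 (restriction_partition _ _).
have -> : finset.pblock (x0 m.+1) ord0 = [set: 'I_m.+1]%SET.
  by apply/setP => j; rewrite restrictionE inE.
by rewrite cardsT card_ord.
Qed.

End homogeneous.

(** * Almost sure properties of homogeneous paths *)

Lemma ae_forall_countable (R : realType) (d : measure_display) (Omega : measurableType d)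
    (mu : {measure set Omega -> \bar R}) (T : countType) (Q : T -> Omega -> Prop) :
  (forall x, \forall w \ae mu, Q x w) -> \forall w \ae mu, forall x, Q x w.
Proof.
move=> H.
have : \forall w \ae mu, forall n, if @unpickle T n is Some x then Q x w else True.
  apply: ae_foralln => n; case: (@unpickle T n) => [x|]; first exact: H.
  exact: aeW.
by apply: filterS => w Hw x; have := Hw (pickle x); rewrite pickleK.
Qed.

Lemma ae_prob0 (R : realType) (d : measure_display) (Omega : measurableType d)
    (P : probability Omega R) (A : set Omega) : measurable A -> prob P A = 0 ->
  \forall w \ae P, ~ A w.
Proof.
move=> mA PA; exists A; split => //; first by rewrite probE// PA.
by move=> w /= /contrapT.
Qed.

Lemma le_expRN_eq0 (R : realType) (p c : R) : 0 < c ->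
  (forall k, p <= expR (- k%:R * c)) -> p <= 0.
Proof.
move=> c0 H; rewrite leNgt; apply/negP => p0.
have [k] : exists k, p^-1 / c < k%:R :> R.
  by exists (Num.bound (p^-1 / c)); rewrite archi_boundP// divr_ge0 ?invr_ge0 ?ltW.
rewrite ltr_pdivrMr// => kp.
have := H k; rewrite leNgt mulNr expRN => /negP; apply.
rewrite invf_plt ?posrE ?expR_gt0//; apply: lt_le_trans kp _.
by apply: le_trans (expR_ge1Dx _); rewrite lerDr.
Qed.

Section paths.
Variable R : realType.
Implicit Types f : R -> nat_partition.

Lemma cadlag_right f i j t : cadlag f -> 0 <= t ->
  exists2 e, 0 < e & forall u, t <= u < t + e -> f u i j = f t i j.
Proof.
move=> /(_ i j)[+ _] t0 => /(_ t t0) H.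
have : \forall u \near t^'+, f u i j = f t i j by exact: (H _ (discrete_set1 _)).
move=> [e /= e0 He]; exists e => // u /andP[tu ue].
move: tu; rewrite le_eqVlt => /predU1P[<-//|tu].
by apply: He => //=; rewrite ltr0_norm ?subr_lt0// opprB ltrBlDl.
Qed.

(** The properties of a typical path on which all pathwise arguments rest. Such a
    path is determined by the separation times of the pairs of integers. *)
Record fragmenting_path f : Prop := {
  fragmenting_start : f 0 = one_block ;
  fragmenting_right : forall i j t, 0 <= t ->
    exists2 e, 0 < e & forall u, t <= u < t + e -> f u i j = f t i j ;
  fragmenting_monotone : forall i j s t, 0 <= s -> s <= t -> f t i j -> f s i j ;
  fragmenting_total : forall i j, i != j -> exists2 t, 0 <= t & ~~ f t i j }.

Definition separation_time f i j : R := inf [set t | 0 <= t /\ ~~ f t i j].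

Lemma separation_timeP f i j t : fragmenting_path f -> i != j -> 0 <= t ->
  f t i j = (t < separation_time f i j).
Proof.
move=> [_ fr fm ft] ij t0.
have ne : [set t | 0 <= t /\ ~~ f t i j] !=set0.
  by have [s s0 sij] := ft i j ij; exists s.
have lb : has_lbound [set t | 0 <= t /\ ~~ f t i j] by exists 0 => s [].
apply/idP/idP => [ft1|]; last first.
  apply: contraLR => nft; rewrite -leNgt; apply: ge_inf => //.
have [e e0 He] := fr i j t t0.
apply: (@lt_le_trans _ _ (t + e)); first by rewrite ltrDl.
apply: lb_le_inf => // s [s0 ns]; rewrite leNgt; apply/negP => st.
have [ts|st'] := leP t s.
  by rewrite He ?ts ?st// ft1 in ns.
by rewrite (fm i j s t s0 (ltW st') ft1) in ns.
Qed.

Lemma separation_time_gt0 f i j : fragmenting_path f -> i != j -> 0 < separation_time f i j.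
Proof.
by move=> ff ij; rewrite -separation_timeP// (fragmenting_start ff).
Qed.

End paths.

Section homogeneous_paths.
Variables (R : realType) (d : measure_display) (Omega : measurableType d)
  (P : probability Omega R) (nu : {measure set (mass_partition R) -> \bar R})
  (Pi : R -> Omega -> nat_partition).
Hypotheses (nuD : dislocation_measure nu) (nu_infinite : nu setT = +oo%E).
Hypothesis Pi_hom : homogeneous_fragmentation P nu Pi.
Local Notation X n t w := (restriction n (Pi t w)).

Lemma measurable_separated t i j : 0 <= t -> measurable [set w | ~~ Pi t w i j].
Proof.
move=> t0; have -> : [set w | ~~ Pi t w i j] = ~` [set w | Pi t w i j].
  by apply/seteqP; split=> w /= /negP.
by apply: measurableC; exact: (measurable_same_block Pi_hom).
Qed.

Lemma prob_block_seq i (l : seq nat) t : uniq (i :: l) -> 0 <= t ->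
  prob P [set w | all (Pi t w i) l] = expR (- t * split_rate_of_size nu (size l).+1).
Proof.
move=> il t0.
pose n := (\max_(k < (size l).+1) nth 0%N (i :: l) k).+1.
have ltn (k : 'I_(size l).+1) : (nth 0%N (i :: l) k < n)%N.
  by rewrite ltnS (leq_bigmax k).
pose u k : 'I_n := Ordinal (ltn k).
have uinj : injective u.
  by move=> k k' [/eqP]; rewrite nth_uniq//= => /eqP/val_inj.
rewrite -(prob_same_block Pi_hom uinj t0); congr prob; apply/seteqP; split=> w /=.
  move=> /allP H k; case: (unliftP ord0 k) => [k' ->|->]; last exact: nat_partition_refl.
  exact: (H _ (mem_nth 0%N (ltn_ord k'))).
move=> H; apply/(all_nthP 0%N) => k kl.
by have := H (lift ord0 (Ordinal kl)).
Qed.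

Lemma prob_pair i j t : i != j -> 0 <= t ->
  prob P [set w | Pi t w i j] = expR (- t * split_rate_of_size nu 2).
Proof.
move=> ij t0; rewrite -(@prob_block_seq i [:: j])//; last by rewrite /= inE ij.
by congr prob; apply/seteqP; split=> w /=; rewrite andbT.
Qed.

Lemma joint_law n s t x y : 0 <= s -> 0 <= t ->
  prob P [set w | X n s w = x /\ X n (s + t) w = y] =
  prob P [set w | X n s w = x] * transition (split_generator nu n) t x y.
Proof.
move=> s0 t0; have [_ markov] := homogeneous_markov Pi_hom n.
have := markov [::] s t x y s0 t0 (fun _ => ltac:(by [])).
have -> : [set w | [/\ forall h : R * {set {set 'I_n}}, h \in [::] -> X n h.1 w = h.2,
    X n s w = x & X n (s + t) w = y]] = [set w | X n s w = x /\ X n (s + t) w = y].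
  by apply/seteqP; split=> [w [//]|w /= []]; split.
have -> : [set w | (forall h : R * {set {set 'I_n}}, h \in [::] -> X n h.1 w = h.2) /\
    X n s w = x] = [set w | X n s w = x].
  by apply/seteqP; split=> [w []|w /=].
rewrite /prob => ->; rewrite fineM// fin_num_measure//.
exact: (measurable_state Pi_hom).
Qed.

(** Two separated integers are not reunited between two given times; the countable
    set of rational times suffices by right-continuity. *)
Lemma ae_monotone : \forall w \ae P, forall i j s t, 0 <= s -> s <= t -> Pi t w i j -> Pi s w i j.
Proof.
have H : \forall w \ae P, forall k : (nat * nat) * (rat * rat),
    0 <= (ratr k.2.1 : R) -> (ratr k.2.1 : R) <= ratr k.2.2 ->
    ~ (~~ Pi (ratr k.2.1) w k.1.1 k.1.2 /\ Pi (ratr k.2.2) w k.1.1 k.1.2).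
  apply: ae_forall_countable => -[[i j] [p q]] /=.
  have [p0|p0] := boolP (0 <= (ratr p : R)); last first.
    by apply: aeW.
  have [pq|pq] := boolP ((ratr p : R) <= ratr q); last first.
    by apply: aeW.
  set s : R := ratr p in p0 pq *; pose t : R := ratr q - s.
  have t0 : 0 <= t by rewrite subr_ge0.
  have -> : ratr q = s + t by rewrite addrC subrK.
  pose n := (maxn i j).+1.
  have iN : (i < n)%N by rewrite ltnS leq_maxl.
  have jN : (j < n)%N by rewrite ltnS leq_maxr.
  pose i' := Ordinal iN; pose j' := Ordinal jN.
  have mE u v : 0 <= u -> 0 <= v ->
      measurable [set w | ~~ Pi u w i j /\ Pi v w i j].
    move=> u0 v0; apply: measurableI; last exact: (measurable_same_block Pi_hom).
    exact: measurable_separated.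
  suff P0 : prob P [set w | ~~ Pi s w i j /\ Pi (s + t) w i j] = 0.
    have := ae_prob0 (mE _ _ p0 (addr_ge0 p0 t0)) P0.
    by apply: filterS => w Hw _ _.
  pose H w := (X n s w, X n (s + t) w).
  have HE z : [set w | H w = z] = [set w | X n s w = z.1 /\ X n (s + t) w = z.2].
    by case: z => x y; apply/seteqP; split=> w /=; rewrite /H => -[<- <-].
  have mH z : measurable [set w | H w = z].
    rewrite HE; apply: measurableI; first exact: (measurable_state Pi_hom).
    by apply: (measurable_state Pi_hom); rewrite addr_ge0.
  pose A z := (j' \notin finset.pblock z.1 i') && (j' \in finset.pblock (z.2 : {set {set 'I_n}}) i').
  transitivity (prob P [set w | A (H w)]).
    congr prob; apply/seteqP; split=> w /=; rewrite /A /H/= !restrictionE => /andP; exact.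
  rewrite (prob_finite P mH A).
  under eq_bigr do rewrite HE joint_law//.
  rewrite -(pair_big_dep (fun x => j' \notin finset.pblock x i')
    (fun x y => j' \in finset.pblock y i') (fun x y => prob P [set w | X n s w = x] *
      transition (split_generator nu n) t x y))/=.
  apply: big1 => x xij; rewrite -mulr_sumr.
  have [xP|xP] := boolP (finset.partition x [set: 'I_n]%SET).
    by rewrite transition_separated// mulr0.
  rewrite (_ : [set w | _] = set0) /prob ?measure0 ?mul0r//.
  apply/seteqP; split=> // w /= wx.
  by move/negP: xP; apply; rewrite -wx restriction_partition.
apply: filterS H => w H i j s t s0 st tij.
have t0 := le_trans s0 st.
apply: contrapT => /negP sij.
have [e e0 He] := cadlag_right i j (homogeneous_cadlag Pi_hom w) t0.
have [e' e'0 He'] := cadlag_right i j (homogeneous_cadlag Pi_hom w) s0.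
have st' : s < t.
  by rewrite lt_neqAle st andbT; apply: contraNneq sij => ->.
have [q /[!in_itv]/= /andP[tq qe]] : exists q, ratr q \in `]t, t + e[.
  by apply: rat_in_itvoo; rewrite ltrDl.
have [p /[!in_itv]/= /andP[sp]] : exists p, ratr p \in `]s, (Num.min (s + e') t)[.
  by apply: rat_in_itvoo; rewrite lt_min st' ltrDl e'0.
rewrite lt_min => /andP[pe pt].
apply: (H ((i, j), (p, q))) => /=.
- exact: le_trans s0 (ltW sp).
- exact: le_trans (ltW pt) (ltW tq).
by rewrite He' ?(ltW sp)// sij He ?(ltW tq)//.
Qed.

(** Two integers stay together for an exponential time of parameter [lambda_2],
    which is positive. *)
Lemma ae_total : \forall w \ae P, forall i j, i != j -> exists2 t, 0 <= t & ~~ Pi t w i j.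
Proof.
have : \forall w \ae P, forall ij : nat * nat, ij.1 != ij.2 ->
    exists2 t, 0 <= t & ~~ Pi t w ij.1 ij.2.
  apply: ae_forall_countable => -[i j] /=.
  have [ij|] := boolP (i != j); last by move=> _; exact: aeW.
  have mE k : measurable [set w | Pi k%:R w i j] by exact: (measurable_same_block Pi_hom).
  pose A := \bigcap_k [set w | Pi k%:R w i j].
  have mA : measurable A by exact: bigcapT_measurable.
  have A0 : prob P A = 0.
    apply/eqP; rewrite eq_le prob_ge0 andbT.
    have lam0 := split_rate_gt0 nuD nu_infinite (ltnSn 1).
    apply: (le_expRN_eq0 lam0) => k; rewrite -(prob_pair ij)//.
    by apply: le_prob => //; exact: bigcap_inf.
  have := ae_prob0 mA A0; apply: filterS => w nA _.
  apply: contrapT => nE; apply: nA => k _ /=; apply: contrapT => /negP kij.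
  by apply: nE; exists k%:R.
by apply: filterS => w H i j ij; exact: (H (i, j)).
Qed.

Lemma ae_fragmenting_path : \forall w \ae P, fragmenting_path (fun t => Pi t w).
Proof.
move: ae_monotone; apply: filterS2 ae_total => w wt wm; split => //.
- exact: homogeneous_start Pi_hom w.
- by move=> i j t t0; apply: cadlag_right => //; exact: homogeneous_cadlag Pi_hom w.
Qed.

Local Notation block i y := (finset.pblock y i).

(** By exchangeability the other [n.-1] integers are equally likely to belong to
    the block of [i] while it is small, and a small block contains at most [M] of
    them. *)
Lemma prob_small_block n (i j : 'I_n) t M : i != j -> 0 <= t ->
  prob P [set w | Pi t w i j && (#|finset.pblock (X n t w) i| <= M)%N] * (n.-1)%:R <= M%:R.
Proof.
move=> ij t0; have mX (y : {set {set 'I_n}}) : measurable [set w | X n t w = y].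
  exact: (measurable_state Pi_hom).
pose E (j : 'I_n) (y : {set {set 'I_n}}) := (j \in finset.pblock y i) && (#|finset.pblock y i| <= M)%N.
pose a j := prob P [set w | E j (X n t w)].
have aE k : i != k -> a k = a j.
  move=> ik; pose f : 'I_n -> 'I_n := tperm j k.
  have finj : injective f by exact: perm_inj.
  have fi : f i = i by rewrite /f tpermD// eq_sym.
  rewrite /a -(prob_relabel Pi_hom (E k) finj t0); congr prob; apply/seteqP.
  have EE w : E k (relabel f (X n t w)) = E j (X n t w).
    have fj : f j = k by rewrite /f tpermL.
    have pE : finset.pblock (relabel f (X n t w)) i = (f @: finset.pblock (X n t w) i)%SET.
      apply/setP => l.
      have [g gf fg] := injF_bij finj.
      rewrite -{1}fi -{1}(fg l) pblock_relabel ?restriction_partition//.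
      by rewrite -{2}(fg l) mem_imset.
    by rewrite /E pE -{1}fj mem_imset// card_imset.
  by split=> w /=; rewrite EE.
have -> : prob P [set w | Pi t w i j && (#|finset.pblock (X n t w) i| <= M)%N] = a j.
  by congr prob; apply/seteqP; split=> w /=; rewrite /E restrictionE.
have -> : a j * (n.-1)%:R = \sum_(k | i != k) a k.
  rewrite (eq_bigr (fun=> a j)) => [|k ik]; last exact: aE.
  rewrite sumr_const mulr_natr; congr (_ *+ _).
  transitivity #|predC1 i|; last by apply: eq_card => k; rewrite !inE eq_sym.
  by rewrite cardC1 card_ord.
under eq_bigr do rewrite /a (prob_finite P mX (E _)) big_mkcond/=.
rewrite exchange_big/=.
apply: (@le_trans _ _ (\sum_y M%:R * prob P [set w | X n t w = y])).
  apply: ler_sum => y _; rewrite -big_mkcondr/= sumr_const -[leLHS]mulr_natl ler_wpM2r ?prob_ge0//.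
  rewrite ler_nat; have [yM|yM] := leqP #|finset.pblock y i| M; last first.
    by rewrite eq_card0// => k; rewrite unfold_in /= /E (leqNgt #|_| M) yM !andbF.
  apply: leq_trans yM; apply: subset_leq_card; apply/fintype.subsetP => k.
  by rewrite unfold_in => /and3P[].
rewrite -mulr_sumr ler_piMr// -(prob_finite P mX xpredT).
by apply: prob_le1; exact: (measurable_finite_pred mX (fun=> true)).
Qed.

End homogeneous_paths.

(** * Expectations of bounded random variables *)

Section expectation.
Variables (R : realType) (d : measure_display) (Omega : measurableType d)
  (P : probability Omega R).
Implicit Types f g : Omega -> R.

Definition bounded_rv f := measurable_fun setT f /\ exists C, forall w, `|f w| <= C.

Definition expect f : R := \int[P]_w f w.

Lemma bounded_rv_integrable f : bounded_rv f -> P.-integrable setT (EFin \o f).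
Proof.
move=> [mf [C fC]]; apply: measurable_bounded_integrable => //.
  by apply: le_lt_trans (probability_le1 _ _) _ => //; rewrite ltry.
exists C; split; first exact: num_real.
by move=> x Cx w _; apply: le_trans (fC w) (ltW Cx).
Qed.

Lemma bounded_rv_cst c : bounded_rv (fun=> c).
Proof. by split => //; exists `|c|. Qed.

Lemma bounded_rvD f g : bounded_rv f -> bounded_rv g -> bounded_rv (fun w => f w + g w).
Proof.
move=> [mf [C fC]] [mg [D gD]]; split; first exact: measurable_funD.
by exists (C + D) => w; apply: le_trans (ler_normD _ _) _; exact: lerD.
Qed.

Lemma bounded_rvM f g : bounded_rv f -> bounded_rv g -> bounded_rv (fun w => f w * g w).
Proof.
move=> [mf [C fC]] [mg [D gD]]; split; first exact: measurable_funM.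
by exists (C * D) => w; rewrite normrM ler_pM.
Qed.

Lemma bounded_rvZ c f : bounded_rv f -> bounded_rv (fun w => c * f w).
Proof. by apply: bounded_rvM; exact: bounded_rv_cst. Qed.

Lemma bounded_rvN f : bounded_rv f -> bounded_rv (fun w => - f w).
Proof.
by move=> /(bounded_rvZ (-1)); rewrite (_ : (fun w => -1 * f w) = fun w => - f w)//;
  apply/funext => w; rewrite mulN1r.
Qed.

Lemma bounded_rvB f g : bounded_rv f -> bounded_rv g -> bounded_rv (fun w => f w - g w).
Proof. by move=> bf bg; apply: bounded_rvD bf (bounded_rvN bg). Qed.

Lemma bounded_rvX f k : bounded_rv f -> bounded_rv (fun w => f w ^+ k).
Proof.
move=> bf; elim: k => [|k IHk].
  by under eq_fun do rewrite expr0; exact: bounded_rv_cst.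
by under eq_fun do rewrite exprS; exact: bounded_rvM.
Qed.

Lemma bounded_rv_sum I (r : seq I) (Q : pred I) (f : I -> Omega -> R) :
  (forall i, bounded_rv (f i)) -> bounded_rv (fun w => \sum_(i <- r | Q i) f i w).
Proof.
move=> bf; elim: r => [|i r IHr].
  by under eq_fun do rewrite big_nil; exact: bounded_rv_cst.
by under eq_fun do rewrite big_cons; case: (Q i) => //; exact: bounded_rvD.
Qed.

Lemma bounded_rv_bool (b : Omega -> bool) : measurable [set w | b w] ->
  bounded_rv (fun w => (b w)%:R).
Proof.
move=> mb; split; last by exists 1 => w; case: (b w); rewrite ?normr1 ?normr0.
rewrite (_ : (fun w => _) = \1_[set w | b w]); first exact: measurable_indic.
apply/funext => w; rewrite indicE; congr (_%:R).
by have [bw|bw] := boolP (b w); [rewrite mem_set|rewrite memNset//=; exact/negP].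
Qed.

Lemma expect_cst c : expect (fun=> c) = c.
Proof.
transitivity (c * fine (P setT)); first exact: Rintegral_cst.
by rewrite probability_setT mulr1.
Qed.

Lemma expectD f g : bounded_rv f -> bounded_rv g ->
  expect (fun w => f w + g w) = expect f + expect g.
Proof. by move=> bf bg; apply: RintegralD => //; exact: bounded_rv_integrable. Qed.

Lemma expectB f g : bounded_rv f -> bounded_rv g ->
  expect (fun w => f w - g w) = expect f - expect g.
Proof. by move=> bf bg; apply: RintegralB => //; exact: bounded_rv_integrable. Qed.

Lemma expectZ c f : bounded_rv f -> expect (fun w => c * f w) = c * expect f.
Proof. by move=> bf; apply: RintegralZl => //; exact: bounded_rv_integrable. Qed.

Lemma expect_sum I (r : seq I) (Q : pred I) (f : I -> Omega -> R) :
  (forall i, bounded_rv (f i)) ->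
  expect (fun w => \sum_(i <- r | Q i) f i w) = \sum_(i <- r | Q i) expect (f i).
Proof.
move=> bf; elim: r => [|i r IHr].
  by rewrite big_nil; under eq_fun do rewrite big_nil; exact: expect_cst.
rewrite big_cons; under eq_fun do rewrite big_cons; case: ifP => // Qi.
by rewrite expectD ?IHr//; exact: bounded_rv_sum.
Qed.

Lemma le_expect f g : bounded_rv f -> bounded_rv g -> (forall w, f w <= g w) ->
  expect f <= expect g.
Proof.
by move=> bf bg fg; apply: le_Rintegral => //; exact: bounded_rv_integrable.
Qed.

Lemma expect_bool (b : Omega -> bool) : measurable [set w | b w] ->
  expect (fun w => (b w)%:R) = prob P [set w | b w].
Proof.
move=> mb; rewrite /expect /prob /Rintegral; congr fine.
rewrite -[X in P X]setIT -integral_indic//; apply: eq_integral => w _; congr EFin.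
rewrite indicE; congr (_%:R).
by have [bw|bw] := boolP (b w); [rewrite mem_set|rewrite memNset//=; exact/negP].
Qed.

Lemma expectE f : bounded_rv f -> (\int[P]_w (f w)%:E = (expect f)%:E)%E.
Proof.
by move=> bf; rewrite /expect /Rintegral fineK//; exact: integrable_fin_num (bounded_rv_integrable bf).
Qed.

Lemma expect_cvg (f_ : nat -> Omega -> R) f C : (forall n, bounded_rv (f_ n)) -> bounded_rv f ->
  (forall n w, `|f_ n w| <= C) -> (\forall w \ae P, f_ n w @[n --> \oo] --> f w) ->
  expect (f_ n) @[n --> \oo] --> expect f.
Proof.
move=> bf_ bf fC fcv.
have [] := @dominated_convergence _ _ _ P setT measurableT
  (fun n w => (f_ n w)%:E) (fun w => (f w)%:E) (fun=> C%:E).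
- by move=> n; apply/measurable_EFinP; exact: (bf_ n).1.
- by apply/measurable_EFinP; exact: bf.1.
- apply: filterS fcv => w fw _; apply/fine_cvgP; split => //; exact: nearW.
- exact: (bounded_rv_integrable (bounded_rv_cst C)).
- by apply: aeW => w n _; rewrite lee_fin.
move=> _ _ /=; rewrite expectE// => /fine_cvgP[_].
apply: cvg_trans; apply: near_eq_cvg; apply: nearW => n /=.
by rewrite expectE.
Qed.

End expectation.

(** * Averages of indicators along the cubes *)

Section averages.
Variable R : realType.
Implicit Types a : nat -> bool.

Definition average a (n : nat) : R := (\sum_(j < n) a j)%:R / n%:R.

Lemma average_ge0 a n : 0 <= average a n.
Proof. by rewrite /average divr_ge0. Qed.

Lemma sum_bool_le a m n : (\sum_(m <= j < n) a j <= n - m)%N.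
Proof.
rewrite -[leqRHS]muln1 -sum_nat_const_nat; apply: leq_sum => j _.
exact: leq_b1.
Qed.

Lemma average_le1 a n : average a n <= 1.
Proof.
rewrite /average; have [->|n0] := posnP n; first by rewrite invr0 mulr0.
rewrite ler_pdivrMr ?ltr0n// mul1r ler_nat.
by have := sum_bool_le a 0 n; rewrite big_mkord subn0.
Qed.

(** The average of [n - m] new terms differs from the old one by at most 1, with
    weight [(n - m) / n]. *)
Lemma average_near a m n : (0 < m)%N -> (m <= n)%N ->
  `|average a n - average a m| <= 1 - m%:R / n%:R.
Proof.
move=> m0 mn; have n0 := leq_trans m0 mn.
have sm : (\sum_(j < m) a j <= m)%N.
  by have := sum_bool_le a 0 m; rewrite big_mkord subn0.
have := sum_bool_le a m n.
have : (\sum_(j < n) a j = \sum_(j < m) a j + \sum_(m <= j < n) a j)%N.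
  by rewrite -!(big_mkord xpredT (fun j => nat_of_bool (a j))) (big_cat_nat (n := m)).
rewrite /average; set s := (\sum_(j < m) a j)%N in sm *.
set r := (\sum_(m <= j < n) a j)%N => -> rnm.
have nR : (0 : R) < n%:R by rewrite ltr0n.
have mR : (0 : R) < m%:R by rewrite ltr0n.
have E : (s + r)%:R / n%:R - s%:R / m%:R =
    r%:R / n%:R - (s%:R / m%:R) * (1 - m%:R / n%:R) :> R.
  by rewrite natrD mulrBr mulr1 mulrA divfK ?gt_eqF//; lra.
rewrite E.
have mn1 : (0 : R) <= 1 - m%:R / n%:R by rewrite subr_ge0 ler_pdivrMr// mul1r ler_nat.
have sm1 : 0 <= (s%:R / m%:R : R) <= 1.
  by rewrite divr_ge0//= ler_pdivrMr// mul1r ler_nat.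
have rn1 : 0 <= (r%:R / n%:R : R) <= 1 - m%:R / n%:R.
  rewrite divr_ge0//= -[X in X - _](divff (lt0r_neq0 nR)) -mulrBl ler_pM2r ?invr_gt0//.
  by rewrite -natrB// ler_nat.
rewrite ler_norml; move: sm1 rn1 => /andP[s0 s1] /andP[r0 r1].
have := mulr_ge0 s0 mn1.
have := ler_piMl mn1 s1.
lra.
Qed.

(** Consecutive cubes have a ratio tending to 1, so that averages change little
    between them. *)
Lemma average_cvg a (l : R) : average a (k.+1 ^ 3)%N @[k --> \oo] --> l ->
  average a n @[n --> \oo] --> l.
Proof.
move=> /cvgrPdist_le al; apply/cvgrPdist_le => e e0.
have [K _ HK] := al (e / 2) ltac:(by rewrite divr_gt0).
(* The bound [3 / k.+2] below is at most [e / 2] as soon as [k] exceeds [6 / e]. *)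
pose J := maxn K (Num.bound (6 / e)).
near=> n.
have nJ : (J.+1 ^ 3 <= n)%N by near: n; exact: nbhs_infty_ge.
have [k [Jk kn nk]] : exists k, [/\ (J <= k)%N, (k.+1 ^ 3 <= n)%N & (n < k.+2 ^ 3)%N].
  have exP : exists k, (k.+1 ^ 3 <= n)%N by exists J.
  have bP k : (k.+1 ^ 3 <= n)%N -> (k <= n)%N.
    by apply: leq_trans; rewrite expnS (leq_trans (leqnSn k))// leq_pmulr// expn_gt0.
  case: (ex_maxnP exP bP) => k kn kmax; exists k; split => //; first exact: kmax.
  by rewrite ltnNge; apply/negP => /kmax; rewrite ltnn.
have kK : (K <= k)%N := leq_trans (leq_maxl _ _) Jk.
have k0 : (0 < k.+1 ^ 3)%N by rewrite expn_gt0.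
have := average_near a k0 kn; have := HK k kK => /=.
suff : 1 - (k.+1 ^ 3)%:R / n%:R <= e / 2 :> R.
  move=> H1 H2 H3.
  rewrite (_ : l - average a n = (l - average a (k.+1 ^ 3)) - (average a n - average a (k.+1 ^ 3))); last lra.
  by apply: le_trans (ler_normB _ _) _; lra.
have k2 : (0 : R) < k.+2%:R by rewrite ltr0n.
apply: (@le_trans _ _ (1 - (k.+1%:R / k.+2%:R) ^+ 3)).
  rewrite lerB// expr_div_n -!natrX ler_pM2l ?ltr0n// lef_pV2 ?posrE ?ltr0n ?expn_gt0//.
    by rewrite ler_nat ltnW.
  exact: leq_trans kn.
apply: le_trans (one_sub_expr_le 3 _) _.
  by rewrite divr_ge0//= ler_pdivrMr// mul1r ler_nat.
have -> : 1 - k.+1%:R / k.+2%:R = k.+2%:R^-1 :> R.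
  rewrite -[X in X - _](divff (lt0r_neq0 k2)) -mulrBl -natrB// subSnn mul1r//.
rewrite ler_pdivrMr// -ler_pdivrMl ?divr_gt0// invf_div mulrC mulrA -natrM.
have : (Num.bound (6 / e))%:R <= k.+2%:R :> R.
  by rewrite ler_nat (leq_trans (leq_maxr K _))// (leq_trans Jk)// ltnW.
apply: le_trans; apply: ltW; apply: archi_boundP; rewrite divr_ge0// ltW//.
Unshelve. all: by end_near. Qed.

End averages.

(** * Law of large numbers for exchangeable indicators *)

Lemma sum_inv_sq_le (R : realType) N : \sum_(0 <= k < N) (k.+1%:R ^+ 2)^-1 <= 2 :> R.
Proof.
suff : \sum_(0 <= k < N) (k.+1%:R ^+ 2)^-1 <= 2 * (1 - N.+1%:R^-1) :> R.
  by move=> H; apply: le_trans H _; rewrite ler_piMr// gerBl invr_ge0.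
elim: N => [|N IHN]; first by rewrite big_geq// invr1 subrr mulr0.
rewrite big_nat_recr//=; apply: le_trans (lerD IHN (lexx _)) _.
have n1 : (0 : R) < N.+1%:R by rewrite ltr0n.
have E : N.+2%:R = N.+1%:R + 1 :> R by rewrite -natr1.
rewrite E; set x := N.+1%:R in n1 *.
have x1 : 1 <= x by rewrite /x ler1n.
have xn : 0 < x + 1 by rewrite addr_gt0.
suff : (x ^+ 2)^-1 <= 2 * (x^-1 - (x + 1)^-1).
  by move: ((x ^+ 2)^-1) (x^-1) ((x + 1)^-1) => a b c; lra.
have -> : x^-1 - (x + 1)^-1 = (x * (x + 1))^-1.
  have : x^-1 * x = 1 by rewrite mulVf ?lt0r_neq0.
  have : (x + 1)^-1 * (x + 1) = 1 by rewrite mulVf ?lt0r_neq0.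
  rewrite invfM; move: (x^-1) ((x + 1)^-1) => u v vE uE.
  transitivity (u * (v * (x + 1)) - v * (u * x)); first by rewrite vE uE !mulr1.
  lra.
rewrite -ler_pdivrMl// -invfM lef_pV2 ?posrE ?mulr_gt0 ?exprn_gt0//.
nra.
Qed.

(** Trades absolute summability for a weighted summability of squares. *)
Lemma norm_le_sq (R : realType) (x c : R) : 0 < c -> `|x| <= c * x ^+ 2 + c^-1.
Proof.
move=> c0; rewrite -(ler_pM2l c0) mulrDr divff ?lt0r_neq0//.
rewrite -(real_normK (num_real x)); set y := `|x|.
have := sqr_ge0 (c * y - 2^-1); nra.
Qed.

Lemma ae_nneseries_fin (R : realType) (d : measure_display) (Omega : measurableType d)
    (P : probability Omega R) (V : nat -> Omega -> \bar R) (C : R) :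
  (forall k, measurable_fun setT (V k)) -> (forall k w, 0 <= V k w)%E ->
  (forall M, \sum_(0 <= k < M) \int[P]_w V k w <= C%:E)%E ->
  \forall w \ae P, (\sum_(0 <= k <oo) V k w < +oo)%E.
Proof.
move=> mV V0 sumV.
have intV : (\int[P]_w (\sum_(0 <= k <oo) V k w) < +oo)%E.
  rewrite integral_nneseries//; apply: (@le_lt_trans _ _ C%:E); last by rewrite ltry.
  apply: lime_le; first by apply: is_cvg_nneseries => k _ _; exact: integral_ge0.
  exact: nearW.
have intg : P.-integrable setT (fun w => \sum_(0 <= k <oo) V k w)%E.
  apply/integrableP; split.
    by apply: (@ge0_emeasurable_sum _ _ _ _ V xpredT) => // k w _ _.
  under eq_integral do rewrite gee0_abs ?nneseries_ge0//.
  exact: intV.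
apply: filterS (integrable_ae measurableT intg) => w /(_ I).
by rewrite ge0_fin_numE ?nneseries_ge0.
Qed.

Section exchangeable_indicators.
Variables (R : realType) (d : measure_display) (Omega : measurableType d)
  (P : probability Omega R) (Y : nat -> Omega -> bool) (m : nat -> R).
Hypothesis mY : forall j, measurable [set w | Y j w].
Hypothesis Y_law : forall l, uniq l -> prob P [set w | all (Y ^~ w) l] = m (size l).

Local Notation A n w := (@average R (Y ^~ w) n).
Local Notation E := (expect P).

Lemma measurable_all_indicators l : measurable [set w | all (Y ^~ w) l].
Proof.
elim: l => [|j l IHl] /=; first by rewrite (_ : [set w | _] = setT)//; apply/seteqP.
rewrite (_ : [set w | _] = [set w | Y j w] `&` [set w | all (Y ^~ w) l]).
  exact: measurableI.
by apply/seteqP; split=> w /= /andP.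
Qed.

Lemma bounded_rv_average n : bounded_rv (fun w => A n w).
Proof.
rewrite /average; under eq_fun do rewrite mulrC natr_sum.
by apply: bounded_rvZ; apply: bounded_rv_sum => j; exact: bounded_rv_bool.
Qed.

Lemma expect_indicator2 j k : E (fun w => (Y j w)%:R * (Y k w)%:R) = if j == k then m 1 else m 2.
Proof.
under eq_fun do rewrite -natrM mulnb.
rewrite expect_bool; last first.
  by have := measurable_all_indicators [:: j; k]; rewrite /=; under eq_set do rewrite andbT.
case: eqVneq => [->|jk].
  by rewrite -(Y_law (l := [:: k]))//; congr prob; apply/seteqP; split=> w /=; rewrite andbb andbT.
rewrite -(Y_law (l := [:: j; k])) /= ?inE ?jk//.
by congr prob; apply/seteqP; split=> w /=; rewrite andbT.
Qed.

(** Among the pairs of indices entering the product, a proportion [1 / n] is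
    diagonal. *)
Lemma expect_average2 k n : (0 < k)%N -> (k <= n)%N ->
  E (fun w => A n w * A k w) = m 2 + (m 1 - m 2) / n%:R.
Proof.
move=> k0 kn; have n0 := leq_trans k0 kn.
have bYY i j : bounded_rv (fun w => (Y i w)%:R * (Y j w)%:R : R).
  by apply: bounded_rvM; exact: bounded_rv_bool.
transitivity (E (fun w => (n%:R * k%:R)^-1 *
    \sum_(i < k) \sum_(j < n) (Y j w)%:R * (Y i w)%:R)).
  congr expect; apply/funext => w; rewrite /average !natr_sum mulf_div mulrC.
  congr (_ * _); rewrite exchange_big/= mulr_suml; apply: eq_bigr => j _.
  by rewrite mulr_sumr.
rewrite expectZ; last by do 2!apply: bounded_rv_sum => ?; exact: bYY.
rewrite expect_sum; last by move=> i; apply: bounded_rv_sum => j; exact: bYY.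
rewrite (eq_bigr (fun=> m 1 + (n%:R - 1) * m 2)); last first.
  move=> i _; rewrite expect_sum; last by move=> j; exact: bYY.
  under eq_bigr do rewrite expect_indicator2.
  have iN : (i < n)%N := leq_trans (ltn_ord i) kn.
  rewrite (bigD1 (Ordinal iN))//= eqxx; congr (_ + _).
  rewrite (eq_bigr (fun=> m 2)); last first.
    by move=> j ji; rewrite ifF//; apply: contraNF ji => /eqP ji; apply/eqP/val_inj.
  rewrite sumr_const -[LHS]mulr_natl; congr (_ * _).
  rewrite (_ : #|_| = n.-1); last by rewrite -[in RHS](card_ord n) -(cardC1 (Ordinal iN)).
  by rewrite -[in RHS](prednK n0) -natr1 addrK.
rewrite sumr_const card_ord -[(_ + _) *+ _]mulr_natl invfM.
have nR : (n%:R : R) != 0 by rewrite pnatr_eq0 -lt0n.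
have kR : (k%:R : R) != 0 by rewrite pnatr_eq0 -lt0n.
have : n%:R^-1 * n%:R = 1 :> R by rewrite mulVf.
have : k%:R^-1 * k%:R = 1 :> R by rewrite mulVf.
set u := n%:R; set v := k%:R; set u' := u^-1; set v' := v^-1 => vE uE.
clearbody u' v'.
transitivity ((v' * v) * (u' * m 1 + (u' * u) * m 2 - u' * m 2)); first by lra.
by rewrite vE uE; lra.
Qed.

Lemma expect_average_diff2 k n : (0 < k)%N -> (k <= n)%N ->
  E (fun w => (A n w - A k w) ^+ 2) = (m 1 - m 2) * (k%:R^-1 - n%:R^-1).
Proof.
move=> k0 kn.
have bA := bounded_rv_average.
transitivity (E (fun w => A n w * A n w - 2 * (A n w * A k w) + A k w * A k w)).
  by congr expect; apply/funext => w; lra.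
have b1 i j : bounded_rv (fun w => A i w * A j w) by exact: bounded_rvM.
rewrite expectD//; last by apply: bounded_rvB => //; exact: bounded_rvZ.
rewrite expectB//; last exact: bounded_rvZ.
rewrite expectZ// !expect_average2// ?(leq_trans k0)//; lra.
Qed.

(** Along the cubes, the increments of the averages are summable in mean square
    against the weights [k ^ 2], hence absolutely summable almost surely. *)
Lemma ae_average_cvg : \forall w \ae P, cvgn (fun n => A n w).
Proof.
pose c k := (k.+1 ^ 3)%N.
have c0 k : (0 < c k)%N by rewrite /c expn_gt0.
have cc k : (c k <= c k.+1)%N by rewrite /c leq_exp2r.
pose D k w := A (c k.+1) w - A (c k) w.
have bD k : bounded_rv (D k) by apply: bounded_rvB; exact: bounded_rv_average.
pose V k w : \bar R := (k.+1%:R ^+ 2 * D k w ^+ 2)%:E.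
have V0 k w : (0 <= V k w)%E by rewrite lee_fin mulr_ge0// sqr_ge0.
have bV k : bounded_rv (fun w => k.+1%:R ^+ 2 * D k w ^+ 2).
  by apply: bounded_rvZ; exact: bounded_rvX.
have mV k : measurable_fun setT (V k) by apply/measurable_EFinP; exact: (bV k).1.
have m12 : 0 <= m 1 - m 2.
  rewrite subr_ge0 -(Y_law (l := [:: 0%N]))// -(Y_law (l := [:: 0%N; 1%N]))//.
  by apply: le_prob; [exact: measurable_all_indicators|exact: measurable_all_indicators|
    move=> w /= /and3P[->]].
have EV k : (\int[P]_w V k w <= (3 * (m 1 - m 2) * (k.+1%:R ^+ 2)^-1)%:E)%E.
  rewrite expectE// lee_fin expectZ; last exact: bounded_rvX.
  rewrite expect_average_diff2//.
  have k1 : (0 : R) < k.+1%:R by rewrite ltr0n.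
  have k2 : (0 : R) < k.+2%:R by rewrite ltr0n.
  have -> : (c k)%:R^-1 - (c k.+1)%:R^-1 =
      (k.+1%:R ^+ 3)^-1 * (1 - (k.+1%:R / k.+2%:R) ^+ 3) :> R.
    rewrite /c !natrX expr_div_n mulrBr mulr1 mulrA mulVf ?mul1r//.
  have : 1 - (k.+1%:R / k.+2%:R) ^+ 3 <= 3 * k.+1%:R^-1 :> R.
    apply: le_trans (one_sub_expr_le 3 _) _.
      by rewrite divr_ge0//= ler_pdivrMr// mul1r ler_nat.
    have -> : 1 - k.+1%:R / k.+2%:R = k.+2%:R^-1 :> R.
      by rewrite -[X in X - _](divff (lt0r_neq0 k2)) -mulrBl -natrB// subSnn mul1r.
    by rewrite ler_pM2l// lef_pV2 ?posrE// ler_nat.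
  set x := 1 - _ ^+ 3 => x3.
  have -> : 3 * (m 1 - m 2) / k.+1%:R ^+ 2 =
      k.+1%:R ^+ 2 * ((m 1 - m 2) * ((k.+1%:R ^+ 3)^-1 * (3 * k.+1%:R^-1))) :> R.
    rewrite -!exprVn; have : k.+1%:R * k.+1%:R^-1 = 1 :> R by rewrite divff ?lt0r_neq0.
    set u := k.+1%:R; set v := u^-1 => uv.
    transitivity (3 * (m 1 - m 2) * v ^+ 2 * (u * v) ^+ 2); last lra.
    by rewrite uv expr1n mulr1.
  rewrite ler_wpM2l ?exprn_ge0// ler_wpM2l// ler_wpM2l// invr_ge0 exprn_ge0//.
have sumV M : (\sum_(0 <= k < M) \int[P]_w V k w <= (3 * (m 1 - m 2) * 2)%:E)%E.
  apply: (@le_trans _ _ (\sum_(0 <= k < M) (3 * (m 1 - m 2) * (k.+1%:R ^+ 2)^-1)%:E)%E).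
    by apply: lee_sum => k _; exact: EV.
  rewrite sumEFin lee_fin -mulr_sumr ler_wpM2l ?mulr_ge0//.
  exact: sum_inv_sq_le.
apply: filterS (ae_nneseries_fin mV V0 sumV) => w.
rewrite -ge0_fin_numE ?nneseries_ge0// => Vfin.
have cD : cvgn (fun k => A (c k) w).
  have -> : (fun k => A (c k) w) = fun k => A (c 0%N) w + series (D ^~ w) k.
    apply/funext => k; rewrite (eq_sum_telescope (fun k => A (c k) w) k); congr (_ + _).
  apply: is_cvgD; first exact: is_cvg_cst.
  apply: normed_cvg; apply: nondecreasing_is_cvgn.
    by apply: nondecreasing_series => k _ _; exact: normr_ge0.
  exists (fine (\sum_(0 <= k <oo) V k w)%E + 2) => _ [N _ <-] /=.
  apply: (@le_trans _ _ (\sum_(0 <= k < N) (k.+1%:R ^+ 2 * D k w ^+ 2) +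
      \sum_(0 <= k < N) (k.+1%:R ^+ 2)^-1)).
    rewrite -big_split/=; apply: ler_sum => k _; apply: norm_le_sq.
    by rewrite exprn_gt0.
  apply: lerD; last exact: sum_inv_sq_le.
  rewrite -lee_fin fineK// -sumEFin.
  by apply: nneseries_lim_ge => k _ _; exact: V0.
by apply/cvg_ex; have /cvg_ex[l Hl] := cD; exists l; exact: average_cvg.
Qed.

End exchangeable_indicators.

(** * Moments of the frequency of a block *)

Lemma cvg_of_le_inv (R : realType) (u : nat -> R) l C :
  (forall n, (0 < n)%N -> `|u n - l| <= C / n%:R) -> u n @[n --> \oo] --> l.
Proof.
move=> H; apply/cvgrPdist_le => e e0; near=> n.
have n0 : (0 < n)%N by near: n; exact: nbhs_infty_gt.
rewrite distrC; apply: le_trans (H n n0) _.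
rewrite ler_pdivrMr ?ltr0n// mulrC -ler_pdivrMr//.
by near: n; exact: nbhs_infty_ger.
Unshelve. all: by end_near. Qed.

Section exchangeable_moments.
Variables (R : realType) (d : measure_display) (Omega : measurableType d)
  (P : probability Omega R) (Y : nat -> Omega -> bool) (m : nat -> R).
Hypothesis mY : forall j, measurable [set w | Y j w].
Hypothesis Y_law : forall l, uniq l -> prob P [set w | all (Y ^~ w) l] = m (size l).
Local Notation A n w := (@average R (Y ^~ w) n).
Local Notation E := (expect P).

(** Truncating the upper limit makes [X] bounded everywhere, not just almost
    everywhere. *)
Lemma measurable_limit_average :
  exists2 X : Omega -> R, measurable_fun setT X /\ (forall w, 0 <= X w <= 1) &
    \forall w \ae P, A n w @[n --> \oo] --> X w.
Proof.
pose L w := limn_sup (fun n => A n w).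
exists (fun w => Num.min 1 (Num.max 0 (L w))).
  split; last by move=> w; rewrite le_min le_max lexx ler01 ge_min lexx.
  apply: measurable_minr => //; apply: measurable_maxr => //.
  apply: measurable_fun_limn_sup.
  - by move=> w _; exists 1 => _ [n _ <-]; exact: average_le1.
  - by move=> w _; exists 0 => _ [n _ <-]; exact: average_ge0.
  - by move=> n; have [] := @bounded_rv_average R _ _ _ mY n.
apply: filterS (ae_average_cvg mY Y_law) => w cw.
rewrite /L cvg_limn_supE// max_r; last first.
  by apply: limr_ge => //; apply: nearW => n; exact: average_ge0.
rewrite min_r//; apply: limr_le => //; apply: nearW => n; exact: average_le1.
Qed.

Variable X : Omega -> R.
Hypotheses (mX : measurable_fun setT X) (X01 : forall w, 0 <= X w <= 1).
Hypothesis AX : \forall w \ae P, A n w @[n --> \oo] --> X w.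

Let bX : bounded_rv X.
Proof.
split=> //; exists 1 => w; have /andP[X0 X1] := X01 w.
by rewrite ger0_norm.
Qed.

(** By induction on [a]: a factor [X] is the limit of the average of the [Y j], and
    for all but the few [j] in [l] a factor [Y j] acts like one more index. *)
Lemma expect_limit_average a l : uniq l ->
  E (fun w => X w ^+ a * (all (Y ^~ w) l)%:R) = m (a + size l)%N.
Proof.
elim: a l => [|a IHa] l ul.
  rewrite -(Y_law ul) -expect_bool; last exact: measurable_all_indicators.
  by congr expect; apply/funext => w; rewrite expr0 mul1r.
pose f k w := A k w * (X w ^+ a * (all (Y ^~ w) l)%:R).
have bf1 : bounded_rv (fun w => X w ^+ a * (all (Y ^~ w) l)%:R).
  apply: bounded_rvM; first exact: bounded_rvX.
  by apply: bounded_rv_bool; exact: measurable_all_indicators.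
have bf k : bounded_rv (f k) by apply: bounded_rvM bf1; exact: bounded_rv_average.
have fcv : E (f n) @[n --> \oo] --> E (fun w => X w ^+ a.+1 * (all (Y ^~ w) l)%:R).
  apply: (@expect_cvg _ _ _ _ _ _ 1) => //.
  - apply: bounded_rvM; first exact: bounded_rvX.
    by apply: bounded_rv_bool; exact: measurable_all_indicators.
  - move=> n w; have /andP[X0 X1] := X01 w.
    have H1 : `|A n w| <= 1 by rewrite ger0_norm ?average_ge0// average_le1.
    have H2 : `|X w ^+ a| <= 1 by rewrite ger0_norm ?exprn_ge0// exprn_ile1.
    have H3 : `|(all (Y ^~ w) l)%:R| <= 1 :> R by case: all; rewrite ?normr1 ?normr0.
    by rewrite /f normrM mulr_ile1// normrM mulr_ile1.
  - apply: filterS AX => w Aw; rewrite /f.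
    by rewrite exprS -mulrA; exact: cvgMr_tmp.
apply: (cvg_unique (@norm_hausdorff _ _) fcv).
(* Only the [j] in [l], at most [size l] of them, contribute to the error. *)
apply: (@cvg_of_le_inv _ _ _ ((size l)%:R * `|m (a + size l)%N - m (a.+1 + size l)%N|)) => n n0.
pose g (j : nat) w := X w ^+ a * (Y j w && all (Y ^~ w) l)%:R.
have bg j : bounded_rv (g j).
  apply: bounded_rvM; first exact: bounded_rvX.
  by apply: bounded_rv_bool; exact: (measurable_all_indicators mY (j :: l)).
have Eg j : E (g j) = if j \in l then m (a + size l)%N else m (a.+1 + size l)%N.
  case: ifPn => jl.
    rewrite -(IHa l ul); congr expect; apply/funext => w; rewrite /g; congr (_ * _%:R).
    by have [/allP/(_ j jl) ->|_] := boolP (all _ l); rewrite ?andbF.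
  by rewrite addSnnS -(IHa (j :: l))//= jl.
have -> : E (f n) = n%:R^-1 * \sum_(j < n) E (g j).
  rewrite -expect_sum// -expectZ; last exact: bounded_rv_sum.
  congr expect; apply/funext => w; rewrite /f /average natr_sum mulrAC mulrC; congr (_ * _).
  rewrite mulr_suml; apply: eq_bigr => j _; rewrite /g mulrCA; congr (_ * _).
  by rewrite -natrM mulnb.
have nR : (n%:R : R) != 0 by rewrite pnatr_eq0 -lt0n.
set b := m (a.+1 + size l)%N; set c := m (a + size l)%N.
have -> : n%:R^-1 * \sum_(j < n) E (g j) - b = n%:R^-1 * \sum_(j < n | (j : nat) \in l) (c - b).
  rewrite -[X in _ - X](mulKf nR) -mulrBr; congr (_ * _).
  have -> : n%:R * b = \sum_(j < n) b by rewrite sumr_const card_ord mulr_natl.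
  rewrite -sumrB [RHS]big_mkcond/=.
  by apply: eq_bigr => j _; rewrite Eg; case: ifP => _ //; rewrite subrr.
rewrite normrM ger0_norm ?invr_ge0// mulrC ler_pM2r ?invr_gt0 ?ltr0n//.
rewrite sumr_const -[in leLHS]mulr_natl normrM ger0_norm// ler_wpM2r// ler_nat.
rewrite cardE -(size_map val); apply: uniq_leq_size.
  by rewrite (map_inj_uniq val_inj) enum_uniq.
by move=> _ /mapP[j + ->]; rewrite mem_enum.
Qed.

Lemma expect_limit_expr k : E (fun w => X w ^+ k) = m k.
Proof.
have := @expect_limit_average k [::] isT; rewrite addn0 => <-.
by congr expect; apply/funext => w; rewrite mulr1.
Qed.

End exchangeable_moments.

Section frequencies.
Variables (R : realType) (nu : {measure set (mass_partition R) -> \bar R}).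
Hypotheses (nuD : dislocation_measure nu) (nu_infinite : nu setT = +oo%E).
Variables (d : measure_display) (Omega : measurableType d) (P : probability Omega R).
Local Notation E := (expect P).

(** [X] has the moments of the asymptotic frequency at time [t] of a tagged block. *)
Definition frequency_law (t : R) (X : Omega -> R) :=
  [/\ measurable_fun setT X, forall w, 0 <= X w <= 1 &
      forall k, E (fun w => X w ^+ k) = expR (- t * split_rate_of_size nu k.+1)].

Lemma frequency_law_bounded t X : frequency_law t X -> bounded_rv X.
Proof.
move=> [mX X01 _]; split=> //; exists 1 => w; have /andP[X0 X1] := X01 w.
by rewrite ger0_norm.
Qed.

(** The [N]-th moment of [1 - X] when [X] has the law [frequency_law t]. *)
Definition moment_poly N (t : R) : R :=
  \sum_(k < N.+1) (-1) ^+ k * 'C(N, k)%:R * expR (- t * split_rate_of_size nu k.+1).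

Lemma expect_one_sub_expr t X N : frequency_law t X ->
  E (fun w => (1 - X w) ^+ N) = moment_poly N t.
Proof.
move=> tX; have bX := frequency_law_bounded tX.
transitivity (E (fun w => \sum_(k < N.+1) (-1) ^+ k * 'C(N, k)%:R * X w ^+ k)).
  congr expect; apply/funext => w; rewrite exprBn; apply: eq_bigr => k _.
  by rewrite expr1n mulr1 mulrAC mulr_natr.
rewrite expect_sum; last by move=> k; apply: bounded_rvZ; exact: bounded_rvX.
apply: eq_bigr => k _; rewrite expectZ; last exact: bounded_rvX.
by case: tX => _ _ ->.
Qed.

Lemma measurable_eq0 (X : Omega -> R) : measurable_fun setT X -> measurable [set w | X w == 0].
Proof.
move=> mX; have := mX measurableT [set 0] (measurable_set1 _); rewrite setTI.
by congr measurable; apply/seteqP; split=> w /= /eqP.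
Qed.

(** The variable [(1 - X) ^+ N] equals 1 where [X] vanishes. *)
Lemma prob_frequency0_le t X N : frequency_law t X ->
  prob P [set w | X w == 0] <= moment_poly N t.
Proof.
move=> tX; rewrite -(expect_one_sub_expr N tX).
have [mX X01 _] := tX; have bX := frequency_law_bounded tX.
rewrite -expect_bool; last exact: measurable_eq0.
apply: le_expect.
- by apply: bounded_rv_bool; exact: measurable_eq0.
- by apply: bounded_rvX; apply: bounded_rvB => //; exact: bounded_rv_cst.
- move=> w; case: eqP => [->|_]; first by rewrite subr0 expr1n.
  by rewrite exprn_ge0// subr_ge0; have /andP[] := X01 w.
Qed.

(** The moments at time [2 * t] are the squares of the moments at time [t]: the
    frequency at time [2 * t] is distributed like the product of two independent
    copies of the frequency [X] at time [t], which vanishes with probability at most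
    twice that of [X]. Instead of a product space, [phi N x] is the expectation of
    [(1 - x * X) ^+ N], and [phi N (X w)] has expectation [moment_poly N (2 * t)]. *)
Lemma prob_frequency0_double t X X2 : frequency_law t X -> frequency_law (2 * t) X2 ->
  prob P [set w | X2 w == 0] <= 2 * prob P [set w | X w == 0].
Proof.
move=> tX tX2; have bX := frequency_law_bounded tX; have [mX X01 momX] := tX.
set h := prob P [set w | X w == 0].
pose mo k : R := expR (- t * split_rate_of_size nu k.+1).
pose phi N x : R := \sum_(k < N.+1) (-1) ^+ k * 'C(N, k)%:R * mo k * x ^+ k.
have bphi N : bounded_rv (fun w => phi N (X w)).
  by apply: bounded_rv_sum => k; apply: bounded_rvZ; exact: bounded_rvX.
have phiE N x : phi N x = E (fun w => (1 - x * X w) ^+ N).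
  transitivity (E (fun w => \sum_(k < N.+1) (-1) ^+ k * 'C(N, k)%:R * x ^+ k * X w ^+ k)).
    rewrite expect_sum; last by move=> k; apply: bounded_rvZ; exact: bounded_rvX.
    apply: eq_bigr => k _; rewrite expectZ; last exact: bounded_rvX.
    by rewrite momX mulrAC.
  congr expect; apply/funext => w; rewrite exprBn; apply: eq_bigr => k _.
  by rewrite expr1n mulr1 exprMn -[RHS]mulr_natr -mulrA mulrAC !mulrA.
have bx N x : bounded_rv (fun w => (1 - x * X w) ^+ N).
  by apply: bounded_rvX; apply: bounded_rvB; [exact: bounded_rv_cst|exact: bounded_rvZ].
have x01 N x w : 0 <= x <= 1 -> 0 <= (1 - x * X w) ^+ N <= 1.
  move=> /andP[x0 x1]; have /andP[X0 X1] := X01 w.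
  have : 0 <= x * X w <= 1 by rewrite mulr_ge0//= mulr_ile1.
  by move=> /andP[p0 p1]; rewrite exprn_ge0 ?exprn_ile1 ?subr_ge0// gerBl.
have phi01 N x : 0 <= x <= 1 -> 0 <= phi N x <= 1.
  move=> x1; rewrite phiE -[X in _ <= X <= _]addr0 -[X in X <= _ <= _](expect_cst P 0).
  rewrite -[X in _ <= _ <= X](expect_cst P 1) addr0; apply/andP; split.
    by apply: le_expect => //; [exact: bounded_rv_cst|move=> w; have /andP[] := x01 N x w x1].
  by apply: le_expect => //; [exact: bounded_rv_cst|move=> w; have /andP[] := x01 N x w x1].
have phi_cvg x : 0 < x <= 1 -> phi N x @[N --> \oo] --> h.
  move=> /andP[x0 x1]; rewrite /h -expect_bool; last exact: measurable_eq0.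
  under eq_cvg do rewrite phiE.
  apply: (@expect_cvg _ _ _ _ _ _ 1) => //.
  - by apply: bounded_rv_bool; exact: measurable_eq0.
  - move=> N w; have /andP[p0 p1] := x01 N x w ltac:(by rewrite (ltW x0)).
    by rewrite ger0_norm.
  - apply: aeW => w; have /andP[X0 X1] := X01 w; case: eqP => [->|/eqP Xn].
      by under eq_cvg do rewrite mulr0 subr0 expr1n; exact: cvg_cst.
    apply: cvg_expr; have p0 : 0 < x * X w by rewrite mulr_gt0// lt0r Xn.
    have p1 : x * X w <= 1 by rewrite mulr_ile1// ltW.
    by rewrite ger0_norm ?subr_ge0// gtrBl.
have bl : bounded_rv (fun w => if X w == 0 then 1 else h).
  rewrite (_ : (fun w => _) = fun w => h + (1 - h) * (X w == 0)%:R).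
    apply: bounded_rvD; first exact: bounded_rv_cst.
    by apply: bounded_rvZ; apply: bounded_rv_bool; exact: measurable_eq0.
  by apply/funext => w; case: eqP => _; rewrite ?mulr1 ?mulr0 ?addr0// addrC subrK.
have Ephi N : E (fun w => phi N (X w)) = moment_poly N (2 * t).
  rewrite expect_sum; last by move=> k; apply: bounded_rvZ; exact: bounded_rvX.
  apply: eq_bigr => k _; rewrite expectZ; last exact: bounded_rvX.
  by rewrite momX -[LHS]mulrA /mo -expRD; congr (_ * expR _); lra.
have cv : E (fun w => phi N (X w)) @[N --> \oo] --> E (fun w => if X w == 0 then 1 else h).
  apply: (@expect_cvg _ _ _ _ _ _ 1) => //.
  - by move=> N w; have /andP[p0 p1] := phi01 N (X w) (X01 w); rewrite ger0_norm.
  - apply: aeW => w; case: eqP => [->|/eqP Xn].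
      have -> : phi^~ 0 = fun=> 1; last exact: cvg_cst.
      apply/funext => N; rewrite phiE -[RHS](expect_cst P 1).
      by congr expect; apply/funext => w'; rewrite mul0r subr0 expr1n.
    by apply: phi_cvg; have /andP[X0 X1] := X01 w; rewrite lt0r Xn X0.
have h0 : 0 <= h by exact: prob_ge0.
have E2 : E (fun w => if X w == 0 then 1 else h) <= 2 * h.
  apply: (@le_trans _ _ (E (fun w => h + (X w == 0)%:R))).
    apply: le_expect => //.
      apply: bounded_rvD; first exact: bounded_rv_cst.
      by apply: bounded_rv_bool; exact: measurable_eq0.
    by move=> w; case: eqP => _; rewrite ?addr0// lerDr.
  rewrite expectD; [|exact: bounded_rv_cst|by apply: bounded_rv_bool; exact: measurable_eq0].
  rewrite expect_cst expect_bool; last exact: measurable_eq0.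
  by rewrite -/h; lra.
apply: le_trans E2; apply: (cvgr_to_ge cv); apply: nearW => N /=.
by rewrite Ephi; exact: prob_frequency0_le.
Qed.

End frequencies.

(** * Positivity of frequencies *)

Lemma le0_of_le_inv (R : realType) (x C : R) :
  (forall n, (0 < n)%N -> x <= C / n%:R) -> x <= 0.
Proof.
move=> H; have c0 : C / n%:R @[n --> \oo] --> 0.
  apply: (@cvg_of_le_inv _ _ _ `|C|) => n n0.
  by rewrite subr0 normrM normfV normr_nat.
apply: (cvgr_to_ge c0); near=> n; apply: H; near: n; exact: nbhs_infty_gt.
Unshelve. all: by end_near. Qed.

Lemma expRN_approx (R : realType) (y : R) : 0 <= y -> `|expR (- y) - 1 + y| <= y ^+ 2.
Proof.
move=> y0.
have lo := expR_ge1Dx (- y).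
have y1 : 0 < 1 + y by rewrite ltr_wpDr.
have hi : expR (- y) <= (1 + y)^-1.
  by rewrite expRN lef_pV2 ?posrE ?expR_gt0// expR_ge1Dx.
have : (1 + y)^-1 <= 1 - y + y ^+ 2.
  rewrite -(ler_pM2r y1) mulVf ?lt0r_neq0//.
  have : 0 <= y ^+ 3 by rewrite exprn_ge0.
  by rewrite exprS; lra.
by rewrite ler_norml; have := sqr_ge0 y; lra.
Qed.

Section positive_frequencies.
Variables (R : realType) (nu : {measure set (mass_partition R) -> \bar R}).
Hypotheses (nuD : dislocation_measure nu) (nu_infinite : nu setT = +oo%E).
Variables (d : measure_display) (Omega : measurableType d) (P : probability Omega R).

(** To first order in [1 / K] the exponentials of [moment_poly N (t / K)] may be
    replaced by [1 - t / K * lambda_k]; the constants cancel since [0 < N], and the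
    linear terms add up to [t / K * alternating_rate N]. *)
Lemma moment_poly_le N t K : (0 < N)%N -> 0 <= t -> (0 < K)%N ->
  K%:R * moment_poly nu N (t / K%:R) <= t * alternating_rate nu N +
  (\sum_(k < N.+1) 'C(N, k)%:R * (t * split_rate_of_size nu k.+1) ^+ 2) / K%:R.
Proof.
move=> N0 t0 K0.
have KR : 0 < (K%:R : R) by rewrite ltr0n.
have KV : K%:R * K%:R^-1 = 1 :> R by rewrite divff ?lt0r_neq0.
have -> : moment_poly nu N (t / K%:R) = \sum_(k < N.+1) (-1) ^+ k * 'C(N, k)%:R *
    (expR (- (t / K%:R) * split_rate_of_size nu k.+1) - 1).
  under [RHS]eq_bigr do rewrite mulrBr mulr1.
  rewrite sumrB [X in _ - X](_ : _ = (1 - 1) ^+ N); last first.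
    rewrite exprBn; apply: eq_bigr => k _.
    by rewrite !expr1n !mulr1 mulr_natr.
  by rewrite subrr expr0n eqn0Ngt N0 subr0.
rewrite /alternating_rate -lerBlDl !mulr_sumr mulr_suml -sumrB.
apply: ler_sum => k _.
set c := 'C(N, k)%:R; set lam := split_rate_of_size nu k.+1.
have lam0 : 0 <= lam := split_rate_ge0 nu k.+1.
pose y := t / K%:R * lam.
have y0 : 0 <= y by rewrite mulr_ge0// divr_ge0.
have c0 : 0 <= c :> R by rewrite ler0n.
have := expRN_approx y0; rewrite mulNr -/y; set e := expR (- y) => ey.
have -> : K%:R * ((-1) ^+ k * c * (e - 1)) - t * ((-1) ^+ k * c * - lam) =
    (-1) ^+ k * (K%:R * c * (e - 1 + y)).
  rewrite /y; transitivity (K%:R * ((-1) ^+ k * c * (e - 1)) + (K%:R * K%:R^-1) * (t * ((-1) ^+ k * c * lam))); last lra.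
  by rewrite KV; lra.
have -> : c * (t * lam) ^+ 2 / K%:R = K%:R * c * y ^+ 2.
  rewrite /y; set v := K%:R^-1 in KV *.
  transitivity ((K%:R * v) * (c * (t * lam) ^+ 2 * v)); first by rewrite KV mul1r.
  lra.
apply: le_trans (ler_norm _) _; rewrite normrM normrX normrN1 expr1n mul1r.
by rewrite normrM ger0_norm ?mulr_ge0// ler_wpM2l// mulr_ge0.
Qed.

Hypothesis freq_ex : forall t : R, 0 <= t -> exists X : Omega -> R, frequency_law nu P t X.

Lemma prob_frequency0_halving N t k X : 0 <= t -> frequency_law nu P t X ->
  prob P [set w | X w == 0] <= (2 ^ k)%:R * moment_poly nu N (t / (2 ^ k)%:R).
Proof.
elim: k t X => [|k IHk] t X t0 tX.
  by rewrite expn0 mul1r divr1; exact: prob_frequency0_le.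
have t2 : 0 <= t / 2 by rewrite divr_ge0.
have [X' tX'] := freq_ex t2.
have tX2 : frequency_law nu P (2 * (t / 2)) X by rewrite mulrC divfK.
apply: le_trans (prob_frequency0_double tX' tX2) _.
apply: le_trans (ler_wpM2l (ler0n R 2) (IHk (t / 2) X' t2 tX')) _.
by rewrite expnS natrM invfM [t * (_ * _)]mulrA mulrA.
Qed.

(** Cutting [0, t] into [2 ^ k] pieces and letting [k] tend to infinity bounds the
    probability by [t * alternating_rate N], for every [N]. *)
Lemma prob_frequency0 t X : 0 <= t -> frequency_law nu P t X ->
  prob P [set w | X w == 0] = 0.
Proof.
move=> t0 tX; apply/eqP; rewrite eq_le prob_ge0 andbT.
set p := prob _ _.
have pN N : (0 < N)%N -> p <= t * alternating_rate nu N.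
  move=> N0; rewrite -subr_le0.
  apply: (@le0_of_le_inv _ _
    (\sum_(k < N.+1) 'C(N, k)%:R * (t * split_rate_of_size nu k.+1) ^+ 2)) => k k0.
  have K0 : (0 < 2 ^ k)%N by rewrite expn_gt0.
  have := le_trans (prob_frequency0_halving N k t0 tX) (moment_poly_le N0 t0 K0).
  rewrite -/p -lerBlDl => H; apply: le_trans H _.
  rewrite ler_wpM2l ?sumr_ge0// => [i _|]; first by rewrite mulr_ge0// sqr_ge0.
  by rewrite lef_pV2 ?posrE ?ltr0n// ler_nat ltnW// ltn_expl.
have cv : t * alternating_rate nu N @[N --> \oo] --> t * 0.
  by apply: cvgMl_tmp; exact: alternating_rate_cvg0.
rewrite mulr0 in cv; apply: (cvgr_to_ge cv); near=> N; apply: pN.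
near: N; exact: nbhs_infty_gt.
Unshelve. all: by end_near. Qed.

End positive_frequencies.

Section homogeneous_frequencies.
Variables (R : realType) (d : measure_display) (Omega : measurableType d)
  (P : probability Omega R) (nu : {measure set (mass_partition R) -> \bar R})
  (Pi : R -> Omega -> nat_partition).
Hypotheses (nuD : dislocation_measure nu) (nu_infinite : nu setT = +oo%E).
Hypothesis Pi_hom : homogeneous_fragmentation P nu Pi.

Let Y i t j w := Pi t w i (bump i j).

Let mY i t j : 0 <= t -> measurable [set w | Y i t j w].
Proof. by move=> t0; exact: (measurable_same_block Pi_hom). Qed.

Let Y_law i t l : 0 <= t -> uniq l ->
  prob P [set w | all ((Y i t) ^~ w) l] = expR (- t * split_rate_of_size nu (size l).+1).
Proof.
move=> t0 ul; rewrite -(size_map (bump i)) -(prob_block_seq Pi_hom (i := i))//; last first.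
  rewrite /= map_inj_uniq ?ul ?andbT; last exact: can_inj (bumpK i).
  by apply/mapP => -[j _ ij]; have := neq_bump i j; rewrite -ij eqxx.
by congr prob; apply/seteqP; split=> w /=; rewrite all_map.
Qed.

(** The indicators that [j] belongs to the block of [i], for [j] different from
    [i], are exchangeable; adding the index [i] does not change the limit of the
    averages. *)
Lemma frequency_law_exists i t : 0 <= t -> exists2 X : Omega -> R, frequency_law nu P t X &
  \forall w \ae P, @average R (Pi t w i) n @[n --> \oo] --> X w.
Proof.
move=> t0.
pose m k := expR (- t * split_rate_of_size nu k.+1).
have mYt j : measurable [set w | Y i t j w] by exact: mY.
have Yt l : uniq l -> prob P [set w | all ((Y i t) ^~ w) l] = m (size l) by exact: Y_law.
have [X [mX X01] AX] := measurable_limit_average mYt Yt.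
exists X; first split => // k.
  exact: (expect_limit_expr mYt Yt mX X01 AX).
apply: filterS AX => w Aw.
suff : average R (Pi t w i) n.+1 @[n --> \oo] --> X w.
  by rewrite (cvg_shiftS (average R (Pi t w i))).
have H : (n%:R * @average R (Y i t ^~ w) n + 1) / n.+1%:R @[n --> \oo] --> X w.
  have -> : X w = X w * 1 + 0 by rewrite mulr1 addr0.
  have c1 : n%:R / n.+1%:R @[n --> \oo] --> (1 : R).
    apply: (@cvg_of_le_inv _ _ _ 1) => n n0.
    have n1 : (0 : R) < n.+1%:R by rewrite ltr0n.
    rewrite -[X in _ - X](divff (lt0r_neq0 n1)) -mulrBl -natr1 opprD addrA subrr sub0r.
    rewrite normrM normrN1 mul1r ger0_norm ?invr_ge0// mul1r.
    by rewrite lef_pV2 ?posrE ?ltr0n// lerDl.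
  have c2 : n.+1%:R^-1 @[n --> \oo] --> (0 : R).
    apply: (@cvg_of_le_inv _ _ _ 1) => n n0; rewrite subr0 ger0_norm ?invr_ge0// mul1r.
    by rewrite lef_pV2 ?posrE ?ltr0n// ler_nat.
  rewrite (_ : (fun n => _) = fun n => average R (Y i t ^~ w) n * (n%:R / n.+1%:R) + n.+1%:R^-1).
    exact: cvgD (cvgM Aw c1) c2.
  by apply/funext => n; rewrite mulrDl mul1r [n%:R * _]mulrC -mulrA.
apply: cvg_trans H; apply: near_eq_cvg; near=> n.
have iN : (i < n.+1)%N by near: n; exact: nbhs_infty_ge.
rewrite /= /average.
rewrite (bigD1_ord (Ordinal iN))//= nat_partition_refl.
rewrite natrD addrC; congr ((_ + _) / _).
have [->|n0] := posnP n; first by rewrite !big_ord0 mul0r.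
by rewrite mulrC divfK ?pnatr_eq0 -?lt0n.
Unshelve. all: by end_near. Qed.

Lemma ae_positive_frequency i t : 0 <= t ->
  \forall w \ae P, exists2 x : R, 0 < x & @average R (Pi t w i) n @[n --> \oo] --> x.
Proof.
move=> t0; have [X tX AX] := frequency_law_exists i t0.
have [mX X01 _] := tX.
have fex s : 0 <= s -> exists X : Omega -> R, frequency_law nu P s X.
  by move=> s0; have [Z sZ _] := frequency_law_exists 0 s0; exists Z.
have := ae_prob0 (measurable_eq0 mX) (prob_frequency0 nuD fex t0 tX).
apply: filterS2 AX => w Aw Xw; exists (X w) => //.
have /andP[X0 _] := X01 w; rewrite lt0r X0 andbT; apply/negP; exact: Xw.
Qed.

End homogeneous_frequencies.

(** * A compensated sum over a time grid *)


Section grid.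
Variables (R : realType) (d : measure_display) (Omega : measurableType d)
  (P : probability Omega R) (nu : {measure set (mass_partition R) -> \bar R})
  (Pi : R -> Omega -> nat_partition).
Hypotheses (nuD : dislocation_measure nu) (nu_infinite : nu setT = +oo%E).
Hypothesis Pi_hom : homogeneous_fragmentation P nu Pi.

Lemma expect_finite (T : finType) (H : Omega -> T) (F : T -> R) :
  (forall y, measurable [set w | H w = y]) ->
  expect P (fun w => F (H w)) = \sum_y F y * prob P [set w | H w = y].
Proof. by move=> mH; rewrite /expect /Rintegral integral_finite_fun. Qed.

Lemma bounded_rv_finite (T : finType) (H : Omega -> T) (F : T -> R) :
  (forall y, measurable [set w | H w = y]) -> bounded_rv (fun w => F (H w)).
Proof.
move=> mH; split; first exact: measurable_finite_fun.
exists (\sum_y `|F y|) => w; rewrite (bigD1 (H w))//= lerDl.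
by apply: sumr_ge0 => y _.
Qed.

Variables (n : nat) (h : R).
Hypothesis h0 : 0 < h.
Local Notation S := {set {set 'I_n}}.
Local Notation state l w := (restriction n (Pi (l%:R * h) w)).
Local Notation tr := (transition (split_generator nu n) h).

Lemma sum_transition t (x : S) :
  \sum_y transition (split_generator nu n) t x y = 1.
Proof.

transitivity (\sum_y transition (split_generator nu n) t x y * (fun=> 1) y).
  by apply: eq_bigr => y _; rewrite mulr1.
rewrite (@transition_split_eigen _ _ _ xpredT 0)//.
  by rewrite mulr0 expR0 mul1r.
move=> z _; rewrite mul0r big1// => B _; rewrite big1// => D _.
by rewrite subrr mulr0.
Qed.

Let grid_ge0 l : 0 <= l%:R * h.
Proof. by rewrite mulr_ge0// ltW. Qed.

Let mX l y : measurable [set w | state l w = y].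
Proof. exact: (measurable_state Pi_hom). Qed.

Let grid_next l : l.+1%:R * h = l%:R * h + h.
Proof. by rewrite -natr1 mulrDl mul1r. Qed.

Lemma grid_joint_law l x y :
  prob P [set w | (state l w, state l.+1 w) = (x, y)] = prob P [set w | state l w = x] * tr x y.
Proof.
rewrite -(joint_law Pi_hom)// ?(ltW h0)//; congr prob; apply/seteqP.
by split=> w /=; rewrite grid_next => -[-> ->].
Qed.

(** The Markov property at the grid time [l] given two earlier successive states,
    which is all that the orthogonality of increments requires. *)
Lemma grid_markov k l x0 x1 x y : (k < l)%N ->
  prob P [set w | (state k w, state k.+1 w, state l w, state l.+1 w) = (x0, x1, x, y)] =
  prob P [set w | (state k w, state k.+1 w, state l w) = (x0, x1, x)] * tr x y.
Proof.
move=> kl; have [_ mk] := homogeneous_markov Pi_hom n.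
have := mk [:: (k%:R * h, x0); (k.+1%:R * h, x1)] (l%:R * h) h x y (grid_ge0 l) (ltW h0).
have H1 (z : R * S) : z \in [:: (k%:R * h, x0); (k.+1%:R * h, x1)] -> 0 <= z.1 <= l%:R * h.
  rewrite !inE => /orP[] /eqP -> /=; rewrite grid_ge0 ler_wpM2r ?(ltW h0)// ler_nat//.
  exact: ltnW.
move=> /(_ H1) E; rewrite /prob.
have H2 w : (forall z : R * S, z \in [:: (k%:R * h, x0); (k.+1%:R * h, x1)] ->
    restriction n (Pi z.1 w) = z.2) <-> state k w = x0 /\ state k.+1 w = x1.
  split=> [H|[? ?] z]; last by rewrite !inE => /orP[] /eqP ->.
  by split; [apply: (H (k%:R * h, x0))|apply: (H (k.+1%:R * h, x1))]; rewrite !inE eqxx ?orbT.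
rewrite (_ : [set w | (_, _, _, _) = _] = [set w | [/\ forall z : R * S,
    z \in [:: (k%:R * h, x0); (k.+1%:R * h, x1)] -> restriction n (Pi z.1 w) = z.2,
    state l w = x & restriction n (Pi (l%:R * h + h) w) = y]]); last first.
  apply/seteqP; split=> w /=; rewrite (grid_next l).
    by case=> ? ? ? ?; split => //; apply/H2.
  by case=> /H2[-> ->] -> ->.
rewrite E -[LHS]/(fine (_ * _)%E) fineM//; last first.
  apply: fin_num_measure; rewrite (_ : [set w | _] =
    [set w | state k w = x0] `&` [set w | state k.+1 w = x1] `&` [set w | state l w = x]).
    by do 2 (apply: measurableI => //).
  by apply/seteqP; split=> w /= [] /H2.
congr (fine (P _) * _); apply/seteqP; split=> w /=.
  by case=> /H2[-> ->] ->.
by case=> ? ? ?; split=> //; apply/H2.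
Qed.

Variable g : S -> S -> R.
Hypothesis g_centred : forall x, finset.partition x [set: 'I_n]%SET ->
  \sum_y g x y * tr x y = 0.
Let incr l w := g (state l w) (state l.+1 w).

Let mpair (T1 T2 : finType) (H1 : Omega -> T1) (H2 : Omega -> T2) :
  (forall y, measurable [set w | H1 w = y]) -> (forall y, measurable [set w | H2 w = y]) ->
  forall y, measurable [set w | (H1 w, H2 w) = y].
Proof.
move=> m1 m2 [y1 y2].
rewrite (_ : [set w | _] = [set w | H1 w = y1] `&` [set w | H2 w = y2]).
  exact: measurableI.
by apply/seteqP; split=> w /= [-> ->].
Qed.

Let mX2 l := mpair (mX l) (mX l.+1).

Let mX4 k l := mpair (mpair (mX2 k) (mX l)) (mX l.+1).

Lemma bounded_incr l : bounded_rv (incr l).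
Proof. exact: (bounded_rv_finite (fun z => g z.1 z.2) (mX2 l)). Qed.

Lemma incr_orthogonal k l : (k < l)%N -> expect P (fun w => incr k w * incr l w) = 0.
Proof.
move=> kl.
have := expect_finite (fun z : S * S * S * S => g z.1.1.1 z.1.1.2 * g z.1.2 z.2) (mX4 k l).
rewrite [X in X = _ -> _](_ : _ = expect P (fun w => incr k w * incr l w))// => ->.
transitivity (\sum_z \sum_y g z.1.1 z.1.2 * g z.2 y *
    prob P [set w | (state k w, state k.+1 w, state l w, state l.+1 w) = (z, y)]).
  by rewrite pair_bigA; apply: eq_bigr => -[].
apply: big1 => -[[x0 x1] x] _ /=.
under eq_bigr => y _ do rewrite grid_markov//.
have [px|npx] := boolP (finset.partition x [set: 'I_n]%SET).
  transitivity (g x0 x1 * prob P [set w | (state k w, state k.+1 w, state l w) = (x0, x1, x)] *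
    \sum_y g x y * tr x y); last by rewrite g_centred// mulr0.
  by rewrite mulr_sumr; apply: eq_bigr => y _; lra.
apply: big1 => y _; rewrite (_ : [set w | _] = set0); last first.
  apply/seteqP; split=> w //= -[_ _ xE]; move: npx; rewrite -xE.
  by rewrite restriction_partition.
by rewrite /prob measure0 mul0r mulr0.
Qed.

(** Orthogonality of martingale increments. *)
Lemma expect_sum_incr_sq L :
  expect P (fun w => (\sum_(l < L) incr l w) ^+ 2) = \sum_(l < L) expect P (fun w => incr l w ^+ 2).
Proof.
have bi := bounded_incr.
elim: L => [|L IH].
  by under eq_fun do rewrite big_ord0 expr0n; rewrite big_ord0 expect_cst.
have bM : bounded_rv (fun w => \sum_(l < L) incr l w) by exact: bounded_rv_sum.
have bML : bounded_rv (fun w => \sum_(l < L) 2 * (incr l w * incr L w)).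
  by apply: bounded_rv_sum => l; apply: bounded_rvZ; exact: bounded_rvM.
transitivity (expect P (fun w => (\sum_(l < L) incr l w) ^+ 2 +
    ((\sum_(l < L) 2 * (incr l w * incr L w)) + incr L w ^+ 2))).
  congr expect; apply/funext => w; rewrite big_ord_recr/= -mulr_sumr -mulr_suml.
  by rewrite sqrrD -addrA mulr_natl.
have bX : bounded_rv (fun w => (\sum_(l < L) incr l w) ^+ 2) by exact: bounded_rvX.
have bL : bounded_rv (fun w => incr L w ^+ 2) by exact: bounded_rvX.
rewrite (expectD P bX (bounded_rvD bML bL)) (expectD P bML bL).
rewrite IH expect_sum; last by move=> l; apply: bounded_rvZ; exact: bounded_rvM.
rewrite [X in _ + (X + _)]big1 ?add0r; first by rewrite big_ord_recr.
move=> l _; by rewrite expectZ ?incr_orthogonal ?mulr0//; exact: bounded_rvM.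
Qed.

Lemma expect_incr_sq l :
  expect P (fun w => incr l w ^+ 2) =
  \sum_x prob P [set w | state l w = x] * \sum_y g x y ^+ 2 * tr x y.
Proof.
have := expect_finite (fun z : S * S => g z.1 z.2 ^+ 2) (mX2 l).
rewrite [X in X = _ -> _](_ : _ = expect P (fun w => incr l w ^+ 2))// => ->.
transitivity (\sum_x \sum_y g x y ^+ 2 *
    prob P [set w | (state l w, state l.+1 w) = (x, y)]).
  by rewrite pair_bigA; apply: eq_bigr => -[].
apply: eq_bigr => x _; rewrite mulr_sumr; apply: eq_bigr => y _.
by rewrite grid_joint_law; lra.
Qed.

End grid.

Section increments.
Variables (R : realType) (d : measure_display) (Omega : measurableType d)
  (P : probability Omega R) (nu : {measure set (mass_partition R) -> \bar R})
  (Pi : R -> Omega -> nat_partition).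
Hypotheses (nuD : dislocation_measure nu) (nu_infinite : nu setT = +oo%E).
Hypothesis Pi_hom : homogeneous_fragmentation P nu Pi.
Variables (n : nat) (i j : 'I_n) (h : R).
Hypotheses (ij : i != j) (h0 : 0 < h).
Local Notation rate B := (split_rate_of_size nu #|B|).
Local Notation state l w := (restriction n (Pi (l%:R * h) w)).
Local Notation lam2 := (split_rate_of_size nu 2).

(** The mean time that the block of [i] spends unchanged if it contains [j], and 0
    once [i] and [j] are separated. *)
Definition waiting_time (x : {set {set 'I_n}}) : R :=
  (j \in finset.pblock x i)%:R / rate (finset.pblock x i).

(** The waiting time is counted when the block of [i] changes during one step of
    length [h], and compensated by the probability of that change, so that to first
    order [h] is subtracted at each step before the separation of [i] and [j]. *)
Definition centred_increment (x y : {set {set 'I_n}}) : R :=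
  waiting_time x * ((finset.pblock y i != finset.pblock x i)%:R
                    - (1 - expR (- h * rate (finset.pblock x i)))).

Let lam_ge0 m : 0 <= split_rate_of_size nu m := split_rate_ge0 nu m.
Let lam2_gt0 : 0 < lam2 := split_rate_gt0 nuD nu_infinite (ltnSn 1).

Lemma card_block_pair x : finset.partition x [set: 'I_n]%SET ->
  j \in finset.pblock x i -> (1 < #|finset.pblock x i|)%N.
Proof.
move=> px jx; have /and3P[/eqP cx _ _] := px.
have ix : i \in finset.pblock x i by rewrite finset.mem_pblock cx inE.
rewrite (cardD1 i) ix (cardD1 j) inE/= jx (eq_sym j) ij.
by [].
Qed.

Lemma waiting_time_ge0 x : 0 <= waiting_time x.
Proof. by rewrite mulr_ge0// invr_ge0. Qed.

(** In one step the block of [i] is kept with probability [exp (- h * lambda)]. *)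
Lemma sum_transition_kept x (F : bool -> R) : finset.partition x [set: 'I_n]%SET ->
  \sum_y F (finset.pblock y i == finset.pblock x i) * transition (split_generator nu n) h x y =
  F true * expR (- h * rate (finset.pblock x i)) +
  F false * (1 - expR (- h * rate (finset.pblock x i))).
Proof.
move=> px; have s1 := sum_transition nu h x.
rewrite (bigID (fun y => finset.pblock y i == finset.pblock x i))/= transition_same_block// in s1.
rewrite (bigID (fun y => finset.pblock y i == finset.pblock x i))/=; congr (_ + _).
  by under eq_bigr => y -> do []; rewrite -mulr_sumr transition_same_block.
rewrite -s1 [X in X - _]addrC addrK mulr_sumr; apply: eq_bigr => y /negbTE ->//.
Qed.

Lemma sum_centred_increment x : finset.partition x [set: 'I_n]%SET ->
  \sum_y centred_increment x y * transition (split_generator nu n) h x y = 0.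
Proof.
move=> px; set q := expR (- h * rate (finset.pblock x i)).
rewrite (sum_transition_kept (fun b => waiting_time x * ((~~ b)%:R - (1 - q))))//.
by rewrite -/q /=; lra.
Qed.

Lemma centred_increment_sq x : finset.partition x [set: 'I_n]%SET ->
  \sum_y centred_increment x y ^+ 2 * transition (split_generator nu n) h x y <=
  h * waiting_time x.
Proof.
move=> px; set q := expR (- h * rate (finset.pblock x i)).
rewrite (sum_transition_kept (fun b => (waiting_time x * ((~~ b)%:R - (1 - q))) ^+ 2))// -/q /=.
rewrite [leLHS](_ : _ = waiting_time x ^+ 2 * (q - q ^+ 2)); last by lra.
have q0 : 0 < q := expR_gt0 _.
have q1 : 1 - q <= h * rate (finset.pblock x i).
  by have := expR_ge1Dx (- h * rate (finset.pblock x i)); rewrite -/q; lra.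
have wx := waiting_time_ge0 x.
have q2 : q - q ^+ 2 <= h * rate (finset.pblock x i) by have := sqr_ge0 (1 - q); lra.
apply: le_trans (ler_wpM2l (sqr_ge0 _) q2) _.
rewrite mulrCA ler_wpM2l ?(ltW h0)// expr2 -mulrA ler_piMr// /waiting_time.
have [jx|jx] := boolP (j \in _); last by rewrite !mul0r.
rewrite mul1r mulVf// lt0r_neq0// split_rate_gt0//; exact: card_block_pair.
Qed.

(** Large blocks have a short waiting time, and small blocks one of at most
    [1 / lambda_2]. *)
Lemma waiting_time_le x M : (0 < M)%N -> finset.partition x [set: 'I_n]%SET ->
  waiting_time x <= (split_rate_of_size nu M.+1)^-1 * (j \in finset.pblock x i)%:R +
    lam2^-1 * ((j \in finset.pblock x i) && (#|finset.pblock x i| <= M)%N)%:R.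
Proof.
move=> M0 px; rewrite /waiting_time.
have lM : 0 < split_rate_of_size nu M.+1 by rewrite split_rate_gt0.
have [jx|_] := boolP (j \in _); last by rewrite mul0r !mulr0 addr0.
have c2 := card_block_pair px jx.
have lx : 0 < rate (finset.pblock x i) by rewrite split_rate_gt0.
rewrite mul1r mulr1/=; case: leqP => [_|Mx].
  rewrite mulr1 -[leLHS]add0r lerD ?invr_ge0//.
  by rewrite lef_pV2 ?posrE// split_rate_nondecreasing.
by rewrite mulr0 addr0 lef_pV2 ?posrE// split_rate_nondecreasing.
Qed.

Lemma geometric_sum_le (c : R) L : 0 < c ->
  h * \sum_(l < L) expR (- (l%:R * h) * c) <= h + c^-1.
Proof.
move=> c0; set q := expR (- (h * c)).
have q0 : 0 < q := expR_gt0 _.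
have hc : 0 < h * c by rewrite mulr_gt0.
have q1 : q * (1 + h * c) <= 1.
  have := expR_ge1Dx (h * c); rewrite -(ler_pM2l q0).
  by rewrite /q -expRD addNr expR0.
have E : (1 - q) * \sum_(l < L) expR (- (l%:R * h) * c) <= 1.
  rewrite (_ : \sum_(l < L) _ = \sum_(l < L) q ^+ l); last first.
    apply: eq_bigr => l _; rewrite /q -expRM_natl; congr expR; lra.
  have := subrX1 q L; set s := \sum_(l < L) _ => e.
  have : 0 <= q ^+ L by rewrite exprn_ge0// ltW.
  lra.
set s := \sum_(l < L) _ in E *.
have s0 : 0 <= s by apply: sumr_ge0 => l _; exact: expR_ge0.
have cV : c * c^-1 = 1 by rewrite divff// gt_eqF.
have cV0 : 0 < c^-1 by rewrite invr_gt0.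
have : (h * c) * s <= (1 + h * c).
  have : (h * c) <= (1 - q) * (1 + h * c) by lra.
  move=> /(ler_wpM2r s0) H; apply: le_trans H _.
  have := ler_wpM2r (ltW (addr_gt0 ltr01 hc)) E; lra.
move=> /(ler_wpM2l (ltW cV0)).
rewrite (_ : c^-1 * (h * c * s) = (c * c^-1) * (h * s)); last lra.
rewrite (_ : c^-1 * (1 + h * c) = (c * c^-1) * h + c^-1); last lra.
by rewrite cV !mul1r.
Qed.

Lemma le_mul_of_le_sq (p a u : R) : 0 <= p -> 0 <= a -> 0 <= u -> p <= a ^+ 2 -> p <= u ^+ 2 -> p <= a * u.
Proof.
move=> p0 a0 u0 pa pu; rewrite -(@ler_pXn2r _ 2)// ?nnegrE ?mulr_ge0//.
by rewrite exprMn expr2 ler_pM.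
Qed.

(** At time [t] the pair is together with probability [u ^+ 2], where
    [u = exp (- t * lambda_2 / 2)], and moreover in a block with at most [M]
    elements with probability at most [alpha ^+ 2]. The geometric mean of these two
    bounds is small with [alpha] and still summable over the grid. *)
Lemma expect_waiting_time_le l M alpha : (0 < M)%N -> 0 <= alpha ->
  M%:R <= alpha ^+ 2 * (n.-1)%:R ->
  expect P (fun w => waiting_time (state l w)) <=
  ((split_rate_of_size nu M.+1)^-1 + alpha / lam2) * expR (- (l%:R * h) * (lam2 / 2)).
Proof.
move=> M0 a0 Ma; set t := l%:R * h.
have t0 : 0 <= t by rewrite mulr_ge0// ltW.
have mS y : measurable [set w | restriction n (Pi t w) = y] by exact: (measurable_state Pi_hom).
have mf (A : pred {set {set 'I_n}}) : bounded_rv (fun w => (A (restriction n (Pi t w)))%:R : R).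
  exact: (bounded_rv_finite (fun x => (A x)%:R) mS).
set lM := split_rate_of_size nu M.+1.
have lM0 : 0 < lM by rewrite /lM split_rate_gt0.
pose A := [pred x : {set {set 'I_n}} | j \in finset.pblock x i].
pose B := [pred x | A x && (#|finset.pblock x i| <= M)%N].
have := @le_expect _ _ _ P _ _ (bounded_rv_finite waiting_time mS)
  (bounded_rvD (bounded_rvZ lM^-1 (mf A)) (bounded_rvZ lam2^-1 (mf B)))
  (fun w => waiting_time_le M0 (restriction_partition n (Pi t w))).
move=> H; apply: le_trans H _.
have bZ (C : pred {set {set 'I_n}}) c := bounded_rvZ c (mf C).
rewrite (expectD P (bZ A _) (bZ B _)) !expectZ// !expect_bool; last 2 first.
- exact: (measurable_finite_pred mS (fun x => B x)).
- exact: (measurable_finite_pred mS (fun x => A x)).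
set u := expR (- t * (lam2 / 2)).
have u0 : 0 < u := expR_gt0 _.
have u1 : u <= 1.
  by rewrite -expR0 ler_expR mulNr oppr_le0 mulr_ge0// divr_ge0.
have pA : prob P [set w | A (restriction n (Pi t w))] = u ^+ 2.
  rewrite (_ : [set w | _] = [set w | Pi t w i j]); last first.
    by apply/seteqP; split=> w /=; rewrite restrictionE.
  rewrite (prob_pair Pi_hom)// -expRM_natl; congr expR; lra.
set p := prob P [set w | B _].
have p0 : 0 <= p by exact: prob_ge0.
have pB : p <= u ^+ 2.
  rewrite -pA; apply: le_prob.
  - exact: (measurable_finite_pred mS (fun x => B x)).
  - exact: (measurable_finite_pred mS (fun x => A x)).
  - by move=> w /= /andP[].
have n1 : (0 < n.-1)%N.
  case: (n) i j ij => [|[|m]]// [] // => [[]]//.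
  by move=> ? [] [].
have pa : p <= alpha ^+ 2.
  have n1' : 0 < (n.-1%:R : R) by rewrite ltr0n.
  rewrite -(ler_pM2r n1'); apply: le_trans Ma.
  have := prob_small_block Pi_hom M ij t0.
  rewrite (_ : [set w | _] = [set w | B (restriction n (Pi t w))])//.
  by apply/seteqP; split=> w /=; rewrite restrictionE.
have pu := le_mul_of_le_sq p0 a0 (ltW u0) pa pB.
rewrite pA mulrDl lerD//.
  apply: ler_wpM2l; first by rewrite invr_ge0 ltW.
  by rewrite expr2 ler_piMr// ltW.
by rewrite mulrAC mulrC ler_wpM2r ?invr_ge0.
Qed.

(** Approximates the difference between the total waiting time of the successive
    blocks containing [i] and [j] and the separation time of [i] and [j]. *)
Definition grid_error (f : R -> nat_partition) L :=
  \sum_(l < L) centred_increment (restriction n (f (l%:R * h))) (restriction n (f (l.+1%:R * h))).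

Lemma bounded_grid_error L : bounded_rv (fun w => grid_error (Pi ^~ w) L).
Proof. apply: bounded_rv_sum => l; exact: (bounded_incr Pi_hom). Qed.

(** The bound does not depend on the mesh or the number of steps, and it is small
    when [M] is large and [n] much larger. *)
Lemma expect_grid_error_sq L M alpha : (0 < M)%N -> 0 <= alpha -> h <= 1 ->
  M%:R <= alpha ^+ 2 * (n.-1)%:R ->
  expect P (fun w => grid_error (Pi ^~ w) L ^+ 2) <=
  (1 + 2 / lam2) * ((split_rate_of_size nu M.+1)^-1 + alpha / lam2).
Proof.
move=> M0 a0 h1 Ma.
rewrite (expect_sum_incr_sq Pi_hom h0 sum_centred_increment).
set K := _ + alpha / lam2.
have K0 : 0 <= K by rewrite addr_ge0 ?divr_ge0// invr_ge0.
apply: (@le_trans _ _ (\sum_(l < L) h * (K * expR (- (l%:R * h) * (lam2 / 2))))).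
  apply: ler_sum => l _; apply: le_trans (ler_wpM2l (ltW h0) (expect_waiting_time_le l M0 a0 Ma)).
  have mS y : measurable [set w | state l w = y].
    by apply: (measurable_state Pi_hom); rewrite mulr_ge0// ltW.
  rewrite (expect_incr_sq Pi_hom h0) (expect_finite P waiting_time mS) mulr_sumr.
  apply: ler_sum => x _; rewrite mulrA [leRHS]mulrC.
  have [px|npx] := boolP (finset.partition x [set: 'I_n]%SET).
    by apply: ler_wpM2l; [exact: prob_ge0|exact: centred_increment_sq].
  rewrite (_ : [set w | _] = set0) ?/prob ?measure0 ?mul0r ?mulr0//.
  apply/seteqP; split=> w //= xE; move: npx; rewrite -xE.
  by rewrite restriction_partition.
rewrite -mulr_sumr -mulr_sumr mulrCA mulrC ler_wpM2r//.
apply: le_trans (geometric_sum_le _ _) _; first by rewrite divr_gt0.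
by rewrite invfM invrK [_^-1 * _]mulrC lerD2r.
Qed.

End increments.

(** * Recovering separation times from the trees *)


(** The mean waiting times of the vertices containing [i] and [j] add up to an
    estimate of the separation time of [i] and [j] that only uses the tree. *)
Definition tree_time (R : realType) (nu : {measure set (mass_partition R) -> \bar R})
    (n : nat) (V : {set {set 'I_n}}) (i j : 'I_n) : R :=
  \sum_(B in V | (i \in B) && (j \in B)) (split_rate_of_size nu #|B|)^-1.

(** A decreasing sequence of sets leaves each set that it visits exactly once: the
    summand is the increment of the indicator that [b l] is a proper subset of
    [b l0]. *)
Lemma sum_last_visit (R : realType) (T : finType) (b : nat -> {set T}) l0 L :
  (forall k l, (k <= l)%N -> b l \subset b k) -> (l0 <= L)%N -> b L != b l0 ->
  \sum_(l < L) ((b l == b l0) && (b l.+1 != b l))%:R = 1 :> R.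
Proof.
move=> mono l0L bL.
pose q l : R := (b l \proper b l0)%:R.
have step l : ((b l == b l0) && (b l.+1 != b l))%:R = q l.+1 - q l.
  rewrite /q !finset.properEneq; case: (ltnP l l0) => ll0.
    have s1 := mono _ _ ll0; have s0 := mono _ _ (ltnW ll0).
    have s2 := mono _ _ (leqnSn l).
    have e1 : (b l.+1 != b l0) && (b l.+1 \subset b l0) = false.
      by apply/negbTE; rewrite negb_and; case: eqP => //= /eqP; rewrite finset.eqEsubset s1 andbT.
    have e2 : (b l != b l0) && (b l \subset b l0) = false.
      by apply/negbTE; rewrite negb_and; case: eqP => //= /eqP; rewrite finset.eqEsubset s0 andbT.
    rewrite e1 e2 subrr; case: eqP => //= e.
    by rewrite finset.eqEsubset s2 e s1.
  rewrite (mono _ _ ll0) (mono _ _ (leqW ll0)) !andbT.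
  case: (eqVneq (b l) (b l0)) => [->|ne]/=; first by rewrite subr0.
  suff -> : b l.+1 != b l0 by rewrite subrr.
  apply: contraNneq ne => e; rewrite finset.eqEsubset (mono _ _ ll0) -e.
  exact: mono.
rewrite -(big_mkord xpredT (fun l => ((b l == b l0) && (b l.+1 != b l))%:R)).
rewrite (eq_bigr (fun l => q l.+1 - q l)) => [|l _]; last exact: step.
rewrite telescope_sumr// /q !finset.properEneq bL mono//=.
rewrite [X in _ - X](_ : _ = 0) ?subr0//.
by case: eqVneq => //= ne; move: ne; rewrite finset.eqEsubset (mono _ _ (leq0n l0)) andbT => /negbTE ->.
Qed.

Section path.
Variables (R : realType) (nu : {measure set (mass_partition R) -> \bar R}).
Hypotheses (nuD : dislocation_measure nu) (nu_infinite : nu setT = +oo%E).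
Variable f : R -> nat_partition.
Hypothesis fP : fragmenting_path f.
Variables (n : nat) (i j : 'I_n).
Hypothesis ij : i != j.
Local Notation rate B := (split_rate_of_size nu #|B|).
Local Notation state t := (restriction n (f t)).
Local Notation B t := (finset.pblock (restriction n (f t)) i).
Local Notation D := (separation_time f i j).

Lemma pblock_path_sub s t : 0 <= s -> s <= t -> B t \subset B s.
Proof.
move=> s0 st; apply/fintype.subsetP => k; rewrite !restrictionE.
exact: (fragmenting_monotone fP).
Qed.

Lemma pair_in_block t : 0 <= t -> (j \in B t) = (t < D).
Proof. by move=> t0; rewrite restrictionE (separation_timeP fP). Qed.

Lemma self_in_block t : i \in B t.
Proof. by rewrite restrictionE nat_partition_refl. Qed.

Lemma pblock_path_right t : 0 <= t -> exists2 e, 0 < e & forall u, t <= u < t + e -> B u = B t.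
Proof.
move=> t0.
have /choice[e eP] : forall k : 'I_n, exists e : R, 0 < e /\
    forall u, t <= u < t + e -> f u i k = f t i k.
  by move=> k; have [e ? ?] := fragmenting_right fP i k t0; exists e.
exists (\big[Order.min/1]_k e k).
  by apply: lt_bigmin => // k _; exact: (eP k).1.
move=> u /andP[tu ut]; apply/setP => k; rewrite !restrictionE (eP k).2// tu/=.
apply: lt_le_trans ut _; rewrite lerD2l; exact: bigmin_le_cond.
Qed.

Lemma vertex_block C : C \in tree_vertices n f -> i \in C -> exists2 t, 0 <= t & C = B t.
Proof.
rewrite inE => /asboolP[t t0 Ct] iC; exists t => //.
have /and3P[_ tr _] := restriction_partition n (f t).
by rewrite (finset.def_pblock tr Ct iC).
Qed.

Lemma block_vertex t : 0 <= t -> B t \in tree_vertices n f.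
Proof.
move=> t0; rewrite inE; apply/asboolP; exists t => //.
have /and3P[/eqP cv _ _] := restriction_partition n (f t).
by apply: finset.pblock_mem; rewrite cv inE.
Qed.

(** The horizon [steps k * mesh k] is [k.+1]: the grids become finer and longer. *)
Local Notation mesh k := (k.+1%:R^-1 : R).
Local Notation steps k := (k.+1 * k.+1)%N.

Let mesh_gt0 k : 0 < mesh k. Proof. by rewrite invr_gt0 ltr0n. Qed.

Let grid_ge0 l k : 0 <= l%:R * mesh k. Proof. by rewrite mulr_ge0. Qed.

Let mesh_cvg0 : mesh k @[k --> \oo] --> 0.
Proof.
apply: (@cvg_of_le_inv _ _ _ 1) => k k0; rewrite subr0 ger0_norm ?invr_ge0// mul1r.
by rewrite lef_pV2 ?posrE ?ltr0n// ler_nat.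
Qed.

Lemma grid_visit t e k : 0 <= t -> mesh k < e -> exists l, t <= l%:R * mesh k < t + e.
Proof.
move=> t0 he; exists (Num.truncn (t * k.+1%:R)).+1.
have k0 : 0 < (k.+1%:R : R) by rewrite ltr0n.
have := truncn_itv (mulr_ge0 t0 (ltW k0)); move=> /andP[lo hi].
apply/andP; split; first by rewrite ler_pdivlMr// ltW.
rewrite -natr1 mulrDl mul1r; apply: ler_ltD => //.
by rewrite ler_pdivrMr.
Qed.

Let horizon k : (steps k)%:R * mesh k = k.+1%:R :> R.
Proof. by rewrite natrM mulfK// pnatr_eq0. Qed.

Lemma near_horizon : \forall k \near \oo, D <= (steps k)%:R * mesh k.
Proof.
near=> k; rewrite horizon; apply: le_trans (_ : k%:R <= _); last by rewrite ler_nat.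
near: k; exact: nbhs_infty_ger.
Unshelve. all: by end_near. Qed.

(** There are finitely many vertices, and each one is occupied during an interval of
    time, hence seen by every fine enough grid. *)
Lemma jump_sum : \forall k \near \oo,
  \sum_(l < steps k) waiting_time nu i j (state (l%:R * mesh k)) *
     (B (l.+1%:R * mesh k) != B (l%:R * mesh k))%:R = tree_time nu (tree_vertices n f) i j.
Proof.
have visit (C : {set 'I_n}) : \forall k \near \oo, C \in tree_vertices n f -> i \in C ->
    exists l, B (l%:R * mesh k) = C.
  have [CV|] := boolP (C \in _); last by move=> _; exact: nearW.
  have [iC|] := boolP (i \in C); last by move=> _; exact: nearW.
  have [t t0 ->] := vertex_block CV iC.
  have [e e0 He] := pblock_path_right t0.
  near=> k => _ _.
  have he : mesh k < e by near: k; exact: (cvgr_lt _ mesh_cvg0).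
  by have [l lP] := grid_visit t0 he; exists l; exact: He.
have := filter_forall _ visit; move=> /(_ _) vis; apply: filterS2 vis near_horizon => k vis hor.
pose b l := B (l%:R * mesh k).
have mono l l' : (l <= l')%N -> b l' \subset b l.
  by move=> ll; apply: pblock_path_sub => //; rewrite ler_wpM2r ?(ltW (mesh_gt0 k))// ler_nat.
transitivity (\sum_(l < steps k) \sum_(C : {set 'I_n} | (i \in C) && (j \in C))
    (rate C)^-1 * ((b l == C) && (b l.+1 != b l))%:R).
  apply: eq_bigr => l _; rewrite /waiting_time -/(b l) -/(b l.+1).
  have ib : i \in b l by exact: self_in_block.
  have [jb|jb] := boolP (j \in b l); last first.
    rewrite !mul0r big1// => C /andP[_ jC]; case: eqVneq => [e|_]; last by rewrite mulr0.
    by rewrite e jC in jb.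
  rewrite (bigD1 (b l)) ?ib//= eqxx/= mul1r big1 ?addr0// => C /andP[_].
  by rewrite eq_sym => /negbTE ->; rewrite mulr0.
rewrite exchange_big/= /tree_time [RHS]big_mkcondl/=.
apply: eq_bigr => C /andP[iC jC]; rewrite -mulr_sumr.
have [CV|CV] := boolP (C \in _); last first.
  rewrite big1 ?mulr0// => l _; case: eqVneq => // e.
  by move: CV; rewrite -e block_vertex.
have [l0 bl0] := vis C CV iC; rewrite -[X in X = _]/(b l0) in bl0.
have jl0 : l0%:R * mesh k < D by rewrite -pair_in_block// -/(b l0) bl0.
have l0L : (l0 < steps k)%N.
  by have := lt_le_trans jl0 hor; rewrite ltr_pM2r// ltr_nat.
rewrite -bl0 (sum_last_visit R mono (ltnW l0L)) ?mulr1//.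
apply: contraTneq jC => e; rewrite -bl0 -e pair_in_block//.
by rewrite -leNgt.
Unshelve. all: by end_near. Qed.

(** The steps of length [h] started before time [t] cover [t] up to an error [h]. *)
Lemma grid_length_bounds h L (t : R) : 0 < h -> 0 <= t ->
  let s := \sum_(l < L) (if l%:R * h < t then h else 0) in
  [/\ (L%:R * h <= s) || (t <= s), s <= t + h & s <= L%:R * h].
Proof.
move=> h0 t0; elim: L => [|L /= [IH1 IH2 IH3]].
  by rewrite /= big_ord0 mul0r lexx addr_ge0// ltW.
rewrite /= big_ord_recr/=; set s := \sum_(l < L) _ in IH1 IH2 IH3 *.
rewrite -natr1 mulrDl mul1r.
case: ltP => Lt.
  have sL : L%:R * h <= s by case/orP: IH1 => // ts; lra.
  by split; [apply/orP; left|..]; lra.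
rewrite addr0; split=> //; last lra.
by apply/orP; right; case/orP: IH1 => //; lra.
Qed.

(** Each compensator is [h] up to an error of order [h ^+ 2], before the separation
    of [i] and [j]. *)
Lemma drift_sum_cvg :
  \sum_(l < steps k) waiting_time nu i j (state (l%:R * mesh k)) *
     (1 - expR (- mesh k * rate (B (l%:R * mesh k)))) @[k --> \oo] --> D.
Proof.
have D0 : 0 <= D by rewrite ltW// separation_time_gt0.
pose lam := split_rate_of_size nu n.
have lam0 : 0 <= lam := split_rate_ge0 nu n.
apply/cvgrPdist_le => e e0; near=> k.
set h := mesh k; have h0 : 0 < h := mesh_gt0 k.
have h1 : h <= 1 by rewrite invf_le1 ?ltr0n// ler1n.
pose phi l := if l%:R * h < D then h else 0.
have bound (l : nat) : `|waiting_time nu i j (state (l%:R * h)) *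
    (1 - expR (- h * rate (B (l%:R * h)))) - phi l| <= h * lam * phi l.
  have lh0 : 0 <= l%:R * h by exact: grid_ge0.
  rewrite /phi /waiting_time pair_in_block//; case: ltP => lD; last first.
    by rewrite !mul0r subr0 normr0 mulr0.
  have jB : j \in B (l%:R * h) by rewrite pair_in_block.
  have c2 := card_block_pair ij (restriction_partition n _) jB.
  set r := rate _.
  have c0 : (0 < #|B (l%:R * h)|)%N by apply/card_gt0P; exists i; exact: self_in_block.
  have rlam : r <= lam.
    by apply: split_rate_nondecreasing => //; rewrite -[X in (_ <= X)%N](card_ord n) max_card.
  have rp : 0 < r by exact: split_rate_gt0.
  have r0 := ltW rp; have rn0 := lt0r_neq0 rp.
  have := expRN_approx (mulr_ge0 (ltW h0) r0); rewrite mulNr.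
  set q := expR _ => hq.
  have -> : true%:R / r * (1 - q) - h = - (r^-1 * (q - 1 + h * r)).
    rewrite -[X in _ - X](mulfK rn0) [X in _ - X]mulrC mul1r; set v := r^-1; lra.
  rewrite normrN normrM ger0_norm ?invr_ge0//.
  apply: le_trans (ler_wpM2l _ hq) _; first by rewrite invr_ge0.
  have -> : r^-1 * (h * r) ^+ 2 = h * r * h.
    transitivity ((r^-1 * r) * (h * r * h)); last by rewrite mulVf// mul1r.
    by set v := r^-1; lra.
  by rewrite ler_wpM2r ?(ltW h0)// ler_wpM2l// ltW.
have [b1 b2 _] := grid_length_bounds (steps k) h0 D0.
set s := \sum_(l < _) _ in b1 b2; set u := \sum_(l < _) _.
have us : `|u - s| <= h * lam * s.
  rewrite /u /s -sumrB mulr_sumr; apply: le_trans (ler_norm_sum _ _ _) _.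
  by apply: ler_sum => l _; exact: bound.
have Ds : D <= s.
  have DL : D <= (steps k)%:R * mesh k by near: k; exact: near_horizon.
  by case/orP: b1 => //; exact: le_trans.
have hC : h * (lam * (D + 1) + 1) <= e.
  rewrite -ler_pdivlMr; last by rewrite ltr_wpDl// mulr_ge0// addr_ge0.
  rewrite /h; near: k; apply: (cvgr_le _ mesh_cvg0); rewrite divr_gt0//.
  by rewrite ltr_wpDl// mulr_ge0// addr_ge0.
have sD : h * lam * s <= h * lam * (D + 1).
  by rewrite ler_wpM2l ?mulr_ge0// ?(ltW h0)//; lra.
rewrite distrC; apply: le_trans hC.
have := ler_normD (u - s) (s - D); rewrite subrKA => H; apply: le_trans H _.
by rewrite (ger0_norm (_ : 0 <= s - D)) ?subr_ge0//; lra.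
Unshelve. all: by end_near. Qed.

Lemma grid_error_cvg :
  grid_error nu i j (mesh k) f (steps k) @[k --> \oo] -->
  tree_time nu (tree_vertices n f) i j - D.
Proof.
have jump : \sum_(l < steps k) waiting_time nu i j (state (l%:R * mesh k)) *
    (B (l.+1%:R * mesh k) != B (l%:R * mesh k))%:R @[k --> \oo] -->
    tree_time nu (tree_vertices n f) i j.
  apply: cvg_near_cst; exact: jump_sum.
have cB := cvgB jump drift_sum_cvg.
rewrite [X in X @ _ --> _](_ : _ = fun k =>
    \sum_(l < steps k) waiting_time nu i j (state (l%:R * mesh k)) *
      (B (l.+1%:R * mesh k) != B (l%:R * mesh k))%:R -
    \sum_(l < steps k) waiting_time nu i j (state (l%:R * mesh k)) *
      (1 - expR (- mesh k * rate (B (l%:R * mesh k))))); first exact: cB.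
apply/funext => k /=; rewrite /grid_error -sumrB; apply: eq_bigr => l _.
by rewrite /centred_increment mulrBr.
Qed.

End path.

Section limn_einf_facts.
Variable R : realType.
Implicit Types u : (\bar R)^nat.

Lemma limn_einf_ge u (c : \bar R) : (forall k, (c <= u k)%E) -> (c <= limn_einf u)%E.
Proof.
move=> cu; rewrite limn_einf_lim; apply: lime_ge; first exact: is_cvg_einfs.
by apply: nearW => n; apply: le_ereal_inf_tmp => _ [k _ <-].
Qed.

Lemma limn_einf_le u (c : \bar R) : (forall k, (u k <= c)%E) -> (limn_einf u <= c)%E.
Proof.
move=> uc; rewrite limn_einf_lim; apply: lime_le; first exact: is_cvg_einfs.
apply: nearW => n; apply: le_trans (uc n); apply: ereal_inf_lbound.
by exists n => /=.
Qed.

Lemma measurable_limn_einf (d : measure_display) (T : measurableType d)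
    (f : (T -> \bar R)^nat) :
  (forall n, measurable_fun setT (f n)) ->
  measurable_fun setT (fun x => limn_einf (f ^~ x)).
Proof.
move=> mf; apply: (@emeasurable_fun_cvg _ _ _ setT (fun n x => einfs (f ^~ x) n)).
  by move=> n; exact: measurable_fun_einfs.
by move=> x _; rewrite limn_einf_lim; exact: is_cvg_einfs.
Qed.

End limn_einf_facts.

Section reconstruction.
Variables (R : realType) (nu : {measure set (mass_partition R) -> \bar R}).
Hypotheses (nuD : dislocation_measure nu) (nu_infinite : nu setT = +oo%E).
Local Notation lam2 := (split_rate_of_size nu 2).

Definition sample_size m n := (m <= n)%N /\
  exists M alpha, [/\ (0 < M)%N, 0 <= alpha, M%:R <= alpha ^+ 2 * n%:R &
    (1 + 2 / lam2) * ((split_rate_of_size nu M.+1)^-1 + alpha / lam2) <= 2^-1 ^+ m].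

(** The sizes are chosen once and for all from [nu], as the decoding map has to be:
    [M] large and [alpha] small, then [n] large. *)
Lemma exists_sample_sizes : exists N : nat -> nat, forall m, sample_size m (N m).
Proof.
suff H : forall m, exists n, sample_size m n by have [N HN] := choice H; exists N.
move=> m.
have l2 : 0 < lam2 := split_rate_gt0 nuD nu_infinite (ltnSn 1).
set K := 1 + 2 / lam2.
have K0 : 0 < K by rewrite ltr_pwDl// divr_ge0// ltW.
set eps : R := 2^-1 ^+ m.
have eps0 : 0 < eps by rewrite exprn_gt0.
(* Each of the two terms multiplied by [K] in the bound will be [eps / (2 * K)]. *)
pose alpha := lam2 * (eps / (2 * K)).
have K2 : 0 < 2 * K by rewrite mulr_gt0.
have a0 : 0 < alpha by rewrite mulr_gt0// divr_gt0.
have [M M0 HM] : exists2 M, (0 < M)%N & (split_rate_of_size nu M.+1)^-1 <= eps / (2 * K).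
  have := split_rate_infty nuD nu_infinite.
  move=> /cvgryPge /(_ (2 * K / eps)) [M0 _ HM].
  exists M0.+1 => //.
  have := HM M0.+2 (leqW (leqnSn _)) => /= H.
  rewrite -[leRHS]invrK lef_pV2 ?posrE ?invf_div//.
  - by rewrite split_rate_gt0.
  - by rewrite divr_gt0.
exists (maxn m (Num.truncn (M%:R / alpha ^+ 2)).+1); split; first exact: leq_maxl.
exists M, alpha; split=> //; first exact: ltW.
  have a2 : 0 < alpha ^+ 2 by rewrite exprn_gt0.
  rewrite mulrC -ler_pdivrMr//; apply: (@le_trans _ _ (Num.truncn (M%:R / alpha ^+ 2)).+1%:R).
    exact/ltW/truncnS_gt.
  by rewrite ler_nat leq_maxr.
apply: (@le_trans _ _ (K * (eps / (2 * K) + eps / (2 * K)))).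
  by rewrite ler_wpM2l ?(ltW K0)// lerD// /alpha mulrAC divff ?mul1r// gt_eqF.
rewrite -/eps (_ : K * _ = (2 * K) * (2 * K)^-1 * eps); last by set v := _^-1; lra.
by rewrite divff ?mul1r// lt0r_neq0.
Qed.

Variables (N : nat -> nat).
Hypothesis N_sizes : forall m, sample_size m (N m).

Variables (d : measure_display) (Omega : measurableType d) (P : probability Omega R)
  (Pi : R -> Omega -> nat_partition).
Hypothesis Pi_hom : homogeneous_fragmentation P nu Pi.

Definition estimated_time (T : tree_sequence) i j m : R :=
  tree_time nu (T (N m)).1 (inord i) (inord j).

Lemma ae_cvg0_of_summable (V : nat -> Omega -> \bar R) : (forall m, measurable_fun setT (V m)) ->
  (forall m w, 0 <= V m w)%E -> (forall m, \int[P]_w V m w <= (2^-1 ^+ m)%:E)%E ->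
  \forall w \ae P, V m w @[m --> \oo] --> 0%E.
Proof.
move=> mV V0 EV.
have sumV L : (\sum_(0 <= k < L) \int[P]_w V k w <= 2%:E)%E.
  apply: (@le_trans _ _ (\sum_(0 <= k < L) (2^-1 ^+ k)%:E)%E).
    by apply: lee_sum => k _; exact: EV.
  rewrite sumEFin lee_fin big_mkord.
  have := subrX1 (2^-1 : R) L; set s := \sum_(k < L) _.
  have : 0 <= (2^-1 : R) ^+ L by rewrite exprn_ge0.
  by lra.
apply: filterS (ae_nneseries_fin mV V0 sumV) => w Vfin.
have tail := nneseries_tail_cvg Vfin (fun k _ => V0 k w).
apply: (squeeze_cvge _ (cvg_cst 0%E) tail).
apply: nearW => m; rewrite V0/=.
have := @nneseries_lim_ge R (V ^~ w) xpredT m m.+1 (fun k _ _ => V0 k w).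
by rewrite big_nat1.
Qed.

(** For each sample size the square of the estimation error is the limit of the
    squared grid errors, so Fatou's lemma carries the mean square bound over, and
    these bounds are summable along the chosen sizes. *)
Lemma ae_estimated_time_pair i j : i != j ->
  \forall w \ae P, estimated_time (trees (Pi ^~ w)) i j m @[m --> \oo] -->
    separation_time (Pi ^~ w) i j.
Proof.
move=> ij.
(* The shift by [m0] makes [i] and [j] belong to every sample. *)
pose m0 := (i + j)%N.
pose err k m w := grid_error nu (inord i : 'I_(N (m + m0)).+1) (inord j) k.+1%:R^-1 (Pi ^~ w)
  (k.+1 * k.+1).
have h0 k : 0 < (k.+1%:R^-1 : R) by rewrite invr_gt0.
have iN m : (i <= N (m + m0))%N.
  by apply: leq_trans (N_sizes _).1; rewrite /m0; lia.
have jN m : (j <= N (m + m0))%N.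
  by apply: leq_trans (N_sizes _).1; rewrite /m0; lia.
have ijm m : (inord i : 'I_(N (m + m0)).+1) != inord j.
  by rewrite -val_eqE/= !inordK// ?ltnS.
have berr k m : bounded_rv (err k m) by exact: (bounded_grid_error Pi_hom).
have berr2 k m : bounded_rv (fun w => err k m w ^+ 2) by exact: bounded_rvX.
pose V m w := limn_einf (fun k => (err k m w ^+ 2)%:E).
have mV0 k m : measurable_fun setT (fun w => (err k m w ^+ 2)%:E).
  by apply/measurable_EFinP; exact: (berr2 k m).1.
have V0 m w : (0 <= V m w)%E.
  by apply: limn_einf_ge => k; rewrite lee_fin sqr_ge0.
have mV m : measurable_fun setT (V m) by exact: measurable_limn_einf.
have EV m : (\int[P]_w V m w <= (2^-1 ^+ m)%:E)%E.
  have f0 k w : setT w -> (0 <= (err k m w ^+ 2)%:E)%E by rewrite lee_fin sqr_ge0.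
  apply: le_trans (fatou P measurableT (mV0 ^~ m) f0) _.
  apply: limn_einf_le => k; rewrite expectE// lee_fin.
  have [_ [M [alpha [M0 a0 Ma HM]]]] := N_sizes (m + m0).
  have k1 : k.+1%:R^-1 <= 1 :> R by rewrite invf_le1 ?ltr0n// ler1n.
  apply: le_trans (expect_grid_error_sq nuD nu_infinite Pi_hom (ijm m) (h0 k) _ M0 a0 k1 Ma) _.
  apply: le_trans HM _; rewrite exprD ler_piMr ?exprn_ge0// exprn_ile1//.
  by rewrite invf_le1// ler1n.
have := ae_cvg0_of_summable mV V0 EV.
apply: filterS2 (ae_fragmenting_path nuD nu_infinite Pi_hom) => w fP Vw.
pose D := separation_time (Pi ^~ w) i j.
pose S m := estimated_time (trees (Pi ^~ w)) i j m.
have VE m : V m w = ((S (m + m0)%N - D) ^+ 2)%:E.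
  have := grid_error_cvg nuD nu_infinite fP (ijm m).
  rewrite !inordK ?ltnS// => c; rewrite /V is_cvg_limn_einfE; last first.
    apply/cvg_ex; eexists; apply: cvg_EFin; first exact: nearW.
    by rewrite /comp; apply: (cvgM c c).
  apply/cvg_lim => //; apply: cvg_EFin; first exact: nearW.
  by rewrite /comp; apply: (cvgM c c).
suff : S (m + m0)%N @[m --> \oo] --> D by rewrite (cvg_shiftn m0 S).
have Vr : (S (m + m0)%N - D) ^+ 2 @[m --> \oo] --> 0.
  have : (fun m => ((S (m + m0)%N - D) ^+ 2)%:E) @ \oo --> 0%:E.
    by rewrite (_ : (fun m => _) = V ^~ w)//; apply/funext => m; rewrite VE.
  by move/fine_cvgP => [_].
apply/cvgrPdist_lt => e e0; near=> m.
rewrite distrC -ltr_sqr ?nnegrE ?(ltW e0)// real_normK ?num_real//.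
near: m; apply: (cvgr_lt _ Vr); by rewrite exprn_gt0.
Unshelve. all: by end_near. Qed.

End reconstruction.

(** * The decoding map and its measurability *)


Section frequency.
Variable R : realType.
Implicit Types B : pred nat.

(** An expression from which measurability can be read off, valid also when the
    averages diverge. *)
Lemma asymptotic_frequencyE B :
  asymptotic_frequency R B =
  if limn_einf (EFin \o average R B) == limn_esup (EFin \o average R B)
  then fine (limn_einf (EFin \o average R B)) else 0.
Proof.
set u := EFin \o _.
case: ifPn => [/eqP e|ne].
  have fin : limn_einf u \is a fin_num.
    rewrite fin_numElt; apply/andP; split.
      by apply: (@lt_le_trans _ _ 0%E) => //; apply: limn_einf_ge => k; rewrite lee_fin average_ge0.
    by apply: (@le_lt_trans _ _ 1%E); [apply: limn_einf_le => k; rewrite lee_fin average_le1|rewrite ltry].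
  have lo : einfs u @ \oo --> limn_einf u by rewrite limn_einf_lim; exact: is_cvg_einfs.
  have hi : esups u @ \oo --> limn_einf u by rewrite e limn_esup_lim; exact: is_cvg_esups.
  have cu : u @ \oo --> limn_einf u.
    apply: (squeeze_cvge _ lo hi); apply: nearW => n; apply/andP; split.
      by apply: ereal_inf_lbound; exists n => /=.
    by apply: ereal_sup_ubound; exists n => /=.
  rewrite /asymptotic_frequency; apply/cvg_lim => //.
  rewrite -(fineK fin) in cu; by have /fine_cvgP[_] := cu.
rewrite /asymptotic_frequency dvgP// => /cvg_ex[l cl].
have cu : u @ \oo --> l%:E by apply: cvg_EFin => //; exact: nearW.
by move: ne; rewrite !(cvg_limn_einf_sup cu) eqxx.
Qed.

Lemma asymptotic_frequency_le1 B : asymptotic_frequency R B <= 1.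
Proof.
rewrite asymptotic_frequencyE; case: ifP => // _.
set x := limn_einf _; have : (x <= 1)%E by apply: limn_einf_le => k; rewrite lee_fin average_le1.
by case: x => [r| |]//=; rewrite lee_fin.
Qed.

Lemma asymptotic_frequency_cvg B x : average R B n @[n --> \oo] --> x ->
  asymptotic_frequency R B = x.
Proof. by move=> /cvg_lim; apply. Qed.

Lemma asymptotic_frequency_gt0_cvg B : 0 < asymptotic_frequency R B ->
  average R B n @[n --> \oo] --> asymptotic_frequency R B.
Proof.
rewrite {1}/asymptotic_frequency => H.
have [//|/dvgP e] := pselect (cvgn (average R B)).
by move: H; rewrite -/(average R B) e ltxx.
Qed.

Lemma le_asymptotic_frequency B B' : (forall j, B j -> B' j) ->
  0 < asymptotic_frequency R B -> 0 < asymptotic_frequency R B' ->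
  asymptotic_frequency R B <= asymptotic_frequency R B'.
Proof.
move=> BB' /asymptotic_frequency_gt0_cvg c /asymptotic_frequency_gt0_cvg c'.
apply: (ler_cvg_to c c'); apply: nearW => n.
rewrite /average ler_wpM2r ?invr_ge0// ler_nat leq_sum// => i _.
by case: (boolP (B i)) => // /BB' ->.
Qed.

Lemma measurable_asymptotic_frequency (d : measure_display) (T : measurableType d)
    (b : T -> nat -> bool) : (forall j, measurable [set x | b x j]) ->
  measurable_fun setT (fun x => asymptotic_frequency R (b x)).
Proof.
move=> mb.
have mA n : measurable_fun setT (fun x => (average R (b x) n)%:E).
  apply/measurable_EFinP; rewrite /average.
  apply: measurable_funM => //.
  under eq_fun do rewrite natr_sum.
  apply: measurable_sum => i; exact: (bounded_rv_bool R (mb i)).1.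
under eq_fun do rewrite asymptotic_frequencyE.
have mi : measurable_fun setT (fun x => limn_einf (EFin \o average R (b x))).
  exact: (measurable_limn_einf mA).
have ms : measurable_fun setT (fun x => limn_esup (EFin \o average R (b x))).
  exact: (measurable_fun_limn_esup mA).
apply: measurable_fun_ifT => //.
  exact: measurable_fun_eqe.
exact: measurableT_comp.
Qed.

Lemma measurable_neg_power (a : R) : measurable_fun setT (neg_power a).
Proof.
rewrite /neg_power; apply: measurable_fun_ifT => //.
  case: (0 < a); first by under eq_fun do rewrite andbT; exact: measurable_fun_eqr.
  under eq_fun do rewrite andbF; exact: measurable_cst.
by apply/measurable_EFinP; exact: measurable_powR.
Qed.

Lemma neg_power_ge0 (a x : R) : (0 <= neg_power a x)%E.
Proof. by rewrite /neg_power; case: ifP => // _; rewrite lee_fin powR_ge0. Qed.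

End frequency.

Definition partition_of_rel (e : rel nat) : nat_partition :=
  match pselect ([/\ reflexive e, symmetric e & transitive e]) with
  | left eP => NatPartition eP
  | right _ => one_block
  end.

Lemma partition_of_relK (pi : nat_partition) (e : rel nat) : (forall i j, e i j = pi i j) ->
  partition_of_rel e = pi.
Proof.
move=> epi; have -> : e = pi by apply/funext => i; apply/funext => j.
rewrite /partition_of_rel; case: pselect => [eP|[]]; last exact: nat_partitionP.
by case: pi {e epi} eP => e eP' eP; congr NatPartition; exact: Prop_irrelevance.
Qed.

Lemma measurable_partition_of_rel (d : measure_display) (T : measurableType d)
    (e : T -> rel nat) : (forall i j, measurable [set x | e x i j]) ->
  measurable_fun setT (fun x => partition_of_rel (e x)).
Proof.
move=> me.
have mt (A C : set T) : measurable A -> measurable C -> measurable [set x | A x -> C x].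
  move=> mA mC; rewrite (_ : [set x | _] = ~` A `|` C).
    by apply: measurableU => //; exact: measurableC.
  apply/seteqP; split=> x /=; last by case.
  by have [Ax|Ax] := pselect (A x) => H; [right; exact: H|left].
pose E := [set x | [/\ reflexive (e x), symmetric (e x) & transitive (e x)]].
have mE : measurable E.
  rewrite (_ : E = (\bigcap_i [set x | e x i i]) `&`
      (\bigcap_i \bigcap_j [set x | e x i j -> e x j i]) `&`
      (\bigcap_i \bigcap_j \bigcap_k [set x | e x j i -> e x i k -> e x j k])).
    apply: measurableI; first apply: measurableI.
    - by apply: bigcapT_measurable.
    - apply: bigcapT_measurable => i; apply: bigcapT_measurable => j.
      exact: (mt _ _ (me i j) (me j i)).
    - apply: bigcapT_measurable => i; apply: bigcapT_measurable => j.
      apply: bigcapT_measurable => k.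
      exact: (mt _ _ (me j i) (mt _ _ (me i k) (me j k))).
  apply/seteqP; split=> x /=.
    case=> r s t; split; first split.
    - by move=> i _; exact: r.
    - by move=> i _ j _ /=; rewrite s.
    - by move=> i _ j _ k _ /=; exact: t.
  case=> -[r s] t; split=> [i|i j|i j k]; first exact: r.
  - by apply/idP/idP; [exact: (s i I j I)|exact: (s j I i I)].
  - exact: (t i I j I k I).
apply: (measurability nat_partition_cylinders) => //.
move=> _ [_ [i [j ->]] <-]; rewrite setTI.
rewrite (_ : _ @^-1` _ = (E `&` [set x | e x i j]) `|` ~` E).
  by apply: measurableU; [exact: measurableI|exact: measurableC].
apply/seteqP; split=> x /=; rewrite /partition_of_rel; case: pselect => [Ex|nEx]/=.
- by move=> eij; left.
- by move=> _; right.
- by case=> [[]|].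
- by [].
Qed.

Lemma measurable_tree_component n (A : comb_tree n.+1 -> Prop) :
  measurable [set T : tree_sequence | A (T n)].
Proof.
apply: (measurable_finite_pred (H := fun T : tree_sequence => T n)) => y.
by apply: sub_sigma_algebra; exists n, y.
Qed.

Section decoding.
Variables (R : realType) (nu : {measure set (mass_partition R) -> \bar R}) (a : R)
  (N : nat -> nat).
Implicit Types T : tree_sequence.

(** The trees determine the separation times in the homogeneous fragmentation; these
    determine its blocks, hence the time changes, hence the self-similar
    fragmentation. The definitions that follow carry out this programme on an
    arbitrary sequence of trees, for which the estimates may diverge and the final
    relation may fail to be an equivalence: hence the lower limit, and the default
    value in [partition_of_rel]. *)
Definition decoded_time T i j : \bar R :=
  limn_einf (fun m => (estimated_time nu N T i j m)%:E).

Definition decoded_block T (r : R) i : pred nat :=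
  fun j => (i == j) || (r%:E < decoded_time T i j)%E.

Definition decoded_clock T (u : R) i : \bar R :=
  (\int[lebesgue_measure]_(r in `[0%R, u])
     neg_power a (asymptotic_frequency R (decoded_block T r i)))%E.

(** Two integers are together at time [t] if the clock of the first one has passed
    [t] before their separation. Rational times are enough since clocks are
    nondecreasing, and they make the event measurable. *)
Definition decoded_rel T (t : R) : rel nat := fun i j =>
  (i == j) || `[< exists q : rat, [/\ 0 <= (ratr q : R),
    ((ratr q : R)%:E < decoded_time T i j)%E & (t%:E < decoded_clock T (ratr q) i)%E] >].

Definition decoded_partition T t := partition_of_rel (decoded_rel T t).

Lemma measurable_decoded_time i j : measurable_fun setT (fun T => decoded_time T i j).
Proof.
apply: (measurable_limn_einf (f := fun m T => (estimated_time nu N T i j m)%:E)) => m.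
apply/measurable_EFinP.
apply: (measurable_finite_fun (H := fun T : tree_sequence => T (N m))
  _ (fun V => tree_time nu V.1 (inord i) (inord j))) => y.
exact: (measurable_tree_component (fun V => V = y)).
Qed.

(** By Tonelli's theorem, from the joint measurability in the tree sequence and the
    time. *)
Lemma measurable_decoded_clock u i : measurable_fun setT (fun T => decoded_clock T u i).
Proof.
pose g (z : tree_sequence * R) : \bar R :=
  if z.2 \in `[0%R, u] then neg_power a (asymptotic_frequency R (decoded_block z.1 z.2 i)) else 0%E.
have mfreq : measurable_fun setT
    (fun z : tree_sequence * R => asymptotic_frequency R (decoded_block z.1 z.2 i)).
  apply: measurable_asymptotic_frequency => j; rewrite /decoded_block.
  have [->|ij]/= := eqVneq i j; first by rewrite (_ : [set x | _] = setT)//; apply/seteqP; split.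
  rewrite -[X in measurable X]setTI; apply: measurable_lte => //.
    by apply/measurable_EFinP; exact: measurable_snd.
  apply: measurableT_comp (measurable_decoded_time i j) _; exact: measurable_fst.
have mg : measurable_fun setT g.
  apply: measurable_fun_ifT => //.
    apply: (measurable_fun_bool true); rewrite setTI.
    rewrite (_ : _ @^-1` _ = setT `*` `[0%R, u]%classic).
      exact: measurableX.
    by apply/seteqP; split=> -[x y] /=; [split|case].
  exact: measurableT_comp (measurable_neg_power a) mfreq.
have g0 z : (0 <= g z)%E by rewrite /g; case: ifP => // _; exact: neg_power_ge0.
have := measurable_fun_fubini_tonelli_F (m2 := @lebesgue_measure R) g mg g0.
rewrite (_ : fubini_F _ _ = fun T => decoded_clock T u i)//.
apply/funext => T; rewrite /fubini_F /decoded_clock [RHS]integral_mkcond.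
apply: eq_integral => r _; rewrite /g/= patchE; congr (if _ then _ else _).
by apply/idP/idP => [H|/set_mem//]; apply/mem_set.
Qed.

Lemma measurable_decoded_partition t : measurable_fun setT (fun T => decoded_partition T t).
Proof.
apply: measurable_partition_of_rel => i j; rewrite /decoded_rel.
have [->|ij]/= := eqVneq i j; first by rewrite (_ : [set x | _] = setT)//; apply/seteqP; split.
rewrite (_ : [set x | _] = \bigcup_(q : rat) [set T |
    [/\ 0 <= (ratr q : R), ((ratr q : R)%:E < decoded_time T i j)%E &
        (t%:E < decoded_clock T (ratr q) i)%E]]); last first.
  apply/seteqP; split=> T /=; first by move=> /asboolP[q H]; exists q.
  by move=> [q _ H]; apply/asboolP; exists q.
apply: bigcupT_measurable_rat => q.
have [q0|q0] := boolP (0 <= (ratr q : R)); last first.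
  by rewrite (_ : [set x | _] = set0)//; apply/seteqP; split=> // T [].
rewrite (_ : [set T | _] = [set T | ((ratr q : R)%:E < decoded_time T i j)%E] `&`
    [set T | (t%:E < decoded_clock T (ratr q) i)%E]); last first.
  by apply/seteqP; split=> T /= [].
apply: measurableI; rewrite -[X in measurable X]setTI; apply: measurable_lte => //.
  exact: measurable_decoded_time.
exact: measurable_decoded_clock.
Qed.

End decoding.

(** * Time change along a path *)


(** A positive lower bound on the frequency bounds the speed of the clock on both
    sides, whatever the sign of [a]. *)
Lemma neg_power_bounds (R : realType) (a x0 : R) : 0 < x0 -> exists c C : R, [/\ 0 < c, 0 <= C &
  forall x, x0 <= x <= 1 -> (c%:E <= neg_power a x <= C%:E)%E].
Proof.
move=> x00.
have npE x : x0 <= x <= 1 -> neg_power a x = (x `^ (- a))%:E.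
  by move=> /andP[xx _]; rewrite /neg_power gt_eqF// (lt_le_trans x00).
have nn x : x0 <= x -> x \is Num.nneg by move=> xx; rewrite nnegrE (le_trans (ltW x00)).
have [a0|a0] := leP a 0.
  exists (x0 `^ (- a)), 1; split => //; first exact: powR_gt0.
  move=> x /[dup] xx /andP[x1 x2]; rewrite npE// !lee_fin.
  have na : 0 <= - a by rewrite oppr_ge0.
  apply/andP; split; first by apply: (ge0_ler_powR na) => //; exact: nn.
  by have := ge0_ler_powR na (nn _ x1) _ x2; rewrite powR1; apply; rewrite nnegrE.
exists 1, (x0 `^ (- a)); split => //; first exact: powR_ge0.
move=> x /[dup] xx /andP[x1 x2]; rewrite npE// !lee_fin !powRN.
have xp : 0 < x := lt_le_trans x00 x1.
apply/andP; split.
  rewrite invf_ge1 ?powR_gt0//.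
  by have := ge0_ler_powR (ltW a0) (nn _ x1) _ x2; rewrite powR1; apply; rewrite nnegrE.
rewrite lef_pV2 ?posrE ?powR_gt0//.
by apply: (ge0_ler_powR (ltW a0)) => //; exact: nn.
Qed.

Lemma ae_lebesgueS (R : realType) (Q S : R -> Prop) : (forall r, Q r -> S r) ->
  (\forall r \ae @lebesgue_measure R, Q r) -> \forall r \ae @lebesgue_measure R, S r.
Proof. by move=> QS; apply: (@filterS _ _ (ae_filter_ringOfSetsType _)). Qed.

Lemma ae_lebesgue_exists (R : realType) (Q : R -> Prop) (s t : R) : s < t ->
  (\forall r \ae @lebesgue_measure R, Q r) -> exists2 r, s < r < t & Q r.
Proof.
move=> st [A [mA A0 QA]]; apply: contrapT => H.
have : (@lebesgue_measure R `]s, t[%classic <= @lebesgue_measure R A)%E.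
  apply: le_measure; rewrite ?inE//=.
  move=> r /=; rewrite in_itv/= => rst; apply: QA => /= Qr; apply: H; by exists r.
rewrite A0 lebesgue_measure_itv/= lte_fin st -EFinB lee_fin; lra.
Qed.

Section time_change.
Variables (R : realType) (a : R) (f : R -> nat_partition).
Hypothesis fP : fragmenting_path f.
Hypothesis f_freq : forall i, \forall r \ae @lebesgue_measure R, 0 <= r ->
  0 < asymptotic_frequency R (f r i).

(** Agrees with [f r i] for [0 <= r], and is measurable in [r] on the whole line. *)
Definition path_block (r : R) i : pred nat := fun j => (i == j) || (r < separation_time f i j).

Lemma path_blockE r i : 0 <= r -> (f r i : pred nat) = path_block r i.
Proof.
move=> r0; apply/funext => j; rewrite /path_block; have [->|ij]/= := eqVneq i j.
  by rewrite nat_partition_refl.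
exact: separation_timeP.
Qed.

Definition clock u i : \bar R :=
  (\int[lebesgue_measure]_(r in `[0%R, u]) neg_power a (asymptotic_frequency R (f r i)))%E.

Let rate i r := neg_power a (asymptotic_frequency R (path_block r i)).

Let clockE u i : clock u i = (\int[lebesgue_measure]_(r in `[0%R, u]) rate i r)%E.
Proof.
apply: eq_integral => r; rewrite inE/= in_itv/= => /andP[r0 _].
by rewrite /rate -path_blockE.
Qed.

Let mrate i : measurable_fun setT (rate i).
Proof.
apply: (measurableT_comp (measurable_neg_power a)).
apply: measurable_asymptotic_frequency => j; rewrite /path_block.
have [->|ij]/= := eqVneq i j; first by rewrite (_ : [set x | _] = setT)//; apply/seteqP; split.
rewrite (_ : [set x | _] = `]-oo, separation_time f i j[%classic)//.
Qed.

Let mrateD D i : measurable_fun D (rate i).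
Proof. exact: measurable_funTS. Qed.

Let rate_ge0 i r : (0 <= rate i r)%E. Proof. exact: neg_power_ge0. Qed.

Lemma clock_nondecreasing i u v : u <= v -> (clock u i <= clock v i)%E.
Proof.
move=> uv; rewrite !clockE; apply: ge0_subset_integral => //; first exact: mrateD.
by apply: subset_itvl; rewrite bnd_simp.
Qed.

(** Blocks decrease, so a positive frequency at a later time bounds all earlier
    frequencies from below. *)
Lemma ae_rate_bounds i u : exists c C : R, [/\ 0 < c, 0 <= C &
  \forall r \ae @lebesgue_measure R, 0 <= r <= u -> (c%:E <= rate i r <= C%:E)%E].
Proof.
pose v := Num.max u 0.
have v1 : v < v + 1 by rewrite ltrDl.
have v0 : 0 <= v by rewrite le_max lexx orbT.
have [r0 /andP[vr0 _] Hr0] := ae_lebesgue_exists v1 (f_freq i).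
have r00 : 0 <= r0 by rewrite (le_trans v0)// ltW.
have x0 := Hr0 r00.
have [c [C [c0 C0 H]]] := neg_power_bounds a x0.
exists c, C; split => //; apply: ae_lebesgueS (f_freq i) => r Hr /andP[r1 ru].
apply: H; rewrite -path_blockE// asymptotic_frequency_le1 andbT.
apply: le_asymptotic_frequency => //; last exact: Hr.
move=> j; apply: (fragmenting_monotone fP) => //.
by apply: le_trans (ltW vr0); rewrite le_max ru.
Qed.

Lemma clock_fin i u : clock u i \is a fin_num.
Proof.
have [c [C [c0 C0 H]]] := ae_rate_bounds i u.
rewrite ge0_fin_numE; last by apply: integral_ge0 => r _; exact: neg_power_ge0.
rewrite clockE.
apply: (@le_lt_trans _ _ (\int[lebesgue_measure]_(r in `[0%R, u]) (cst C%:E) r)%E).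
  apply: ae_ge0_le_integral => //=; first exact: mrateD.
  apply: ae_lebesgueS H => r H; rewrite /= in_itv/= => ru.
  by have /andP[] := H ru.
rewrite integral_cst//= lebesgue_measure_itv/=; case: ifP => _; last by rewrite mule0 ltry.
by rewrite -EFinB -EFinM ltry.
Qed.

(** Strict monotonicity is what makes every homogeneous time visited by the time
    change. *)
Lemma clock_increasing i s u : 0 <= s -> s < u -> (clock s i < clock u i)%E.
Proof.
move=> s0 su; have [c [C [c0 C0 H]]] := ae_rate_bounds i u.
have -> : clock u i = (clock s i + \int[lebesgue_measure]_(r in `]s, u]) rate i r)%E.
  rewrite !clockE (@itv_bndbnd_setU _ _ (BLeft 0) (BRight s) (BRight u)) ?bnd_simp ?(ltW su)//.
  rewrite ge0_integral_setU//; first exact: mrateD.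
  apply/disj_setPS => r [] /=; rewrite !in_itv/= => /andP[_ rs] /andP[sr _].
  by move: (le_lt_trans rs sr); rewrite ltxx.
rewrite lteDl ?clock_fin//.
apply: (@lt_le_trans _ _ (\int[lebesgue_measure]_(r in `]s, u]) (cst c%:E) r)%E).
  rewrite integral_cst//= lebesgue_measure_itv/= lte_fin su -EFinB -EFinM lte_fin.
  by rewrite mulr_gt0// subr_gt0.
apply: ae_ge0_le_integral => //=.
- by move=> r _; rewrite lee_fin ltW.
- exact: mrateD.
apply: ae_lebesgueS H => r H; rewrite /= in_itv/= => /andP[sr ru].
by have /andP[] := H (andb_true_intro (conj (ltW (le_lt_trans s0 sr)) ru)).
Qed.

Lemma time_change_clock i s : 0 <= s -> time_change a f i (fine (clock s i)) = s%:E.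
Proof.
move=> s0; rewrite /time_change; apply/eqP; rewrite eq_le; apply/andP; split.
  apply/lee_addgt0Pr => e e0; apply: ereal_inf_lbound; exists (s + e) => //.
  split; first by rewrite addr_ge0// ltW.
  by rewrite fineK ?clock_fin//; apply: clock_increasing => //; rewrite ltrDl.
apply: le_ereal_inf_tmp => _ [u [u0 tu] <-]; rewrite lee_fin leNgt; apply/negP => us.
move: tu; rewrite fineK ?clock_fin// => tu.
have := clock_nondecreasing i (ltW us); by rewrite leNgt => /negP; apply.
Qed.

Lemma time_change_ge0 i t : (0 <= time_change a f i t)%E.
Proof. by apply: le_ereal_inf_tmp => _ [u [u0 _] <-]; rewrite lee_fin. Qed.

Lemma time_changed_blockE i j t : i != j ->
  time_changed_block a f t i j = (time_change a f i t < (separation_time f i j)%:E)%E.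
Proof.
move=> ij; rewrite /time_changed_block; have := time_change_ge0 i t.
case: (time_change a f i t) => [u| |]//.
  by rewrite !lee_fin lte_fin => u0; exact: separation_timeP.
by move=> _; rewrite /= eq_sym (negbTE ij).
Qed.

(** Expresses the time change through its clock at rational times, as in
    [decoded_rel]. *)
Lemma time_change_lt i t (x : R) : (time_change a f i t < x%:E)%E <->
  exists q : rat, [/\ 0 <= (ratr q : R), (ratr q : R) < x & (t%:E < clock (ratr q) i)%E].
Proof.
split.
  move=> /ereal_inf_lt[_ [u [u0 tu] <-]]; rewrite lte_fin => ux.
  have [q] := rat_in_itvoo ux; rewrite in_itv/= => /andP[uq qx].
  exists q; split => //; first by rewrite (le_trans u0)// ltW.
  by apply: lt_le_trans tu _; apply: clock_nondecreasing; exact: ltW.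
move=> [q [q0 qx tq]]; apply: (@le_lt_trans _ _ (ratr q : R)%:E); last by rewrite lte_fin.
by apply: ereal_inf_lbound; exists (ratr q).
Qed.

Variable g : R -> nat_partition.
Hypothesis gE : forall t, 0 <= t -> forall i, g t i =1 time_changed_block a f t i.

(** The time changes differ from one integer to another, but each of them maps onto
    all homogeneous times, up to the limit in which all integers are separated:
    the blocks visited are the same. *)
Lemma tree_vertices_time_changed n : tree_vertices n g = tree_vertices n f.
Proof.
have vertexE (h : R -> nat_partition) B : B \in tree_vertices n h <->
    exists2 i : 'I_n, i \in B & exists2 t, 0 <= t & forall j : 'I_n, (j \in B) = h t i j.
  rewrite inE; split=> [/asboolP[t t0 Bt]|[i iB [t t0 H]]].
    have /and3P[_ tr nB] := restriction_partition n (h t).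
    have [B0|[i iB]] := set_0Vmem B; first by rewrite -B0 Bt in nB.
    exists i => //; exists t => // j.
    by rewrite -restrictionE (finset.def_pblock tr Bt iB).
  apply/asboolP; exists t => //.
  have -> : B = finset.pblock (restriction n (h t)) i.
    by apply/setP => j; rewrite restrictionE.
  have /and3P[/eqP cv _ _] := restriction_partition n (h t).
  by apply: finset.pblock_mem; rewrite cv inE.
apply/setP => B; apply/idP/idP => /vertexE[i iB [t t0 H]]; apply/vertexE; exists i => //.
  have H' (j : 'I_n) : (j \in B) = time_changed_block a f t i j by rewrite H gE.
  move: H'; rewrite /time_changed_block; have := time_change_ge0 i t.
  case: (time_change a f i t) => [u| |]// u0 H'; first by exists u.
  have /choice[T HT] : forall j : 'I_n, exists t, i != j -> 0 <= t /\ ~~ f t i j.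
    move=> j; have [->|ij] := eqVneq i j; first by exists 0.
    by have [s ? ?] := fragmenting_total fP (ij : (i : nat) != j); exists s.
  exists (\big[Order.max/0]_j T j).
    exact: bigmax_ge_id.
  move=> j; rewrite H' /=; have [<-|ij] := eqVneq (i : nat) j; first by rewrite nat_partition_refl.
  have [T0 TN] := HT j ij.
  apply/esym/negbTE; apply: contraNN TN.
  apply: (fragmenting_monotone fP) => //; exact: (le_bigmax _ T j).
exists (fine (clock t i)); first by rewrite fine_ge0//; apply: integral_ge0 => r _; exact: neg_power_ge0.
move=> j; rewrite H gE; last by rewrite fine_ge0//; apply: integral_ge0 => r _; exact: neg_power_ge0.
by rewrite /time_changed_block time_change_clock.
Qed.

Lemma trees_time_changed : trees g = trees f.
Proof.
apply: functional_extensionality_dep => n.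
by rewrite /trees /tree tree_vertices_time_changed.
Qed.

Variables (nu : {measure set (mass_partition R) -> \bar R}) (N : nat -> nat).
Hypothesis f_times : forall i j, i != j ->
  estimated_time nu N (trees f) i j m @[m --> \oo] --> separation_time f i j.

Lemma decoded_timeE i j : i != j ->
  decoded_time nu N (trees f) i j = (separation_time f i j)%:E.
Proof.
move=> ij; have c : (fun m => (estimated_time nu N (trees f) i j m)%:E) @ \oo -->
    (separation_time f i j)%:E.
  by apply: cvg_EFin; [exact: nearW|exact: f_times].
by rewrite /decoded_time is_cvg_limn_einfE; [exact/cvg_lim|apply/cvg_ex; eexists; exact: c].
Qed.

Lemma decoded_clockE u i : decoded_clock nu a N (trees f) u i = clock u i.
Proof.
rewrite clockE /decoded_clock; apply: eq_integral => r _; rewrite /rate.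
congr (neg_power _ (asymptotic_frequency _ _)); apply/funext => j.
rewrite /decoded_block /path_block; have [//|ij]/= := eqVneq i j.
by rewrite decoded_timeE// lte_fin.
Qed.

Lemma decoded_partitionE t : 0 <= t -> decoded_partition nu a N (trees g) t = g t.
Proof.
move=> t0; rewrite trees_time_changed; apply: partition_of_relK => i j; rewrite /decoded_rel.
have [->|ij]/= := eqVneq i j; first by rewrite nat_partition_refl.
rewrite gE// time_changed_blockE//; apply/asboolP/idP.
  move=> [q [q0 qD tq]]; apply/time_change_lt; exists q; split; first exact: q0.
    by rewrite decoded_timeE// lte_fin in qD.
  by rewrite -decoded_clockE; exact: tq.
move/time_change_lt => [q [q0 qD tq]]; exists q; split; first exact: q0.
  by rewrite decoded_timeE// lte_fin.
by rewrite decoded_clockE; exact: tq.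
Qed.

End time_change.

(** * Frequencies at almost every time, and conclusion *)


Section ae_frequencies.
Variables (R : realType) (d : measure_display) (Omega : measurableType d)
  (P : probability Omega R) (nu : {measure set (mass_partition R) -> \bar R})
  (Pi : R -> Omega -> nat_partition).
Hypotheses (nuD : dislocation_measure nu) (nu_infinite : nu setT = +oo%E).
Hypothesis Pi_hom : homogeneous_fragmentation P nu Pi.

(** Agrees with the block of [i] at time [r] on typical paths. Rational times make
    the condition a countable union of rectangles, hence jointly measurable. *)
Let block i (z : Omega * R) : pred nat := fun j =>
  `[< exists q : rat, [/\ 0 <= (ratr q : R), z.2 < ratr q & Pi (ratr q) z.1 i j] >].

Let blockE i w r : fragmenting_path (Pi ^~ w) -> 0 <= r -> block i (w, r) = Pi r w i.
Proof.
move=> fP r0; apply/funext => j; rewrite /block/=; apply/asboolP/idP.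
  by move=> [q [q0 rq]]; apply: (fragmenting_monotone fP) => //; exact: ltW.
move=> rij; have [e e0 He] := fragmenting_right fP i j r0.
have re : r < r + e by rewrite ltrDl.
have [q] := rat_in_itvoo re; rewrite in_itv/= => /andP[rq qe].
exists q; split=> //; first by rewrite (le_trans r0)// ltW.
by rewrite He// qe ltW.
Qed.

Let bad i := [set z : Omega * R | 0 <= z.2 /\ asymptotic_frequency R (block i z) <= 0].

Let measurable_bad i : measurable (bad i).
Proof.
have mf : measurable_fun setT (fun z : Omega * R => asymptotic_frequency R (block i z)).
  apply: measurable_asymptotic_frequency => j.
  rewrite (_ : [set x | _] = \bigcup_(q in [set q : rat | 0 <= (ratr q : R)])
      ([set w | Pi (ratr q) w i j] `*` `]-oo, (ratr q : R)[%classic)); last first.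
    apply/seteqP; split=> -[w r] /=; rewrite /block/=.
      by move=> /asboolP[q [q0 rq qij]]; exists q => //=; split=> //=; rewrite in_itv.
    move=> [q q0 [/= qij]]; rewrite in_itv/= => rq; apply/asboolP; by exists q.
  rewrite bigcup_mkcond; apply: bigcupT_measurable_rat => q; case: ifPn => // /set_mem q0.
  by apply: measurableX => //; exact: (measurable_same_block Pi_hom).
rewrite (_ : bad i = (setT `*` `[0%R, +oo[%classic) `&`
    (setT `&` (fun z => asymptotic_frequency R (block i z)) @^-1` `]-oo, 0%R]%classic)).
  apply: measurableI; first exact: measurableX.
  by apply: mf => //; exact: measurable_itv.
by apply/seteqP; split=> -[w r] /=; rewrite !in_itv/= andbT; [case|case=> -[_ ?] [_ ?]].
Qed.

Let prob_bad i r : P (ysection (bad i) r) = 0%E.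
Proof.
have mb : measurable (ysection (bad i) r) by exact: measurable_ysection.
have [r0|r0] := ltP r 0.
  rewrite (_ : ysection _ _ = set0) ?measure0//; apply/seteqP; split=> // w.
  by rewrite /ysection/= inE/= /bad/= => -[]; rewrite leNgt r0.
have : \forall w \ae P, ~ bad i (w, r).
  have fP := ae_fragmenting_path nuD nu_infinite Pi_hom.
  have pos := ae_positive_frequency nuD Pi_hom i r0.
  apply: filterS2 fP pos => w fP [x x0 cx].
  rewrite /bad/= blockE// => -[_].
  by rewrite (asymptotic_frequency_cvg cx) leNgt x0.
move=> [A [mA A0 sub]]; apply/eqP; rewrite eq_le measure_ge0 andbT -A0.
by apply: le_measure; rewrite ?inE// => w; rewrite /ysection/= inE => bw; apply: sub => /=; apply.
Qed.

(** At each fixed time frequencies are positive almost surely; by Fubini's theorem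
    they are, almost surely, positive at almost every time. *)
Lemma ae_frequencies : \forall w \ae P, forall i, \forall r \ae @lebesgue_measure R,
  0 <= r -> 0 < asymptotic_frequency R (Pi r w i).
Proof.
apply: ae_forall_countable => i.
have int0 : (\int[P]_w lebesgue_measure (xsection (bad i) w) = 0)%E.
  have GE : (\int[lebesgue_measure]_r fubini_G P (EFin \o \1_(bad i)) r = 0)%E.
    apply: integral0_eq => r _.
    by rewrite (indic_fubini_tonelli_GE P (measurable_bad i)); exact: prob_bad.
  rewrite -GE -(indic_fubini_tonelli P (@lebesgue_measure R) (measurable_bad i)).
  apply: eq_integral => w _.
  by rewrite (indic_fubini_tonelli_FE (@lebesgue_measure R) (measurable_bad i)).
have mx : measurable_fun setT (fun w => lebesgue_measure (xsection (bad i) w)).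
  have := indic_measurable_fun_fubini_tonelli_F (@lebesgue_measure R) (measurable_bad i).
  by rewrite (indic_fubini_tonelli_FE (@lebesgue_measure R) (measurable_bad i)).
have /(ae_eq_integral_abs P measurableT mx) : (\int[P]_w `|lebesgue_measure (xsection (bad i) w)| = 0)%E.
  by rewrite -int0; apply: eq_integral => w _; rewrite gee0_abs.
have fP := ae_fragmenting_path nuD nu_infinite Pi_hom.
apply: filterS2 fP => w fP /(_ I) /= x0.
exists (xsection (bad i) w); split=> //.
  exact: (measurable_xsection w (measurable_bad i)).
move=> r /= nr; rewrite /xsection/= inE/= /bad/=.
have [r0|r0] := boolP (0 <= r); last by case: nr => r0'; rewrite r0' in r0.
split=> //; rewrite blockE// leNgt; apply/negP => H; exact: nr.
Qed.

Lemma ae_estimated_time N : (forall m, sample_size nu m (N m)) ->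
  \forall w \ae P, forall i j, i != j ->
    estimated_time nu N (trees (Pi ^~ w)) i j m @[m --> \oo] --> separation_time (Pi ^~ w) i j.
Proof.
move=> HN; apply: ae_forall_countable => i; apply: ae_forall_countable => j.
have [->|ij] := eqVneq i j; first exact: nearW.
by apply: filterS (ae_estimated_time_pair nuD nu_infinite HN Pi_hom ij) => w H _.
Qed.

End ae_frequencies.

Theorem proposition2 (R : realType) (a : R)
    (nu : {measure set (mass_partition R) -> \bar R})
    (nu_dislocation : dislocation_measure nu)
    (nu_infinite : nu setT = +oo%E) :
  exists G : tree_sequence -> R -> nat_partition,
    (forall t : R, 0 <= t -> measurable_fun setT (fun T : tree_sequence => G T t)) /\
    forall (d : measure_display) (Omega : measurableType d)
      (P : probability Omega R) (Pi : R -> Omega -> nat_partition),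
      self_similar_fragmentation P a nu Pi ->
      {ae P, forall w, forall t : R, 0 <= t ->
        Pi t w = G (trees (fun u => Pi u w)) t}.
Proof.
have [N HN] := exists_sample_sizes nu_dislocation nu_infinite.
exists (decoded_partition nu a N); split=> [t _|d Omega P Pi [_ [Pi0 hom PiE]]].
  exact: measurable_decoded_partition.
have paths := ae_fragmenting_path nu_dislocation nu_infinite hom.
have freqs := ae_frequencies nu_dislocation nu_infinite hom.
have times := ae_estimated_time nu_dislocation nu_infinite hom HN.
apply: filterS2 (filterI paths freqs) (filterI times PiE) => w [fP wfreqs] [wtimes wE] t t0.
exact/esym/(decoded_partitionE fP wfreqs wE wtimes).
Qed.
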